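(* Let $[\cdot]_\beta$ be the superexpectation of the $\mathbb{S}^{2|2}_+$ model on $\Lambda$, and let $\mathbb{E}_{i,\boldsymbol{\ell}}$ be the expectation of the vertex-diminished jump process (VDJP). Let $g\colon(0,1]^\Lambda\to\mathbb{R}$ be a smooth compactly supported function, and let $a,b\in\Lambda$. Then $$\big[x_ax_b\,g(\boldsymbol{z})\big]_\beta=\int_0^\infty\mathbb{E}_{a,\boldsymbol{1}}\big(g(\boldsymbol{L}_t)1_{X_t=b}\big)\,dt.$$
   Context: $\Lambda$ is a finite set and $\beta=(\beta_{ij})_{i,j\in\Lambda}$ are edge weights with $\beta_{ij}=\beta_{ji}\ge0$ such that the graph with vertex set $\Lambda$ and edge set $\{\{i,j\}\mid\beta_{ij}>0\}$ is connected. Bold symbols denote objects indexed by $\Lambda$; $\boldsymbol{1}=(1)_{i\in\Lambda}$. Forms: let $\mathbb{B}^2\subset\mathbb{R}^2$ be the open unit disc. $\Omega^{2\Lambda}(\mathbb{B}^{2\Lambda})$ is the algebra over $C^\infty((\mathbb{B}^2)^\Lambda)$ (coordinates $(x_i,y_i)_{i\in\Lambda}$) generated by pairwise anticommuting (Grassmann) generators $(\xi_i,\eta_i)_{i\in\Lambda}$ (each squaring to $0$); its elements are called forms, and a form is compactly supported if its coefficient functions are. $F_0$ denotes the degree-$0$ part of a form $F$; a form is even if all its terms have even degree in the generators. For even forms $F^1,\dots,F^k$ and a smooth $g$, $g(F^1,\dots,F^k)=\sum_\alpha\frac1{\alpha!}g^{(\alpha)}(F^1_0,\dots,F^k_0)\prod_j(F^j-F^j_0)^{\alpha_j}$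 (a finite sum). $\partial_{\xi_i},\partial_{\eta_i}$ are the left derivatives (antiderivations over $C^\infty$ with $\partial_{\xi_i}\xi_j=\delta_{ij}=\partial_{\eta_i}\eta_j$, $\partial_{\xi_i}\eta_j=0=\partial_{\eta_i}\xi_j$). $\mathbb{S}^{2|2}_+$ model: let $z_i=\sqrt{1-x_i^2-y_i^2+2\xi_i\eta_i}$ (an even form), $u_i=(z_i,x_i,y_i,\xi_i,\eta_i)$, $u_i\cdot u_j=z_iz_j+x_ix_j+y_iy_j-\xi_i\eta_j+\eta_i\xi_j$ (so $u_i\cdot u_i=1$). For compactly supported $F$, $\int_{(\mathbb{S}^{2|2}_+)^\Lambda}F=(2\pi)^{-|\Lambda|}\int_{(\mathbb{B}^{2})^\Lambda}\prod_{i\in\Lambda}dx_i\,dy_i\ \big(\prod_{i\in\Lambda}\partial_{\eta_i}\partial_{\xi_i}\big)\frac1{\prod_{i\in\Lambda}z_i}F$. Let $H_\beta(\boldsymbol{u})=\frac12\sum_{i,j\in\Lambda}\beta_{ij}(1-u_i\cdot u_j)$ and $[F]_\beta=\int_{(\mathbb{S}^{2|2}_+)^\Lambda}Fe^{-H_\beta}$. VDJP: with initial condition $(v,\boldsymbol{L}_0)\in\Lambda\times(0,1]^\Lambda$, the process has $X_0=v$, jump rates $\mathbb{P}_{v,\boldsymbol{L}_0}[X_{t+dt}=j\mid(X_r)_{r\le t},X_t=i]=\beta_{ij}L_t^j\,dt$, where $L_t^j=L_0^j-\int_0^t1_{X_r=j}\,dr$, and is stopped at $\zeta=\inf\{r\mid\exists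 j\in\Lambda:\ L_r^j\le0\}$. Functions on $(0,1]^\Lambda$ are extended by $0$, so the integrand vanishes for $t\ge\zeta$. *)

(* Defs.v *)
(* MathComp and MathComp-Analysis *)
From HB Require Import structures.
From mathcomp Require Import all_boot all_order all_algebra.

Set Implicit Arguments.
Unset Strict Implicit.
Unset Printing Implicit Defensive.

Import Order.TTheory GRing.Theory Num.Theory.

Local Open Scope ring_scope.

(** * Grassmann algebras *)

(* An element is its family of coefficients on the basis of the monomials e_A,
   A : {set G}, where e_A is the product of the generators in A taken in
   increasing order of [enum_rank].  Hence e_A * e_B = 0 if A and B meet, and
   e_A * e_B = (-1) ^+ inversions A B * e_(A :|: B) otherwise. *)
Section Inversions.
Variable G : finType.
Implicit Types A B C : {set G}.

Definition inversions A B : nat :=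
  (\sum_(a in A) \sum_(b in B) (enum_rank b < enum_rank a))%N.

Lemma inversions0l B : inversions set0 B = 0%N.
Proof. by rewrite /inversions big_set0. Qed.

Lemma inversions0r A : inversions A set0 = 0%N.
Proof. by rewrite /inversions big1// => a _; rewrite big_set0. Qed.

Lemma inversions_split_l A B C : A \subset B ->
  inversions B C = (inversions A C + inversions (B :\: A) C)%N.
Proof. by move=> AB; rewrite /inversions (big_setID A)/= (setIidPr AB). Qed.

Lemma inversions_split_r A B C : A \subset B ->
  inversions C B = (inversions C A + inversions C (B :\: A))%N.
Proof.
move=> AB; rewrite /inversions -big_split/=; apply: eq_bigr => c _.
by rewrite (big_setID A)/= (setIidPr AB).
Qed.

End Inversions.

Definition grassmann (R : comNzRingType) (G : finType) : Type :=
  {ffun {set G} -> R}.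

Section Grassmann.
Variables (R : comNzRingType) (G : finType).
Local Notation Gr := (grassmann R G).
Implicit Types (F H K : Gr) (A B C : {set G}).

HB.instance Definition _ := GRing.Lmodule.copy Gr {ffun {set G} -> R^o}.

Definition grassmann_one : Gr := [ffun A : {set G} => (A == set0)%:R].

Definition grassmann_mul F H : Gr := [ffun C : {set G} =>
  \sum_(A : {set G} | A \subset C)
    (-1) ^+ inversions A (C :\: A) * (F A * H (C :\: A))].

Fact grassmann_mulA : associative grassmann_mul.
Proof.
move=> F H K; apply/ffunP => C; rewrite !ffunE.
pose t A B : R := (-1) ^+ (inversions A (B :\: A) + inversions B (C :\: B)) *
                    (F A * H (B :\: A) * K (C :\: B)).
transitivity (\sum_(A : {set G} | A \subset C)
    \sum_(B : {set G} | (A \subset B) && (B \subset C)) t A B); last first.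
  rewrite (exchange_big_dep (fun B : {set G} => B \subset C))/=; last first.
    by move=> A B _ /andP[].
  apply: eq_bigr => B BC; rewrite ffunE big_distrl/= big_distrr/=.
  apply: eq_big => [A|A /andP[_ /andP[AB _]]].
    by rewrite BC andbT; apply: andb_idl => /subset_trans; apply.
  by rewrite /t exprD -!mulrA [RHS]mulrCA.
apply: eq_bigr => A AC; rewrite ffunE !big_distrr/=.
rewrite (reindex_onto (fun B => B :\: A) (fun D => A :|: D))/=; last first.
  move=> D; rewrite subsetD => /andP[_ DA].
  by rewrite setDUl setDv set0U; apply/setDidPl.
apply: eq_big => [B|B].
  apply/andP/andP => [[BAC /eqP AB]|[AB BC]].
    split; first by rewrite -AB subsetUl.
    rewrite -AB; apply/subUsetP; split=> //.
    by apply: subset_trans BAC _; exact: subsetDl.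
  split; first exact: setSD.
  by apply/eqP; apply/setP => x; rewrite !inE; case: (boolP (x \in A)) => //= /(subsetP AB).
move=> /andP[BAC /eqP AB].
have sAB : A \subset B by rewrite -AB subsetUl.
have -> : C :\: A :\: (B :\: A) = C :\: B.
  by rewrite setDDl AB.
rewrite /t (@inversions_split_r _ (B :\: A) (C :\: A) A)//.
rewrite (@inversions_split_l _ A B (C :\: B))//.
have -> : C :\: A :\: (B :\: A) = C :\: B.
  by rewrite setDDl AB.
by rewrite !exprD -!mulrA; do 2!congr (_ * _); exact: mulrCA.
Qed.

Fact grassmann_mul1 : left_id grassmann_one grassmann_mul.
Proof.
move=> F; apply/ffunP => C; rewrite !ffunE (bigD1 set0) ?sub0set//=.
rewrite ffunE eqxx inversions0l setD0 expr0 !mul1r big1 ?addr0// => A.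
by move=> /andP[_ /negPf A0]; rewrite ffunE A0 mul0r mulr0.
Qed.

Fact grassmann_mulr1 : right_id grassmann_one grassmann_mul.
Proof.
move=> F; apply/ffunP => C; rewrite !ffunE (bigD1 C)//= ffunE setDv eqxx.
rewrite inversions0r expr0 mul1r mulr1 big1 ?addr0// => A /andP[AC nAC].
rewrite ffunE setD_eq0; case: (boolP (C \subset A)) => [CA|_].
  by rewrite eqEsubset AC CA in nAC.
by rewrite !mulr0.
Qed.

Fact grassmann_mulDl : left_distributive grassmann_mul +%R.
Proof.
move=> F H K; apply/ffunP => C; rewrite !ffunE -big_split/=.
by apply: eq_bigr => A _; rewrite ffunE mulrDl mulrDr.
Qed.

Fact grassmann_mulDr : right_distributive grassmann_mul +%R.
Proof.
move=> F H K; apply/ffunP => C; rewrite !ffunE -big_split/=.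
by apply: eq_bigr => A _; rewrite ffunE mulrDr mulrDr.
Qed.

Fact grassmann_one_neq0 : grassmann_one != 0.
Proof.
by apply/eqP => /ffunP/(_ set0); rewrite !ffunE eqxx => /eqP; rewrite oner_eq0.
Qed.

HB.instance Definition _ := GRing.Zmodule_isNzRing.Build Gr
  grassmann_mulA grassmann_mul1 grassmann_mulr1
  grassmann_mulDl grassmann_mulDr grassmann_one_neq0.

Fact grassmann_scaleAl (k : R) F H : k *: (F * H) = (k *: F) * H.
Proof.
apply/ffunP => C; rewrite !ffunE scaler_sumr; apply: eq_bigr => A _.
by rewrite ffunE /GRing.scale/= mulrCA !mulrA.
Qed.

HB.instance Definition _ := GRing.Lmodule_isLalgebra.Build R Gr grassmann_scaleAl.

Fact grassmann_scaleAr (k : R) F H : k *: (F * H) = F * (k *: H).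
Proof.
apply/ffunP => C; rewrite !ffunE scaler_sumr; apply: eq_bigr => A _.
by rewrite ffunE /GRing.scale/= mulrCA [k * (_ * _)]mulrCA.
Qed.

HB.instance Definition _ := GRing.Lalgebra_isAlgebra.Build R Gr grassmann_scaleAr.

Definition generator (g : G) : Gr := [ffun A : {set G} => (A == [set g])%:R].

(* the degree-0 part F_0 *)
Definition body F : R := F set0.

(* e_g * e_B = (-1) ^+ inversions [set g] B * e_(g |: B), so the left
   derivative with respect to g maps e_(g |: B) to
   (-1) ^+ inversions [set g] B * e_B when g \notin B. *)
Definition left_deriv (g : G) F : Gr := [ffun B : {set G} =>
  if g \in B then 0 else (-1) ^+ inversions [set g] B * F (g |: B)].

Lemma generator_mulE g F C : (generator g * F) C =
  if g \in C then (-1) ^+ inversions [set g] (C :\ g) * F (C :\ g) else 0.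
Proof.
rewrite /GRing.mul/= ffunE; case: ifPn => gC.
  rewrite (bigD1 [set g]) ?sub1set//= ffunE eqxx mul1r big1 ?addr0//.
  by move=> A /andP[_ /negPf An]; rewrite ffunE An mul0r mulr0.
rewrite big1// => A AC; rewrite ffunE; case: eqP => [Ag|_].
  by move: AC; rewrite Ag sub1set (negPf gC).
by rewrite mul0r mulr0.
Qed.

Lemma inversions11 (g h : G) : g != h ->
  (inversions [set g] [set h] + inversions [set h] [set g] = 1)%N.
Proof.
move=> gh; rewrite /inversions !big_set1.
by case: ltngtP => // /val_inj/enum_rank_inj/eqP; rewrite eq_sym (negPf gh).
Qed.

Lemma generator_sqr g : generator g * generator g = 0.
Proof.
apply/ffunP => C; rewrite generator_mulE [RHS]ffunE; case: ifP => // gC.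
rewrite ffunE; case: eqP => [/setP/(_ g)|]; last by rewrite mulr0.
by rewrite !inE eqxx.
Qed.

(* Together with [left_deriv1] and linearity, this characterises the left
   derivative as the antiderivation with d_g h = (g == h)%:R. *)
Lemma left_deriv_generatorM g h F :
  left_deriv g (generator h * F) = (g == h)%:R *: F - generator h * left_deriv g F.
Proof.
have addE (H K : Gr) (C : {set G}) : (H - K) C = H C - K C by rewrite !ffunE.
have scaleE k (H : Gr) (C : {set G}) : (k *: H) C = k * H C by rewrite ffunE.
apply/ffunP => C; rewrite addE scaleE generator_mulE [LHS]ffunE generator_mulE.
rewrite [left_deriv g F _]ffunE.
rewrite !inE; case: (eqVneq g h) => [<-|gh] /=.
  rewrite mul1r; case: ifPn => gC; first by rewrite setD1K// signrMK subrr.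
  by rewrite setU1K// signrMK subr0.
rewrite mul0r add0r.
case: (boolP (g \in C)) => gC; case: (boolP (h \in C)) => hC;
  rewrite ?mulr0 ?oppr0//.
have -> : (g |: C) :\ h = g |: (C :\ h).
  apply/setP => x; rewrite !inE; case: (eqVneq x g) => [->|]//=; by rewrite gh.
have ghC : g \notin C :\ h by rewrite !inE negb_and gC orbT.
rewrite (@inversions_split_r _ [set h] C [set g]) ?sub1set//.
rewrite (@inversions_split_r _ [set g] (g |: C :\ h) [set h]) ?subsetUl// setU1K//.
have E : (-1) ^+ inversions [set g] [set h] * (-1) ^+ inversions [set h] [set g]
    = -1 :> R by rewrite -exprD inversions11.
rewrite !exprD !mulrA -mulNr; congr (_ * _).
by rewrite -mulrA mulrACA E mulN1r mulrC.
Qed.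

Lemma left_deriv1 g : left_deriv g 1 = 0.
Proof.
apply/ffunP => C; rewrite !ffunE; case: ifP => // _.
rewrite (_ : (g |: C == set0) = false) ?mulr0//.
by apply/negbTE/set0Pn; exists g; rewrite setU11.
Qed.

End Grassmann.

From mathcomp Require Import all_classical all_reals all_analysis.
Import numFieldNormedType.Exports.
Local Open Scope classical_set_scope.

(** * Smooth functions of finitely many variables *)

Section Smooth.
Variables (R : realType) (J : finType).
Implicit Types (g : (J -> R) -> R) (v : J -> R).

Definition partial (j : J) g : (J -> R) -> R :=
  fun v => (fun t : R => g (@dfwith J (fun=> R) v j t))^`() (v j).

Definition partials (js : seq J) g : (J -> R) -> R := foldr partial g js.

(* C^oo on U, which is meant to be open: iterated partial derivatives of all
   orders exist and are continuous at every point of U. *)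
Definition smooth_on (U : set {ptws J -> R}) g : Prop :=
  forall (js : seq J) (v : {ptws J -> R}), U v ->
    {for v, continuous (partials js g : {ptws J -> R} -> R)} /\
    forall j, derivable
      (fun t : R => partials js g (@dfwith J (fun=> R) v j t)) (v j) 1.

(* (0, 1]^J *)
Definition unit_box : set {ptws J -> R} :=
  [set l | forall j, 0 < l j /\ l j <= 1].

(* (0, 1]^J is not open: as usual, a function on it is smooth if it extends to
   a smooth function on an open neighbourhood.  Here g itself is such an
   extension; its partial derivatives at the points of (0, 1]^J depend only on
   its restriction to (0, 1]^J. *)
Definition smooth_on_unit_box g : Prop :=
  exists2 U : set {ptws J -> R}, open U & unit_box `<=` U /\ smooth_on U g.

(* Only the restriction of g to (0, 1]^J is extended. *)
Definition extend_by_zero g : (J -> R) -> R := patch (fun=> 0) unit_box g.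

Definition compactly_supported_in_unit_box g : Prop :=
  exists2 K : set {ptws J -> R}, compact K &
    K `<=` unit_box /\ forall l, unit_box l -> ~ K l -> g l = 0.

End Smooth.

(** * Functional calculus on even elements of a Grassmann algebra *)

Section Calculus.
Variables (R : realType) (G : finType).
Local Notation Gr := (grassmann R G).

(* g(F^1, ..., F^k) by Taylor expansion at the degree-0 parts.  Each exponent
   may be truncated at #|G|, since F^j - F^j_0 has no degree-0 part, so that its
   power of exponent #|G| + 1 is zero. *)
Definition gcalc (J : finType) (g : (J -> R) -> R) (F : J -> Gr) : Gr :=
  \sum_(alpha : {ffun J -> 'I_(#|G|).+1})
    ((\prod_j (alpha j)`!)%N%:R^-1 *
     partials (flatten [seq nseq (alpha j) j | j <- enum J]) g
       (fun j => body (F j))) *: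
    \prod_j (F j - (body (F j))%:A) ^+ alpha j.

Definition gcalc1 (f : R -> R) (F : Gr) : Gr :=
  gcalc (fun v : unit -> R => f (v tt)) (fun=> F).

End Calculus.

(** * The hemispherical model *)

Section Hemisphere.
Variables (R : realType) (Lam : finType).

(* a point (x_i, y_i)_i of (R^2)^Lam *)
Local Notation point := (Lam -> R * R).

Local Notation Gr := (grassmann R (Lam + Lam)%type).

(* A form is given by its values at the points; its coefficient functions are
   the maps p |-> F p A.  They need not be smooth here, but the forms met below
   are smooth on the product of the open discs, and all the operations on
   forms are pointwise. *)
Definition form : Type := point -> Gr.

Definition xi (i : Lam) : Gr := generator R (inl i).
Definition eta (i : Lam) : Gr := generator R (inr i).

Definition xform (i : Lam) : form := fun p => (p i).1%:A.
Definition yform (i : Lam) : form := fun p => (p i).2%:A.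

Definition zform (i : Lam) : form := fun p =>
  gcalc1 Num.sqrt
    ((1 - (p i).1 ^+ 2 - (p i).2 ^+ 2)%:A + 2%:R *: (xi i * eta i)).

Definition udot (i j : Lam) : form := fun p =>
  zform i p * zform j p + xform i p * xform j p + yform i p * yform j p
  - xi i * eta j + eta i * xi j.

Definition hamiltonian (beta : Lam -> Lam -> R) : form := fun p =>
  2%:R^-1 *: \sum_i \sum_j beta i j *: (1 - udot i j p).

(* \prod_i d_(eta_i) d_(xi_i); the factors commute, and all the generators are
   removed, so the result is its own degree-0 part. *)
Definition berezin (F : Gr) : R :=
  body (foldr (fun i H => left_deriv (inr i) (left_deriv (inl i) H))
              F (enum Lam)).

Definition disc : set (R * R) := [set q | q.1 ^+ 2 + q.2 ^+ 2 < 1].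

(* Lebesgue integral over disc^s of the coordinates in s, the others being
   those of p *)
Fixpoint disc_integral (s : seq Lam) (f : point -> R) (p : point) : R :=
  if s is i :: s' then
    \int[(@lebesgue_measure R \x @lebesgue_measure R)%E]_(q in disc)
      disc_integral s' f (@dfwith Lam (fun=> (R * R)%type) p i q)
  else f p.

(* The starting point is irrelevant as every coordinate is integrated out. *)
Definition superintegral (F : form) : R :=
  (2%:R * pi) ^- #|Lam| *
  disc_integral (enum Lam)
    (fun p => berezin (gcalc1 GRing.inv (\prod_i zform i p) * F p))
    (fun=> (0, 0)).

Definition superexpectation (beta : Lam -> Lam -> R) (F : form) : R :=
  superintegral (fun p => F p * gcalc1 expR (- hamiltonian beta p)).

End Hemisphere.

(** * The vertex-diminished jump process *)

Section VDJP.
Variables (R : realType) (Lam : finType).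
Variables (d : measure_display) (Omega : measurableType d).
Variable P : probability Omega R.

Implicit Types (X : R -> Omega -> Lam) (L : Lam -> R) (w : Omega).

(* the process L_t^j *)
Definition remaining L X (t : R) w : Lam -> R := fun j =>
  L j - \int[@lebesgue_measure R]_(r in `[0, t]) (X r w == j)%:R.

(* the stopping time zeta *)
Definition lifetime L X w : \bar R :=
  ereal_inf [set r%:E | r in
    [set r : R | 0 <= r /\ exists j, remaining L X r w j <= 0]].

(* the sigma-algebra generated by (X_r), 0 <= r <= t *)
Definition history X (t : R) : set (set Omega) :=
  <<s [set B | exists r i, [/\ 0 <= r, r <= t & B = [set w | X r w = i]] ]>>.

Record is_vdjp (beta : Lam -> Lam -> R) (v : Lam) L X : Prop := IsVDJP {
  vdjp_initial_times : forall j, 0 < L j /\ L j <= 1 ;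
  vdjp_measurable : forall t i, 0 <= t -> measurable [set w | X t w = i] ;
  vdjp_start : forall w, X 0 w = v ;
  (* the paths are right-continuous with left limits in the discrete space Lam *)
  vdjp_right_continuous : forall w t, 0 <= t ->
    \forall s \near t^'+, X s w = X t w ;
  vdjp_left_limits : forall w t, 0 < t ->
    exists i, \forall s \near t^'-, X s w = i ;
  (* There are no jumps at deterministic times, which the infinitesimal
     prescription of the jump rates does not see. *)
  vdjp_no_fixed_jump : forall t, 0 < t ->
    P [set w | X s w <> X t w] @[s --> t^'-] --> 0%E ;
  (* P(X_(t+h) = j | (X_r)_(r <= t), X_t = i) = beta_ij L_t^j h + o(h) before
     the lifetime; conditioning means integrating over the events of the past. *)
  vdjp_rates : forall t A i j, 0 <= t -> history X t A -> i != j ->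
    let B := A `&` [set w | X t w = i /\ (t%:E < lifetime L X w)%E] in
    (fine (P (B `&` [set w | X (t + h) w = j])) / h) @[h --> 0^'+] -->
      (\int[P]_(w in B) (beta i j * remaining L X t w j) : R) ;
  vdjp_stopped : forall w s t, 0 <= s -> s <= t ->
    (lifetime L X w <= s%:E)%E -> X t w = X s w
}.

End VDJP.

(* Main.v *)
(* With s_i = 1 - x_i^2 - y_i^2 the form z_i is sqrt (s_i + 2 xi_i eta_i), so the
   left-hand side is the flat superintegral of
     x_a x_b exp (1/2 \sum beta (x x + y y) - \sum beta xi eta) K (s + 2 xi eta),
   where K (l^2) = g (l) exp (- 1/2 \sum beta (1 - l l)) / \prod l.  Let k be the
   mixed derivative of K in all variables; K is recovered from k by iterated
   integration, and both sides of the theorem become linear functionals D_b of k.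
   Integration by parts in x_i on the left, and the forward equation of the
   process on the right, give the same identity
     2 D_i k = \sum_j beta_ij D_j (I_i k) + delta_ai (I_Lam I_i k) (1, ..., 1)
   for both functionals, where I_i integrates in the i-th variable.  On the left
   the last term is a superexpectation without insertions: by supersymmetry it
   does not depend on beta, and at beta = 0 polar coordinates evaluate it.
   The difference of the two functionals satisfies the homogeneous identity and
   is bounded by a multiple of the supremum of |k|.  For the norm weighted by
   exp (c \sum_j s_j) the operators I_i are contractions of ratio 1 / c, so for
   large c the difference vanishes. *)

Require Import Defs.
From HB Require Import structures.
From mathcomp Require Import all_boot all_order all_algebra.
From mathcomp Require Import reals.

Set Implicit Arguments.
Unset Strict Implicit.
Unset Printing Implicit Defensive.

Import Order.TTheory GRing.Theory Num.Theory.

Local Open Scope ring_scope.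

(** * Grassmann algebra *)

(** The Grassmann variables differentiate K in the variables of a set A. Written through k, such a
    derivative is a primitive of k in the remaining variables, so that no derivative has to be
    controlled. The functions k are continuous and vanish as soon as one coordinate is at most some
    e > 0: this removes the boundary terms at 0 and at the edge of the disc, while no vanishing is
    imposed at 1, where the inhomogeneous term is evaluated.

    Supersymmetry takes the form of a finite identity between sums over sets: integration by parts
    moves a variable m into A with a factor 2, and the cofactor expansion of minors of beta moves it
    back.

    For the process, the forward equation is applied not to the observable K itself but to the
    observable without its factor l_i: the rate of the jumps into i gives this factor back. The
    exponential in the observable grows along a path at the exit rate of the process, so that drift
    and loss by jumps cancel. Since the total of the left times decreases at unit rate, all time
    integrals run over the compact interval from 0 to the number of vertices. *)

Section GrassmannAlgebra.
Variables (R : comNzRingType) (G : finType).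
Local Notation Gr := (grassmann R G).
Implicit Types (F H K N : Gr) (A B : {set G}) (g h : G).

Lemma grD F H A : (F + H) A = F A + H A. Proof. by rewrite !ffunE. Qed.
Lemma grN F A : (- F) A = - F A. Proof. by rewrite !ffunE. Qed.
Lemma grZ c F A : (c *: F) A = c * F A. Proof. by rewrite !ffunE. Qed.
Lemma gr0 A : (0 : Gr) A = 0. Proof. by rewrite !ffunE. Qed.
Lemma gr1 A : (1 : Gr) A = (A == set0)%:R. Proof. by rewrite !ffunE. Qed.
Lemma grM F H A : (F * H) A = \sum_(B : {set G} | B \subset A)
    (-1) ^+ inversions B (A :\: B) * (F B * H (A :\: B)).
Proof. by rewrite /GRing.mul/= ffunE. Qed.

Definition has_degree (d : nat) F := forall A, (#|A| < d)%N -> F A = 0.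

Lemma has_degree_gt d F : has_degree d F -> (#|G| < d)%N -> F = 0.
Proof.
by move=> Fd Gd; apply/ffunP => A; rewrite gr0 Fd// (leq_ltn_trans (max_card _) Gd).
Qed.

Lemma has_degreeM d e F H : has_degree d F -> has_degree e H ->
  has_degree (d + e) (F * H).
Proof.
move=> Fd He A Ade; rewrite grM big1// => B BA.
have [Bd|dB] := ltnP #|B| d; first by rewrite Fd// mul0r mulr0.
rewrite He ?mulr0 ?mulr0//; have := cardsID B A; rewrite (setIidPr BA) => AE.
by rewrite -(ltn_add2l #|B|) AE (leq_trans Ade)// leq_add2r.
Qed.

Lemma has_degreeX d n F : has_degree d F -> has_degree (n * d) (F ^+ n).
Proof. by move=> Fd; elim: n => // n IH; rewrite exprS mulSn; exact: has_degreeM. Qed.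

Lemma has_degree1 F : body F = 0 -> has_degree 1 F.
Proof. by move=> F0 A; rewrite ltnS leqn0 cards_eq0 => /eqP ->. Qed.

Lemma has_degree_generator g : has_degree 1 (generator R g).
Proof. by apply: has_degree1; rewrite /body ffunE eq_sym; case: eqP => // /setP/(_ g); rewrite !inE eqxx. Qed.

Lemma bodyD F H : body (F + H) = body F + body H. Proof. exact: grD. Qed.
Lemma bodyN F : body (- F) = - body F. Proof. exact: grN. Qed.
Lemma bodyZ c F : body (c *: F) = c * body F. Proof. exact: grZ. Qed.
Lemma body1 : body (1 : Gr) = 1. Proof. by rewrite /body gr1 eqxx. Qed.
Lemma bodyA (c : R) : body (c%:A : Gr) = c. Proof. by rewrite bodyZ body1 mulr1. Qed.

Lemma bodyM F H : body (F * H) = body F * body H.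
Proof.
rewrite /body grM (bigD1 set0)//= big1 ?addr0; last first.
  by move=> A /andP[]; rewrite subset0 => /eqP ->; rewrite eqxx.
by rewrite inversions0l setD0 expr0 mul1r.
Qed.

Lemma body_subA F : body (F - (body F)%:A) = 0.
Proof. by rewrite bodyD bodyN bodyA subrr. Qed.

(* The grading automorphism, which governs commutation with the generators. *)
Definition grade F : Gr := [ffun A : {set G} => (-1) ^+ #|A| * F A].

Lemma gradeK F : grade (grade F) = F.
Proof. by apply/ffunP => A; rewrite !ffunE signrMK. Qed.

Lemma inversions1_card g B : g \notin B ->
  (inversions [set g] B + inversions B [set g] = #|B|)%N.
Proof.
move=> gB; rewrite /inversions big_set1.
under [X in (_ + X)%N]eq_bigr do rewrite big_set1.
rewrite -big_split/= -[RHS]sum1_card; apply: eq_bigr => b bB.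
case: ltngtP => // /val_inj/enum_rank_inj gb; by rewrite -gb bB in gB.
Qed.

Lemma generator_grade g F : generator R g * F = grade F * generator R g.
Proof.
apply/ffunP => C; rewrite generator_mulE grM; case: ifPn => gC; last first.
  rewrite big1// => A AC; rewrite [generator R g _]ffunE.
  case: eqP => [Ag|_]; last by rewrite mulr0 mulr0.
  have : g \in C :\: A by rewrite Ag inE eqxx.
  by rewrite inE (negPf gC) andbF.
rewrite (bigD1 (C :\ g)) ?subsetDl//= setDDr setDv set0U.
have -> : C :&: [set g] = [set g] by apply/setIidPr; rewrite sub1set.
rewrite [generator R g _]ffunE eqxx mulr1 ffunE big1 ?addr0; last first.
  move=> A /andP[AC nA]; rewrite [generator R g _]ffunE; case: eqP => [CA|_].
    by move: nA; rewrite -CA setDDr setDv set0U (setIidPr AC) eqxx.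
  by rewrite mulr0 mulr0.
have gCg : g \notin C :\ g by rewrite !inE eqxx.
rewrite mulrA -exprD -(inversions1_card gCg) addnCA addnn -muln2 exprD.
by rewrite exprM sqrr_sign mulr1.
Qed.

Definition central F := forall H, F * H = H * F.

Lemma central_generatorM g h : central (generator R g * generator R h).
Proof. by move=> F; rewrite -mulrA (generator_grade h F) mulrA (generator_grade g (grade F)) gradeK mulrA. Qed.

(* The even elements, in the only sense that is used: they are central, and the
   left derivatives satisfy the ordinary product rule with them. *)
Definition even_elt N := central N /\
  forall g F, left_deriv g (N * F) = left_deriv g N * F + N * left_deriv g F.

Lemma left_derivD g F H : left_deriv g (F + H) = left_deriv g F + left_deriv g H.
Proof.
by apply/ffunP => A; rewrite !ffunE; case: ifP => _; rewrite ?addr0// mulrDr.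
Qed.

Lemma left_derivZ g c F : left_deriv g (c *: F) = c *: left_deriv g F.
Proof.
apply/ffunP => A; rewrite !ffunE; case: ifP => _; rewrite ?mulr0// /GRing.scale/= ?mulr0//.
by rewrite mulrCA.
Qed.

Lemma left_deriv_generator g h : left_deriv g (generator R h) = (g == h)%:R *: 1.
Proof. by rewrite -[generator R h]mulr1 left_deriv_generatorM left_deriv1 mulr0 subr0. Qed.

Lemma even_generatorM g h : even_elt (generator R g * generator R h).
Proof.
split; first exact: central_generatorM.
move=> k F; rewrite -mulrA !left_deriv_generatorM left_deriv_generator.
rewrite !mulrBr !mulrBl scalerAl -!scalerAr -!scalerAl mulr1 opprB addrA.
by rewrite !mulrA addrAC.
Qed.

Lemma even1 : even_elt 1.
Proof.
by split => [F|g F]; rewrite ?mul1r ?mulr1// left_deriv1 mul0r add0r.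
Qed.

Lemma evenD N F : even_elt N -> even_elt F -> even_elt (N + F).
Proof.
move=> [cN dN] [cF dF]; split => [H|g H]; first by rewrite mulrDl cN cF mulrDr.
by rewrite mulrDl !left_derivD dN dF !mulrDl addrACA.
Qed.

Lemma evenZ c N : even_elt N -> even_elt (c *: N).
Proof.
move=> [cN dN]; split => [H|g H]; first by rewrite -scalerAl cN scalerAr.
by rewrite -scalerAl !left_derivZ dN scalerDr !scalerAl.
Qed.

Lemma evenM N F : even_elt N -> even_elt F -> even_elt (N * F).
Proof.
move=> [cN dN] [cF dF]; split => [H|g H]; first by rewrite -mulrA cF mulrA cN mulrA.
by rewrite -mulrA dN dF dN mulrDr mulrDl !mulrA addrA.
Qed.

Lemma even_prod (I : Type) (r : seq I) (P : pred I) (f : I -> Gr) :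
  (forall i, even_elt (f i)) -> even_elt (\prod_(i <- r | P i) f i).
Proof. by move=> ef; apply: big_ind => //; [exact: even1|exact: evenM]. Qed.

Lemma evenX n N : even_elt N -> even_elt (N ^+ n).
Proof. by move=> eN; elim: n => [|n IH]; rewrite ?exprS; [exact: even1|exact: evenM]. Qed.

Lemma evenA (c : R) : even_elt c%:A.
Proof. exact/evenZ/even1. Qed.

Lemma evenN N : even_elt N -> even_elt (- N).
Proof. by move=> eN; rewrite -scaleN1r; exact: evenZ. Qed.

(** Stands in for [bigD1] in a noncommutative ring: a central factor can be moved to the front.
    Uniqueness in r makes the condition j != i remove exactly one factor. *)
Lemma prod_centralD1 (I : eqType) (r : seq I) (P : pred I) (f : I -> Gr) i :
  (forall j, central (f j)) -> uniq r -> i \in r -> P i ->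
  \prod_(j <- r | P j) f j = f i * \prod_(j <- r | P j && (j != i)) f j.
Proof.
move=> cf; elim: r => //= j r IH /andP[jr ur]; rewrite inE => /predU1P[->|ir] Pi.
  rewrite !big_cons Pi eqxx andbF; congr (_ * _); rewrite big_seq_cond [RHS]big_seq_cond.
  apply: eq_bigl => k; case: (eqVneq k j) => [->|_]; last by rewrite andbT.
  by rewrite (negPf jr).
rewrite !big_cons (IH ur ir Pi); have -> : j != i.
  by apply: contra jr => /eqP ->.
by case: (P j) => //=; rewrite mulrA cf mulrA.
Qed.

End GrassmannAlgebra.

(** * Taylor polynomials and perturbations of square zero *)

Section SquareZero.
Variables (R : numFieldType) (G : finType).
Local Notation Gr := (grassmann R G).
Implicit Types (F H K N W : Gr).

(* The Taylor polynomial defining the functional calculus. *)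
Definition taylor (c : nat -> R) N : Gr :=
  \sum_(k < #|G|.+1) (k`!%:R^-1 * c k) *: N ^+ k.

Lemma exprD_sqr0 N W k : central W -> W * W = 0 ->
  (N + W) ^+ k.+1 = N ^+ k.+1 + k.+1%:R *: (W * N ^+ k).
Proof.
move=> cW W2; elim: k => [|k IH]; first by rewrite !expr1 expr0 mulr1 scale1r.
rewrite [LHS]exprS IH mulrDl !mulrDr -!scalerAr -exprS -addrA; congr (_ + _).
rewrite [W * (W * _)]mulrA W2 mul0r scaler0 addr0.
have -> : N * (W * N ^+ k) = W * N ^+ k.+1 by rewrite mulrA -cW -mulrA -exprS.
by rewrite -[k.+2%:R]natr1 scalerDl scale1r.
Qed.

(** First-order Taylor formula in W, exact since W^2 = 0. Shifting the coefficients c amounts to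
    differentiating the function. *)
Lemma taylorD_sqr0 c N W : central W -> W * W = 0 -> body N = 0 -> body W = 0 ->
  taylor c (N + W) = taylor c N + W * taylor (c \o S) N.
Proof.
move=> cW W2 N0 W0; rewrite /taylor big_ord_recl [in RHS]big_ord_recl -addrA.
rewrite !expr0; congr (_ + _).
rewrite [X in W * X]big_ord_recr/= mulrDr -scalerAr.
(* The two truncated sums differ by this top term, whose degree exceeds the number of generators. *)
have -> : W * N ^+ #|G| = 0.
  apply: (@has_degree_gt _ _ #|G|.+1) => //; rewrite -add1n.
  apply: has_degreeM; first exact: has_degree1.
  by rewrite -[X in has_degree X]muln1; apply: has_degreeX; exact: has_degree1.
rewrite scaler0 addr0 mulr_sumr -big_split/=; apply: eq_bigr => k _.
rewrite exprD_sqr0// scalerDr; congr (_ + _); rewrite scalerA -scalerAr; congr (_ *: _).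
rewrite mulrAC; congr (_ * _); rewrite factS natrM invfM mulrAC mulVf ?mul1r//.
by rewrite pnatr_eq0.
Qed.

Lemma taylor0 c : taylor c 0 = (c 0%N)%:A.
Proof.
rewrite /taylor big_ord_recl expr0 fact0 invr1 mul1r big1 ?addr0// => k _.
by rewrite expr0n scaler0.
Qed.

End SquareZero.

(** * The Berezin integral and the minors of beta *)

Section Berezin.
Variables (R : realType) (Lam : finType).
Local Notation G := (Lam + Lam)%type.
Local Notation Gr := (grassmann R G).
Local Notation xi := (@Defs.xi R Lam).
Local Notation eta := (@Defs.eta R Lam).
Implicit Types (F H : Gr) (i j k l : Lam) (A B : {set Lam}).

Lemma grade_generator (g : G) : grade (generator R g) = - generator R g.
Proof.
apply/ffunP => A; rewrite !ffunE; case: eqP => [->|_]; last by rewrite mulr0 oppr0.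
by rewrite cards1 expr1 mulN1r.
Qed.

Lemma generatorC (g h : G) :
  generator R g * generator R h = - (generator R h * generator R g).
Proof. by rewrite generator_grade grade_generator mulNr. Qed.

Lemma generatorM_sqr0 (g h : G) :
  generator R g * generator R h * (generator R g * generator R h) = 0.
Proof.
rewrite -mulrA [generator R h * _]mulrA [generator R h * generator R g]generatorC.
by rewrite mulNr mulrN -!mulrA generator_sqr !mulr0 oppr0.
Qed.

Definition om i : Gr := xi i * eta i.

Lemma even_om i : even_elt (om i). Proof. exact: even_generatorM. Qed.
Lemma central_om i : central (om i). Proof. by case: (even_om i). Qed.
Lemma om_sqr0 i : om i * om i = 0. Proof. exact: generatorM_sqr0. Qed.

Lemma body_generatorM (g h : G) : body (generator R g * generator R h) = 0.
Proof.
rewrite bodyM [body _](has_degree_generator R g) ?mul0r//.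
by rewrite cards0.
Qed.

(** Each generator is differentiated once, so only the coefficient of the top monomial survives.
    Linearity and vanishing on derivatives follow whatever the sign c; the normalization is settled
    by [berezin_om_set]. *)
Lemma berezin_top : exists c, forall F : Gr, berezin F = c * F [set: G].
Proof.
have H (l : seq Lam) (B : {set G}) : exists c, forall F : Gr,
    foldr (fun i H => left_deriv (inr i) (left_deriv (inl i) H)) F l B =
    c * F ([set u | match u with inl i => i \in l | inr i => i \in l end] :|: B).
  elim: l B => [|i l IH] B.
    exists 1 => F; rewrite mul1r /=; congr (F _).
    by apply/setP => -[] j; rewrite !inE.
  have [c cP] := IH (inl i |: (inr i |: B)).
  have -> : [set u | match u with inl j => j \in i :: l | inr j => j \in i :: l end] :|: B =
      [set u | match u with inl j => j \in l | inr j => j \in l end] :|: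
      (inl i |: (inr i |: B)).
    by apply/setP => -[] j; rewrite !inE; case: (j \in l); case: (_ \in B);
      rewrite ?orbT ?orbF//= ?orbT//.
  exists (if inr i \in B then 0 else (-1) ^+ inversions [set inr i] B *
     (if inl i \in inr i |: B then 0 else (-1) ^+ inversions [set inl i] (inr i |: B) * c)).
  move=> F /=; rewrite ffunE; case: ifP => _; first by rewrite mul0r.
  rewrite ffunE; case: ifP => _; first by rewrite !mulr0 mul0r.
  by rewrite cP !mulrA.
have [c cP] := H (enum Lam) set0; exists c => F.
rewrite /berezin /body cP; congr (_ * F _).
by apply/setP => -[] j; rewrite !inE mem_enum.
Qed.

Lemma berezinD F H : berezin (F + H) = berezin F + berezin H.
Proof. by have [c cP] := berezin_top; rewrite !cP grD mulrDr. Qed.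

Lemma berezinZ (a : R) F : berezin (a *: F) = a * berezin F.
Proof. by have [c cP] := berezin_top; rewrite !cP grZ mulrCA. Qed.

Lemma berezin0 : berezin (0 : Gr) = 0.
Proof. by have [c cP] := berezin_top; rewrite cP gr0 mulr0. Qed.

Lemma berezin_sum (I : Type) (r : seq I) (P : pred I) (f : I -> Gr) :
  berezin (\sum_(x <- r | P x) f x) = \sum_(x <- r | P x) berezin (f x).
Proof. exact: (big_morph (@berezin R Lam) berezinD berezin0). Qed.

Lemma berezin_left_deriv (g : G) F : berezin (left_deriv g F) = 0.
Proof. by have [c cP] := berezin_top; rewrite cP ffunE in_setT mulr0. Qed.

Definition om_set A : Gr := \prod_(i <- enum Lam | i \in A) om i.

Lemma even_om_set A : even_elt (om_set A).
Proof. by apply: even_prod => i; exact: even_om. Qed.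

Lemma om_setD1 i A : i \in A -> om_set A = om i * om_set (A :\ i).
Proof.
move=> iA; rewrite /om_set (prod_centralD1 (i := i)) ?enum_uniq ?mem_enum//; last first.
  by move=> j; exact: central_om.
by congr (_ * _); apply: eq_bigl => j; rewrite !inE andbC.
Qed.

Lemma xi_om_set i A : i \in A -> xi i * om_set A = 0.
Proof.
by move=> iA; rewrite (om_setD1 iA) /om !mulrA /Defs.xi generator_sqr !mul0r.
Qed.

Lemma deriv_xi_om i j : left_deriv (inl i) (om j) = (i == j)%:R *: eta j.
Proof.
rewrite /om /Defs.xi /Defs.eta left_deriv_generatorM left_deriv_generator/=.
by rewrite scale0r mulr0 subr0.
Qed.

Lemma deriv_eta_om i j : left_deriv (inr i) (om j) = - ((i == j)%:R *: xi j).
Proof.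
rewrite /om /Defs.xi /Defs.eta left_deriv_generatorM left_deriv_generator/= scale0r sub0r.
by rewrite -scalerAr mulr1.
Qed.

Lemma deriv_xi_om_set i A : i \notin A -> left_deriv (inl i) (om_set A) = 0.
Proof.
rewrite /om_set => iA; elim: (enum Lam) => [|j s IH].
  by rewrite big_nil left_deriv1.
rewrite big_cons; case: ifPn => // jA; have [_ ->] := even_om j.
rewrite IH mulr0 addr0 deriv_xi_om; case: eqP => [ij|_]; last by rewrite scale0r mul0r.
by rewrite ij jA in iA.
Qed.

Lemma deriv_eta_om_set i A : left_deriv (inr i) (om_set A) =
  - ((i \in A)%:R *: (xi i * om_set (A :\ i))).
Proof.
have H B : i \notin B -> left_deriv (inr i) (om_set B) = 0.
  rewrite /om_set => iB; elim: (enum Lam) => [|j s IH].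
    by rewrite big_nil left_deriv1.
  rewrite big_cons; case: ifPn => // jB; have [_ ->] := even_om j.
  rewrite IH mulr0 addr0 deriv_eta_om; case: eqP => [ij|_]; last by rewrite scale0r oppr0 mul0r.
  by rewrite ij jB in iB.
case: (boolP (i \in A)) => iA; last by rewrite H// scale0r oppr0.
rewrite scale1r (om_setD1 iA); have [_ ->] := even_om i.
by rewrite H ?mulr0 ?addr0 ?deriv_eta_om ?eqxx ?scale1r ?mulNr// !inE eqxx.
Qed.

(** If i is not in A, then om_A is the xi_i-derivative of xi_i om_A, and integrates to zero. For the
    full set, the two derivatives of index i act on om_i alone and give 1. *)
Lemma berezin_om_set A : berezin (om_set A) = (A == [set: Lam])%:R.
Proof.
case: eqP => [->|/eqP AT]; last first.
  have [i iA] : exists i, i \notin A.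
    apply/existsP; rewrite -negb_forall; apply: contra AT => /forallP AT.
    by apply/eqP/setP => i; rewrite inE AT.
  have := berezin_left_deriv (inl i) (xi i * om_set A).
  rewrite /Defs.xi left_deriv_generatorM eqxx scale1r deriv_xi_om_set//.
  by rewrite mulr0 subr0.
pose D (s : seq Lam) (F : Gr) :=
  foldr (fun i H => left_deriv (inr i) (left_deriv (inl i) H)) F s.
have DM (s : seq Lam) i F : i \notin s -> D s (om i * F) = om i * D s F.
  elim: s => //= j s IH; rewrite inE negb_or => /andP[ij si]; rewrite IH//.
  have [_ d] := even_om i.
  rewrite d deriv_xi_om eq_sym (negPf ij) scale0r mul0r add0r.
  by rewrite d deriv_eta_om eq_sym (negPf ij) scale0r oppr0 mul0r add0r.
suff H (s : seq Lam) : uniq s -> D s (\prod_(i <- s) om i) = 1.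
  rewrite /berezin /om_set; under eq_bigl do rewrite inE.
  by rewrite -/(D _ _) H ?enum_uniq// body1.
elim: s => [|i s IH /andP[si us]]; first by rewrite big_nil.
rewrite big_cons /= DM// IH// mulr1 deriv_xi_om eqxx scale1r.
by rewrite /Defs.eta left_deriv_generator eqxx scale1r.
Qed.

Implicit Types (beta : Lam -> Lam -> R).

(* exp (- \sum_(i, j) beta i j xi_i eta_j); the summands commute and square to
   zero. *)
Definition gexp beta : Gr := \prod_(p : Lam * Lam) (1 - beta p.1 p.2 *: (xi p.1 * eta p.2)).

Lemma even_xi_eta i j : even_elt (xi i * eta j).
Proof. exact: even_generatorM. Qed.

Lemma even_gexp beta : even_elt (gexp beta).
Proof.
apply: even_prod => p; apply: evenD; first exact: even1.
by apply/evenN/evenZ/even_xi_eta.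
Qed.

(** Passing d_(eta_l) through xi_k changes the sign of - beta_kl. Each factor of the product can be
    put back behind its derivative because xi_k^2 = 0. *)
Lemma deriv_eta_gexp beta l :
  left_deriv (inr l) (gexp beta) = (\sum_k beta k l *: xi k) * gexp beta.
Proof.
rewrite /gexp.
have -> : \sum_k beta k l *: xi k =
    \sum_(p : Lam * Lam) (if p.2 == l then beta p.1 p.2 *: xi p.1 else 0).
  rewrite -(pair_bigA _ (fun i j => if j == l then beta i j *: xi i else 0))/=.
  apply: eq_bigr => k _; rewrite (bigD1 l)//= eqxx big1 ?addr0// => j jl.
  by rewrite (negPf jl).
elim: (index_enum _) => [|p s IH]; first by rewrite !big_nil left_deriv1 mul0r.
rewrite !big_cons; set W := 1 - _; set E := \prod_(_ <- s) _ in IH *.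
have eW : even_elt W.
  by apply: evenD; [exact: even1|apply/evenN/evenZ/even_xi_eta].
have [cW ->] := eW; rewrite IH mulrA.
have dW : left_deriv (inr l) W = if p.2 == l then beta p.1 p.2 *: xi p.1 else 0.
  rewrite /W left_derivD left_deriv1 add0r -scaleN1r !left_derivZ.
  rewrite /Defs.xi left_deriv_generatorM left_deriv_generator/= scale0r sub0r.
  rewrite -scalerAr mulr1 eq_sym (inj_eq (@inr_inj _ _)).
  by case: ifP => _; rewrite ?scale1r ?scale0r ?oppr0 ?scaler0 ?scalerN ?scaleN1r ?opprK.
rewrite dW [RHS]mulrDl; congr (_ + _); last by rewrite cW !mulrA.
case: ifP => _; last by rewrite !mul0r.
rewrite [RHS]mulrA; congr (_ * E); rewrite /W mulrBr mulr1 -scalerAl -scalerAr mulrA /Defs.xi generator_sqr.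
by rewrite mul0r !scaler0 subr0.
Qed.

(** The principal minor of - beta on the complement of A. Then [coefd beta k j A] is the cofactor of
    its entry (k, j), and is zero if k or j lies in A. *)
Definition coefc beta A : R := berezin (om_set A * gexp beta).
Definition coefd beta k j A : R := berezin (xi k * eta j * (om_set A * gexp beta)).

Lemma coefd0 beta k j A : k \in A -> coefd beta k j A = 0.
Proof.
move=> kA; rewrite /coefd; have [cA _] := even_om_set A.
by rewrite -mulrA [eta j * _]mulrA -(cA (eta j)) !mulrA xi_om_set// !mul0r berezin0.
Qed.

(* Cofactor expansion, in the form: the Berezin integral of
   [d_(eta_l) (eta_j om_A exp (...))] vanishes. *)
Lemma coef_expand beta l j A :
  (l == j)%:R * coefc beta A =
  (l \in A)%:R * coefd beta l j (A :\ l) - \sum_k beta k l * coefd beta k j A.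
Proof.
have := berezin_left_deriv (inr l) (eta j * (om_set A * gexp beta)).
rewrite /Defs.eta left_deriv_generatorM (inj_eq (@inr_inj _ _)).
have [_ ->] := even_om_set A; rewrite deriv_eta_om_set deriv_eta_gexp.
rewrite -/(Defs.eta R j) -scaleN1r berezinD !berezinZ mulN1r => /eqP.
rewrite subr_eq0 => /eqP ->; rewrite /coefd.
have cE := (even_gexp beta).1; have cA := (even_om_set A).1.
have -> : eta j * (- ((l \in A)%:R *: (xi l * om_set (A :\ l))) * gexp beta +
    om_set A * ((\sum_k beta k l *: xi k) * gexp beta)) =
  (l \in A)%:R *: (xi l * eta j * (om_set (A :\ l) * gexp beta)) +
  \sum_k (- beta k l) *: (xi k * eta j * (om_set A * gexp beta)).
  rewrite mulrDr; congr (_ + _).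
    rewrite mulNr mulrN -scalerAl -scalerAr -scalerN !mulrA; congr (_ *: _).
    by rewrite /Defs.eta /Defs.xi generatorC !mulNr opprK.
  rewrite mulr_suml !mulr_sumr; apply: eq_bigr => k _.
  rewrite -scalerAl -!scalerAr scaleNr -scalerN; congr (_ *: _).
  rewrite [om_set A * (_ * _)]mulrA cA -mulrA mulrA.
  by rewrite !mulrA /Defs.eta /Defs.xi [generator R (inr j) * _]generatorC !mulNr.
rewrite berezinD berezinZ berezin_sum; congr (_ + _).
by rewrite -sumrN; apply: eq_bigr => k _; rewrite berezinZ mulNr.
Qed.

End Berezin.

(** * Sums over subsets and over multi-indices *)

Section SubsetSums.
Variables (V : nmodType) (J : finType).

Lemma sum_subsets_cons (F : {set J} -> V) i (l : seq J) : i \notin l ->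
  \sum_(A : {set J} | A \subset i :: l) F A =
  \sum_(A : {set J} | A \subset l) F A + \sum_(A : {set J} | A \subset l) F (i |: A).
Proof.
move=> il; rewrite (bigID (fun A : {set J} => i \notin A))/=; congr (_ + _).
  apply: eq_bigl => A; apply/andP/subsetP => [[/subsetP AS iA] j jA|AS].
    by have := AS j jA; rewrite inE => /predU1P[ji|//]; rewrite -ji jA in iA.
  split; last by apply/negP => /AS; apply/negP.
  by apply/subsetP => j /AS jl; rewrite inE jl orbT.
rewrite (reindex_onto (fun A : {set J} => i |: A) (fun A => A :\ i))/=; last first.
  by move=> A /andP[_]; rewrite negbK => iA; rewrite setD1K.
apply: eq_bigl => A; rewrite setU11 andbT; apply/andP/subsetP => [[/subsetP AS /eqP AE] j jA|AS].
  have ji : j != i by move: jA; rewrite -AE !inE => /andP[].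
  by have := AS j; rewrite !inE jA orbT (negPf ji) => /(_ isT).
have iA : i \notin A by apply/negP => /AS; apply/negP.
split; last by rewrite setU1K.
by apply/subsetP => j; rewrite !inE => /predU1P[->|/AS ->]; rewrite ?eqxx ?orbT.
Qed.

(** Multi-indices with exponents at most 1 are indicator functions of sets; the bound n.+2 makes
    room for the exponent 1. *)
Lemma sum_ffun_le1 n (F : {ffun J -> 'I_n.+2} -> V) :
  (forall (alpha : {ffun J -> 'I_n.+2}) j, (1 < alpha j)%N -> F alpha = 0) ->
  \sum_alpha F alpha = \sum_(A : {set J}) F [ffun j => inord (j \in A)].
Proof.
move=> F0; rewrite (bigID (fun alpha : {ffun J -> 'I_n.+2} => [forall j, (alpha j <= 1)%N]))/=.
rewrite [X in _ + X]big1 ?addr0; last first.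
  by move=> alpha /forallPn[j]; rewrite -ltnNge; exact: F0.
rewrite (reindex_onto (fun A : {set J} => [ffun j => inord (j \in A) : 'I_n.+2])
  (fun alpha : {ffun J -> 'I_n.+2} => [set j | alpha j == 1%N :> nat]))/=; last first.
  move=> alpha /forallP le1; apply/ffunP => j; rewrite ffunE inE; apply: val_inj.
  rewrite /= inordK; last by case: (_ == _).
  by have := le1 j; case: (nat_of_ord (alpha j)) => [|[|]].
apply: eq_bigl => A; apply/andP; split.
  by apply/forallP => j; rewrite ffunE inordK; case: (_ \in _).
by apply/eqP/setP => j; rewrite inE ffunE inordK; case: (_ \in _).
Qed.

End SubsetSums.

Lemma prod_central_rev (R : comNzRingType) (G J : finType) (f : J -> grassmann R G) l (P : pred J) :
  (forall j, central (f j)) -> \prod_(j <- rev l | P j) f j = \prod_(j <- l | P j) f j.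
Proof.
move=> cf; elim: l => [|i l IH]; first by rewrite /rev.
rewrite rev_cons -cats1 big_cat IH big_cons big_cons big_nil.
by case: (P i); rewrite /= mulr1 ?cf.
Qed.

Lemma prodZ_central (R : comNzRingType) (G J : finType) (c : J -> R) (f : J -> grassmann R G) l
    (P : pred J) :
  \prod_(j <- l | P j) (c j *: f j) = (\prod_(j <- l | P j) c j) *: \prod_(j <- l | P j) f j.
Proof.
elim: l => [|i l IH]; first by rewrite !big_nil scale1r.
rewrite !big_cons; case: (P i) => //.
by rewrite IH -scalerAl -scalerAr scalerA.
Qed.

From mathcomp Require Import all_classical all_reals all_analysis.
From mathcomp Require Import measurable_realfun ring lra zify.
Import numFieldNormedType.Exports.
Local Open Scope classical_set_scope.

(** * Integrals and continuous functions of real variables *)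

Section RealIntegral.
Variable R : realType.
Notation mu := (@lebesgue_measure R).
Implicit Types (f F : R -> R) (a b c M x y : R).

(** Not oriented: for b < a the interval is empty and the integral is zero. *)
Definition rint a b f : R := \int[mu]_(t in `[a, b]) f t.

Lemma continuous_integrable a b f : continuous f ->
  mu.-integrable `[a, b] (EFin \o f).
Proof.
move=> cf; apply: continuous_compact_integrable; first exact: segment_compact.
by apply: continuous_subspaceT.
Qed.

Lemma eq_rint a b f F : (forall t, a <= t <= b -> f t = F t) ->
  rint a b f = rint a b F.
Proof.
by move=> fF; apply: eq_Rintegral => t; rewrite inE/= in_itv/= => /fF.
Qed.

Lemma rint_gt a b f : b < a -> rint a b f = 0.
Proof. by move=> ba; rewrite /rint set_itv_ge ?Rintegral_set0// bnd_simp -ltNge. Qed.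

Lemma rintxx a f : rint a a f = 0.
Proof. by rewrite /rint set_itv1 Rintegral_set1. Qed.

Lemma rint_cst a b c : a <= b -> rint a b (fun=> c) = c * (b - a).
Proof.
move=> ab; rewrite /rint Rintegral_cst//= lebesgue_measure_itv/= lte_fin.
by move: ab; rewrite le_eqVlt => /predU1P[->|->//]; rewrite ltxx subrr.
Qed.

Lemma rintD a b f F : continuous f -> continuous F ->
  rint a b (fun t => f t + F t) = rint a b f + rint a b F.
Proof. by move=> cf cF; rewrite /rint RintegralD//; exact: continuous_integrable. Qed.

Lemma rintB a b f F : continuous f -> continuous F ->
  rint a b (fun t => f t - F t) = rint a b f - rint a b F.
Proof. by move=> cf cF; rewrite /rint RintegralB//; exact: continuous_integrable. Qed.

Lemma rintZ a b c f : continuous f ->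
  rint a b (fun t => c * f t) = c * rint a b f.
Proof. by move=> cf; rewrite /rint RintegralZl//; exact: continuous_integrable. Qed.

Lemma rint_sum (I : Type) (l : seq I) x y (f : I -> R -> R) :
  (forall z, continuous (f z)) ->
  rint x y (fun t => \sum_(z <- l) f z t) = \sum_(z <- l) rint x y (f z) /\
  continuous (fun t => \sum_(z <- l) f z t).
Proof.
move=> cf; elim: l => [|z l [IH1 IH2]].
  under eq_fun do rewrite big_nil; rewrite big_nil; split; last exact: cst_continuous.
  have [xy|xy] := leP x y; last exact: rint_gt.
  by rewrite rint_cst// mul0r.
under eq_fun do rewrite big_cons; rewrite big_cons; split; first by rewrite rintD// IH1.
by move=> t; apply: cvgD; [exact: cf|exact: IH2].
Qed.

Lemma rint_le a b f F : continuous f -> continuous F ->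
  (forall t, a <= t <= b -> f t <= F t) -> rint a b f <= rint a b F.
Proof.
move=> cf cF fF; apply: le_Rintegral => //; exact: continuous_integrable.
Qed.

Lemma rint_bound a b f M : a <= b -> continuous f ->
  (forall t, a <= t <= b -> `|f t| <= M) -> `|rint a b f| <= M * (b - a).
Proof.
move=> ab cf fM; have cM r : continuous (fun _ : R => r : R) by exact: cst_continuous.
rewrite -(rint_cst M ab) ler_norml -[- rint _ _ _]mulN1r -(rintZ _ _ (-1) (cM M)).
apply/andP; split; apply: rint_le => //.
  by move=> t tab; have := fM _ tab; rewrite ler_norml mulN1r => /andP[].
by move=> t tab; have := fM _ tab; rewrite ler_norml => /andP[].
Qed.

Lemma rint_split a b c f : continuous f -> a <= b -> b <= c ->
  rint a c f = rint a b f + rint b c f.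
Proof.
move=> cf ab bc; apply/eqP; rewrite addrC -subr_eq; apply/eqP.
rewrite /rint Rintegral_itvB ?bnd_simp//; last exact: continuous_integrable.
rewrite Rintegral_itv_obnd_cbnd//.
apply: (@integrableS _ _ _ mu `[b, c] `]b, c]) => //; last exact: continuous_integrable.
exact: subset_itv_oc_cc.
Qed.

Lemma rint_derive a x f : a < x -> continuous f ->
  is_derive x 1 (fun u => rint a u f) (f x).
Proof.
move=> ax cf.
have [d e] := @continuous_FTC1_closed _ f a x (x + 1) (ltac:(by rewrite ltrDl))
  (@continuous_integrable a (x + 1) f cf) ax (cf x).
by apply: DeriveDef; [exact: d|rewrite -derive1E; exact: e].
Qed.

Lemma rint_FTC a b f F : a <= b -> continuous f ->
  (forall t : R, a <= t <= b -> is_derive t (1 : R) F (f t)) ->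
  rint a b f = F b - F a.
Proof.
move=> ab cf Ff; have cF (t : R) : a <= t <= b -> {for t, continuous F}.
  move=> tab; apply: differentiable_continuous; apply/derivable1_diffP.
  by have [] := Ff t tab.
move: ab; rewrite le_eqVlt => /predU1P[<-|ab]; first by rewrite rintxx subrr.
rewrite /rint /Rintegral (@continuous_FTC2 _ f F)//.
- exact: continuous_subspaceT.
- split.
  + by move=> t; rewrite in_itv/= => /andP[a_t tb]; have [|//] := Ff t; rewrite !ltW.
  + by apply: cvg_at_right_filter; apply: cF; rewrite lexx ltW.
  + by apply: cvg_at_left_filter; apply: cF; rewrite lexx ltW.
- move=> t; rewrite in_itv/= => /andP[a_t tb]; rewrite derive1E.
  by have [|//] := Ff t; rewrite !ltW.
Qed.

Lemma floor_approx_cvg x :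
  (Num.floor (n.+1%:R * x))%:~R / n.+1%:R @[n --> \oo] --> x.
Proof.
apply: (@squeeze_cvgr _ _ _ _ (fun n => x - n.+1%:R^-1) (fun=> x)).
- apply: nearW => n; have n0 : 0 < n.+1%:R :> R by [].
  have /andP[h1 h2] := floor_itv (n.+1%:R * x).
  rewrite ler_pdivlMr// ler_pdivrMr// mulrBl mulVf ?gt_eqF//.
  rewrite mulrC h1 andbT lerBlDr ltW//.
  by move: h2; rewrite intrD.
- rewrite -[X in _ --> X]subr0; apply: cvgB; first exact: cvg_cst.
  exact: cvg_harmonic.
- exact: cvg_cst.
Qed.

(* A Caratheodory function is jointly measurable: round its continuous argument
   to the grid of mesh [1 / n]. *)
Lemma measurable_caratheodory d (T : measurableType d) (h : R -> T -> R) :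
  (forall y : T, continuous (fun x : R => h x y : R)) ->
  (forall x, measurable_fun setT (h x)) ->
  measurable_fun [set: R * T] (fun q : R * T => h q.1 q.2).
Proof.
move=> ch mh.
apply: (@measurable_fun_cvg _ _ _ setT
  (fun n (q : R * T) => h ((Num.floor (n.+1%:R * q.1))%:~R / n.+1%:R) q.2)).
  move=> n _ Y mY; rewrite setTI.
  rewrite [X in measurable X](_ : _ = \bigcup_(m in [set: int])
    ([set x : R | Num.floor (n.+1%:R * x) = m] `*`
     (h (m%:~R / n.+1%:R) @^-1` Y))); last first.
    apply/seteqP; split => [[x y] /= xy|[x y] [m _ [/= <- ]]//].
    by exists (Num.floor (n.+1%:R * x)).
  apply: countable_bigcupT_measurable => // m; apply: measurableX.
    rewrite [X in measurable X](_ : _ = `[m%:~R / n.+1%:R, (m + 1)%:~R / n.+1%:R[%classic)//.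
    apply/seteqP; split => [x|x] /=; rewrite in_itv/= ler_pdivrMr// ltr_pdivlMr// [x * _]mulrC.
      by move=> <-; exact: floor_itv.
    exact: floor_def.
  by rewrite -[X in measurable X]setTI; apply: mh.
move=> [x y] _ /=; exact: (cvg_comp _ _ (@floor_approx_cvg x) (ch y x)).
Qed.

Section Rectangle.
Variables (a b c d' M : R) (h : R -> R -> R).
Hypothesis mh : measurable_fun [set: R * R] (fun q : R * R => h q.1 q.2).
Hypothesis hM : forall x y, a <= x <= b -> c <= y <= d' -> `|h x y| <= M.

Let D : set (R * R) := `[a, b] `*` `[c, d'].
Let h2 (q : R * R) := h q.1 q.2.

Let mD : measurable (D : set (measurableTypeR R * measurableTypeR R)). Proof. exact: measurableX. Qed.

Lemma rectangle_integrable : (mu \x mu)%E.-integrable D (EFin \o h2).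
Proof.
apply: measurable_bounded_integrable => //.
- suff : ((mu \x mu)%E D < +oo)%E by [].
  rewrite /D product_measure1E//= !lebesgue_measure_itv/=.
  by do 2 case: ifP => _; rewrite ?mule0 ?mul0e// -EFinM ltry.
- by apply: measurable_funTS; exact: mh.
- exists M; split; first exact: num_real.
  move=> N MN [x y] [/= xab ycd]; apply: le_trans (ltW MN).
  by apply: hM; [move: xab; rewrite in_itv|move: ycd; rewrite in_itv].
Qed.

Let ihD : (mu \x mu)%E.-integrable setT ((EFin \o h2) \_ D).
Proof. exact: ((integrable_mkcond _ mD).1 rectangle_integrable). Qed.

Let ihx x : a <= x <= b -> mu.-integrable `[c, d'] (EFin \o h x).
Proof.
move=> xab; apply: measurable_bounded_integrable => //.
- by rewrite /= lebesgue_measure_itv/=; case: ifP => _; rewrite ?ltry.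
- by apply: measurable_funTS; exact: (measurableT_comp mh (pair1_measurable x)).
- exists M; split; first exact: num_real.
  move=> N MN y /= ycd; apply: le_trans (ltW MN).
  by apply: hM; move: ycd; rewrite ?in_itv.
Qed.

Lemma rint_prod :
  \int[(mu \x mu)%E]_(q in D) h2 q = rint a b (fun x => rint c d' (h x)).
Proof.
rewrite /rint /Rintegral; congr fine.
rewrite integral_mkcond -integral12_prod_meas1; last exact: ihD.
rewrite [RHS]integral_mkcond; apply: eq_integral => x _.
rewrite /fubini_F/= patchE; case: ifPn => [xab|xab]; last first.
  apply: integral0_eq => y _; rewrite patchE ifF//; apply/negbTE.
  by apply: contra xab; rewrite !inE => -[].
rewrite /Rintegral fineK; last first.
  by apply: integrable_fin_num => //; apply: ihx; move: xab; rewrite inE/= in_itv.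
rewrite [RHS]integral_mkcond; apply: eq_integral => y _.
rewrite !patchE; have -> : ((x, y) \in D) = (y \in `[c, d']%classic); last by [].
by move: xab; rewrite inE => xab; apply/idP/idP; rewrite !inE; [case|split].
Qed.

Let ihy y : c <= y <= d' -> mu.-integrable `[a, b] (EFin \o h^~ y).
Proof.
move=> ycd; apply: measurable_bounded_integrable => //.
- by rewrite /= lebesgue_measure_itv/=; case: ifP => _; rewrite ?ltry.
- by apply: measurable_funTS; exact: (measurableT_comp mh (pair2_measurable y)).
- exists M; split; first exact: num_real.
  move=> N MN x /= xab; apply: le_trans (ltW MN).
  by apply: hM; move: xab; rewrite ?in_itv.
Qed.

Lemma rint_swap : rint a b (fun x => rint c d' (h x)) =
  rint c d' (fun y => rint a b (h^~ y)).
Proof.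
rewrite -rint_prod /rint /Rintegral; congr fine.
rewrite integral_mkcond -integral21_prod_meas1; last exact: ihD.
rewrite [RHS]integral_mkcond; apply: eq_integral => y _.
rewrite /fubini_G/= patchE; case: ifPn => [ycd|ycd]; last first.
  apply: integral0_eq => x _; rewrite patchE ifF//; apply/negbTE.
  by apply: contra ycd; rewrite !inE => -[].
rewrite /Rintegral fineK; last first.
  by apply: integrable_fin_num => //; apply: ihy; move: ycd; rewrite inE/= in_itv.
rewrite [RHS]integral_mkcond; apply: eq_integral => x _.
rewrite !patchE; have -> : ((x, y) \in D) = (x \in `[a, b]%classic); last by [].
by move: ycd; rewrite inE => ycd; apply/idP/idP; rewrite !inE; [case|split].
Qed.

End Rectangle.

End RealIntegral.

(** * Continuous functions of finitely many variables *)

Section Continuity.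
Variable R : realType.

Definition box (J : finType) (M : R) (v : J -> R) : Prop := forall j, `|v j| <= M.

(* Continuity, in the form of uniform continuity on bounded sets, which is
   equivalent since R^J is locally compact. *)
Definition cts (J : finType) (f : (J -> R) -> R) : Prop :=
  forall M e : R, 0 < e -> exists2 d : R, 0 < d & forall u v, box M u -> box M v ->
    (forall j, `|u j - v j| <= d) -> `|f u - f v| <= e.

Definition cts1 (f : R -> R) : Prop :=
  forall M e : R, 0 < e -> exists2 d : R, 0 < d & forall x y, `|x| <= M -> `|y| <= M ->
    `|x - y| <= d -> `|f x - f y| <= e.

Local Notation upd v i t := (@dfwith _ (fun=> R) v i t).

Lemma finite_witness (J : finType) (P : J -> R -> Prop) :
  (forall j d d', P j d -> d' <= d -> P j d') ->
  (forall j, exists2 d : R, 0 < d & P j d) -> exists2 d : R, 0 < d & forall j, P j d.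
Proof.
move=> Pm Pd.
have [d dP] : {d : J -> R & forall j, 0 < d j /\ P j (d j)}.
  by apply: (@choice J R (fun j x => 0 < x /\ P j x)) => j; have [x] := Pd j; exists x.
exists (\big[Order.min/1]_j d j).
  by apply: (big_ind (fun x => 0 < x)) => // [x y x0 y0|j _]; [rewrite lt_min x0|have [] := dP j].
by move=> j; apply: Pm (dP j).2 _; rewrite (bigD1 j)//= ge_min lexx.
Qed.

Lemma boxW (J : finType) M N (v : J -> R) : M <= N -> box M v -> box N v.
Proof. by move=> MN vM j; apply: le_trans MN. Qed.

Lemma box_upd (J : finType) M (v : J -> R) i t : box M v -> `|t| <= M ->
  box M (upd v i t).
Proof.
by move=> vM tM j; case: (eqVneq i j) => [<-|ij]; rewrite ?dfwithin ?dfwithout.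
Qed.

Lemma box_ge (J : finType) (v : J -> R) : exists2 M : R, 0 <= M & box M v.
Proof.
exists (\sum_j `|v j|); first exact: sumr_ge0.
by move=> j; rewrite (bigD1 j)//= lerDl sumr_ge0.
Qed.

Lemma updK (J : finType) (v : J -> R) i : upd v i (v i) = v.
Proof.
by apply/funext => j; case: (eqVneq i j) => [<-|ij]; rewrite ?dfwithin ?dfwithout.
Qed.

Lemma upd_upd (J : finType) (v : J -> R) i x y : upd (upd v i x) i y = upd v i y.
Proof.
by apply/funext => j; case: (eqVneq i j) => [<-|ij]; rewrite ?dfwithin ?dfwithout.
Qed.

Lemma updC (J : finType) (v : J -> R) i j x y : i != j ->
  upd (upd v i x) j y = upd (upd v j y) i x.
Proof.
move=> ij; apply/funext => k; case: (eqVneq i k) => [<-|ik].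
  by rewrite dfwithin dfwithout 1?eq_sym// dfwithin.
rewrite [RHS]dfwithout//; case: (eqVneq j k) => [<-|jk]; rewrite ?dfwithin//.
by rewrite !dfwithout.
Qed.

(** Walk from 0 to u in n equal steps. Each step moves every coordinate by at most |M| / n <= d, and
    so changes f by at most 1. *)
Lemma cts_bounded (J : finType) (f : (J -> R) -> R) M : cts f ->
  exists2 B : R, 0 <= B & forall u, box M u -> `|f u| <= B.
Proof.
move=> cf; have [d d0 df] := cf `|M| 1 ltr01.
pose n := (Num.truncn (`|M| / d)).+1.
have n0 : 0 < n%:R :> R by rewrite ltr0n.
have nM : `|M| / n%:R <= d.
  rewrite ler_pdivrMr// mulrC -ler_pdivrMr//.
  by apply: ltW; rewrite /n; apply: truncnS_gt.
exists (`|f (fun=> 0)| + n%:R); first by rewrite addr_ge0.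
move=> u uM; have uM' j : `|u j| <= `|M|.
  by apply: le_trans (uM j) _; exact: ler_norm.
pose w k j := k%:R / n%:R * u j.
have wM k : (k <= n)%N -> box `|M| (w k).
  move=> kn j; rewrite normrM -[leRHS]mul1r; apply: ler_pM => //.
  by rewrite ger0_norm ?divr_ge0// ler_pdivrMr// mul1r ler_nat.
suff H k : (k <= n)%N -> `|f (w k) - f (fun=> 0)| <= k%:R.
  have := H _ (leqnn n); have -> : w n = u.
    by apply/funext => j; rewrite /w divff ?mul1r ?gt_eqF.
  move=> h; rewrite -[f u](subrK (f (fun=> 0))).
  by apply: le_trans (ler_normD _ _) _; rewrite addrC lerD.
elim: k => [_|k IH kn].
  have -> : w 0%N = fun=> 0 by apply/funext => j; rewrite /w !mul0r.
  by rewrite subrr normr0.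
rewrite -[_ - _](subrKA (f (w k))) -natr1 addrC.
apply: le_trans (ler_normD _ _) _; apply: lerD; first exact/IH/ltnW.
apply: df; [exact: wM|exact/wM/ltnW|move=> j].
rewrite /w -mulrBl -mulrBl -natr1 addrAC subrr add0r mul1r normrM.
apply: le_trans nM; rewrite mulrC ler_pM//.
by rewrite ger0_norm ?invr_ge0.
Qed.

Lemma cts_cst (J : finType) c : cts (fun _ : J -> R => c).
Proof. by move=> M e e0; exists 1 => // *; rewrite subrr normr0 ltW. Qed.

Lemma cts_proj (J : finType) (j : J) : cts (fun v => v j).
Proof. by move=> M e e0; exists e. Qed.

Lemma cts_comp (I J : finType) (f : (J -> R) -> R) (s : J -> (I -> R) -> R) :
  cts f -> (forall j, cts (s j)) -> cts (fun v => f (s^~ v)).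
Proof.
move=> cf cs M e e0.
have [N NP] : {N : J -> R & forall j, 0 <= N j /\ forall u, box M u -> `|s j u| <= N j}.
  apply: (@choice J R (fun j x => 0 <= x /\ forall u, box M u -> `|s j u| <= x)) => j.
  by have [x] := cts_bounded M (cs j); exists x.
have sN u : box M u -> box (\sum_j N j) (s^~ u).
  move=> uM j; apply: le_trans ((NP j).2 _ uM) _.
  by rewrite (bigD1 j)//= lerDl sumr_ge0// => k _; case: (NP k).
have [d d0 df] := cf (\sum_j N j) e e0.
have [d' d'0 d'P] : exists2 d' : R, 0 < d' & forall j, forall u v, box M u -> box M v ->
    (forall j, `|u j - v j| <= d') -> `|s j u - s j v| <= d.
  apply: finite_witness; last by move=> j; exact: cs.
  by move=> j x y xP yx u v uM vM uv; apply: xP => // k; apply: le_trans yx.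
exists d' => // u v uM vM uv; apply: df; [exact: sN|exact: sN|].
by move=> j; exact: d'P.
Qed.

Lemma cts_comp1 (J : finType) (g : R -> R) (f : (J -> R) -> R) :
  cts1 g -> cts f -> cts (fun v => g (f v)).
Proof.
move=> cg cf; apply: (@cts_comp J unit (fun w => g (w tt)) (fun=> f)) => //.
move=> M e e0; have [d d0 dg] := cg M e e0; exists d => // u v uM vM uv.
exact: dg.
Qed.

Lemma ctsD (J : finType) (f g : (J -> R) -> R) :
  cts f -> cts g -> cts (fun v => f v + g v).
Proof.
move=> cf cg M e e0; have e20 : 0 < e / 2 by rewrite divr_gt0.
have [d d0 df] := cf M _ e20; have [d' d'0 dg] := cg M _ e20.
exists (Num.min d d'); first by rewrite lt_min d0.
move=> u v uM vM uv; rewrite opprD addrACA [leRHS]splitr.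
apply: le_trans (ler_normD _ _) _; apply: lerD; [apply: df|apply: dg] => // j;
  by apply: le_trans (uv j) _; rewrite ge_min lexx ?orbT.
Qed.

Lemma ctsM (J : finType) (f g : (J -> R) -> R) :
  cts f -> cts g -> cts (fun v => f v * g v).
Proof.
move=> cf cg M e e0.
have [A A0 fA] := cts_bounded M cf; have [B B0 gB] := cts_bounded M cg.
have A1 : 0 < A + 1 by rewrite ltr_wpDl.
have B1 : 0 < B + 1 by rewrite ltr_wpDl.
have [d d0 df] := cf M (e / 2 / (B + 1)) (ltac:(by rewrite !divr_gt0)).
have [d' d'0 dg] := cg M (e / 2 / (A + 1)) (ltac:(by rewrite !divr_gt0)).
exists (Num.min d d'); first by rewrite lt_min d0.
move=> u v uM vM uv.
have -> : f u * g u - f v * g v = (f u - f v) * g u + f v * (g u - g v) by ring.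
rewrite [leRHS]splitr; apply: le_trans (ler_normD _ _) _; rewrite !normrM.
apply: lerD.
  rewrite -[leRHS](@divfK _ (B + 1)) ?gt_eqF//; apply: ler_pM => //.
    by apply: df => // j; apply: le_trans (uv j) _; rewrite ge_min lexx.
  by apply: le_trans (gB _ uM) _; rewrite lerDl.
rewrite -[leRHS](@divfK _ (A + 1)) ?gt_eqF// mulrC; apply: ler_pM => //.
  by apply: dg => // j; apply: le_trans (uv j) _; rewrite ge_min lexx orbT.
by apply: le_trans (fA _ vM) _; rewrite lerDl.
Qed.

Lemma ctsZ (J : finType) c (f : (J -> R) -> R) : cts f -> cts (fun v => c * f v).
Proof. by move=> cf; apply: ctsM => //; exact: cts_cst. Qed.

Lemma ctsN (J : finType) (f : (J -> R) -> R) : cts f -> cts (fun v => - f v).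
Proof.
move=> cf M e e0; have [d d0 df] := cf M e e0; exists d => // u v uM vM uv.
by rewrite -opprD normrN df.
Qed.

Lemma ctsB (J : finType) (f g : (J -> R) -> R) :
  cts f -> cts g -> cts (fun v => f v - g v).
Proof. by move=> cf cg; apply: ctsD => //; exact: ctsN. Qed.

Lemma cts_sum (J : finType) (I : Type) (r : seq I) (P : pred I) (F : I -> (J -> R) -> R) :
  (forall i, cts (F i)) -> cts (fun v => \sum_(i <- r | P i) F i v).
Proof.
move=> cF; elim: r => [|i r IH].
  by rewrite (_ : (fun v => _) = fun=> 0); [exact: cts_cst|apply/funext => v; rewrite big_nil].
rewrite (_ : (fun v => _) = fun v => (if P i then F i v else 0) +
    \sum_(i <- r | P i) F i v); last first.
  by apply/funext => v; rewrite big_cons; case: ifP; rewrite ?add0r.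
by apply: ctsD => //; case: (P i) => //; exact: cts_cst.
Qed.

Lemma cts_prod (J : finType) (I : Type) (r : seq I) (P : pred I) (F : I -> (J -> R) -> R) :
  (forall i, cts (F i)) -> cts (fun v => \prod_(i <- r | P i) F i v).
Proof.
move=> cF; elim: r => [|i r IH].
  by rewrite (_ : (fun v => _) = fun=> 1); [exact: cts_cst|apply/funext => v; rewrite big_nil].
rewrite (_ : (fun v => _) = fun v => (if P i then F i v else 1) *
    \prod_(i <- r | P i) F i v); last first.
  by apply/funext => v; rewrite big_cons; case: ifP; rewrite ?mul1r.
by apply: ctsM => //; case: (P i) => //; exact: cts_cst.
Qed.

Lemma cts1_expR : cts1 (@expR R).
Proof.
have H (M x y : R) : y <= M -> x <= y -> `|expR x - expR y| <= expR M * `|x - y|.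
  move=> yM xy; rewrite distrC [`|x - y|]distrC !ger0_norm ?subr_ge0 ?ler_expR//.
  have -> : expR y - expR x = expR y * (1 - expR (x - y)).
    by rewrite mulrBr mulr1 -expRD [y + _]addrC subrK.
  apply: ler_pM; rewrite ?expR_ge0 ?ler_expR//.
    by rewrite subr_ge0 -[leRHS]expR0 ler_expR subr_le0.
  by have := expR_ge1Dx (x - y); lra.
move=> M e e0; exists (e / expR M); first by rewrite divr_gt0 ?expR_gt0.
move=> x y xM yM; rewrite ler_pdivlMr ?expR_gt0// mulrC => h; apply: le_trans h.
have [xy|/ltW yx] := leP x y.
  by apply: H => //; apply: le_trans yM; exact: ler_norm.
rewrite distrC [`|x - y|]distrC.
by apply: H => //; apply: le_trans xM; exact: ler_norm.
Qed.

Lemma cts_upd (J : finType) (f : (J -> R) -> R) i (s : (J -> R) -> R) :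
  cts f -> cts s -> cts (fun v => f (upd v i (s v))).
Proof.
move=> cf cs; apply: (@cts_comp J J f (fun j v => upd v i (s v) j)) => // j.
case: (eqVneq i j) => [<-|ij].
  by rewrite (_ : (fun v => _) = s)//; apply/funext => v; rewrite dfwithin.
rewrite (_ : (fun v => _) = (fun v => v j)); first exact: cts_proj.
by apply/funext => v; rewrite dfwithout.
Qed.

Lemma near_dist (x e : R) : 0 < e -> \forall t \near x, `|x - t| <= e.
Proof.
move=> e0; have /cvgrPdist_le h : (fun t : R => t : R) @ x --> x by exact: cvg_id.
exact: h.
Qed.

Lemma cts_section (J : finType) (f : (J -> R) -> R) v i : cts f ->
  continuous (fun t : R => f (upd v i t) : R).
Proof.
move=> cf x; apply/cvgrPdist_le => e e0.
have [M M0 vM] := box_ge v.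
have [d d0 df] := cf (M + `|x| + 1) e e0.
have vM' : box (M + `|x| + 1) v by apply: boxW vM; rewrite -addrA lerDl.
have m0 : 0 < Num.min d 1 by rewrite lt_min d0/=.
apply: filterS (near_dist x m0) => t; rewrite le_min => /andP[xtd xt1]; apply: df.
- by apply: box_upd => //; rewrite addrAC lerDr addr_ge0.
- apply: box_upd => //; have : `|t| <= `|x| + 1; last by lra.
  rewrite -[t](subrK x) addrC -[t - x]opprB.
  by apply: le_trans (ler_normB _ _) _; rewrite lerD2l.
- move=> j; case: (eqVneq i j) => [<-|ij]; first by rewrite !dfwithin.
  by rewrite !dfwithout// subrr normr0 ltW.
Qed.

End Continuity.

(** * Iterated primitives *)

Section Primitives.
Variables (R : realType) (J : finType).
Local Notation upd v i t := (@dfwith _ (fun=> R) v i t).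
Implicit Types (f g k : (J -> R) -> R) (v s : J -> R) (i j : J).

Lemma rint_lipschitz (a x y B : R) (F : R -> R) : continuous F -> 0 <= B -> x <= y ->
  (forall t, a <= t <= y -> `|F t| <= B) ->
  `|rint a y F - rint a x F| <= B * (y - x).
Proof.
move=> cF B0 xy FB; have [ya|ay] := ltP y a.
  by rewrite !rint_gt ?(le_lt_trans xy)// subrr normr0 mulr_ge0// subr_ge0.
have [xa|ax] := ltP x a.
  rewrite (rint_gt _ xa) subr0; apply: le_trans (rint_bound ay cF FB) _.
  by apply: ler_wpM2l => //; rewrite lerD2l lerN2 ltW.
rewrite (rint_split cF ax xy) addrAC subrr add0r; apply: rint_bound => // t /andP[xt ty].
by apply: FB; rewrite ty andbT (le_trans ax).
Qed.

(* The lower bound is immaterial for functions vanishing at negative arguments,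
   to which these operators are applied. *)
Definition prim i f v : R := rint (-2) (v i) (fun t => f (upd v i t)).

(** The interval exceeds [-1, 1], so that functions vanishing off the disc vanish at both ends. *)
Definition tot i f v : R := rint (-2) 2 (fun t => f (upd v i t)).

Definition prims (l : seq J) f := foldr prim f l.
Definition tots (l : seq J) f := foldr tot f l.

Lemma tot_prim i f v : tot i f v = prim i f (upd v i 2).
Proof. by rewrite /prim dfwithin; apply: eq_rint => t _; rewrite upd_upd. Qed.

Lemma prim_upd i f v x : prim i f (upd v i x) = rint (-2) x (fun t => f (upd v i t)).
Proof. by rewrite /prim dfwithin; apply: eq_rint => t _; rewrite upd_upd. Qed.

Lemma cts_prim i f : cts f -> cts (prim i f).
Proof.
move=> cf M e e0; pose N : R := `|M| + 2.
have N0 : 0 < N by rewrite /N ltr_wpDl.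
have [B B0 fB] := cts_bounded N cf.
have [d d0 df] := cf N (e / 2 / (2 * N)) (ltac:(by rewrite !divr_gt0// mulr_gt0)).
exists (Num.min d (e / 2 / (B + 1))).
  by rewrite lt_min d0 !divr_gt0// ltr_wpDl.
have boxN u : box M u -> box N u.
  by apply: boxW; apply: le_trans (ler_norm _) _; rewrite /N lerDl.
have uN (u : J -> R) t : box M u -> -2 <= t <= u i -> `|t| <= N.
  move=> uM /andP[t2 tu]; rewrite ler_norml; apply/andP; split.
    by have := normr_ge0 M; rewrite /N; lra.
  apply: le_trans tu _; apply: le_trans (ler_norm _) _; exact: boxN.
suff H u v : box M u -> box M v -> v i <= u i ->
    (forall j, `|u j - v j| <= Num.min d (e / 2 / (B + 1))) ->
    `|prim i f u - prim i f v| <= e.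
  move=> u v uM vM uv; have [vu|/ltW uv'] := leP (v i) (u i); first exact: H.
  by rewrite distrC; apply: H => // j; rewrite distrC.
move=> uM vM vu uv.
(* The intermediate value has the upper limit of u and the other coordinates of v: the first
   difference changes the integrand only, the second one the upper limit only. *)
rewrite -[_ - _](subrKA (rint (-2) (u i) (fun t => f (upd v i t)))) [leRHS]splitr.
apply: le_trans (ler_normD _ _) _; apply: lerD; last first.
  apply: (@le_trans _ _ (B * (u i - v i))).
    apply: rint_lipschitz => //; first exact: cts_section.
    by move=> t ht; apply: fB; apply: box_upd; [exact: boxN|exact: uN ht].
  apply: (@le_trans _ _ ((B + 1) * (u i - v i))).
    by apply: ler_wpM2r; rewrite ?subr_ge0// lerDl.
  rewrite mulrC -ler_pdivlMr ?ltr_wpDl//; apply: le_trans (ler_norm _) _.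
  by apply: le_trans (uv i) _; rewrite ge_min lexx orbT.
rewrite -rintB; [|exact: cts_section..].
have [ui2|ui2] := ltP (u i) (-2); first by rewrite rint_gt// normr0 divr_ge0// ltW.
apply: (@le_trans _ _ (e / 2 / (2 * N) * (u i - -2))).
  apply: rint_bound => //.
    by move=> t; apply: cvgB; apply: cts_section.
  move=> t ht; apply: df.
  - by apply: box_upd; [exact: boxN|exact: uN ht].
  - by apply: box_upd; [exact: boxN|exact: uN ht].
  - move=> j; case: (eqVneq i j) => [<-|ij]; first by rewrite !dfwithin subrr normr0 ltW.
    by rewrite !dfwithout//; apply: le_trans (uv j) _; rewrite ge_min lexx.
rewrite -[leRHS](@divfK _ (2 * N)) ?gt_eqF ?mulr_gt0//; apply: ler_wpM2l.
  by apply: divr_ge0; [apply: divr_ge0|apply: mulr_ge0]; rewrite // ltW.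
have := boxN _ _ uM i; rewrite ler_norml => /andP[_ h].
by have := normr_ge0 M; rewrite /N in h *; lra.
Qed.

Lemma cts_tot i f : cts f -> cts (tot i f).
Proof.
move=> cf; rewrite (_ : tot i f = fun v => prim i f (upd v i 2)).
  by apply: cts_upd; [exact: cts_prim|exact: cts_cst].
by apply/funext => v; rewrite tot_prim.
Qed.

Lemma cts_prims l f : cts f -> cts (prims l f).
Proof. by move=> cf; elim: l => //= i l; exact: cts_prim. Qed.

Lemma cts_tots l f : cts f -> cts (tots l f).
Proof. by move=> cf; elim: l => //= i l; exact: cts_tot. Qed.

Lemma rint_updC a b c d i j f v : cts f ->
  rint a b (fun x => rint c d (fun y => f (upd (upd v i x) j y))) =
  rint c d (fun y => rint a b (fun x => f (upd (upd v i x) j y))).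
Proof.
move=> cf; pose N : R := `|a| + `|b| + `|c| + `|d|.
have [M M0 vM] := box_ge v; have [B B0 fB] := cts_bounded (M + N) cf.
apply: (@rint_swap _ _ _ _ _ B).
- apply: (@measurable_caratheodory R _ _ (fun x y => f (upd (upd v i x) j y))); last first.
    move=> x; apply: continuous_measurable_fun; exact: cts_section.
  case: (eqVneq i j) => [->|ij] y.
    rewrite (_ : (fun x => _) = fun=> f (upd v j y)); first exact: cst_continuous.
    by apply/funext => x; rewrite upd_upd.
  rewrite (_ : (fun x => _) = fun x => f (upd (upd v j y) i x)).
    exact: cts_section.
  by apply/funext => x; rewrite updC.
- move=> x y /andP[ax xb] /andP[cy yd]; apply: fB.
  have := ler_norm a; have := ler_norm b; have := ler_norm c; have := ler_norm d.
  have := ler_norm (- a); have := ler_norm (- b); have := ler_norm (- c).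
  have := ler_norm (- d); rewrite !normrN => *.
  apply: box_upd; first apply: box_upd.
  + by apply: boxW vM; rewrite lerDl /N !addr_ge0.
  + by rewrite ler_norml /N; apply/andP; split; lra.
  + by rewrite ler_norml /N; apply/andP; split; lra.
Qed.

Lemma primC i j f : cts f -> prim i (prim j f) = prim j (prim i f).
Proof.
move=> cf; case: (eqVneq i j) => [->//|ij]; apply/funext => v.
rewrite {1}/prim; under eq_rint do rewrite {1}/prim dfwithout//.
rewrite (rint_updC _ _ _ _ i j v cf) {2}/prim; apply: eq_rint => y _.
rewrite /prim dfwithout 1?eq_sym//; apply: eq_rint => x _; by rewrite updC.
Qed.

Lemma totC i j f : cts f -> tot i (tot j f) = tot j (tot i f).
Proof.
move=> cf; case: (eqVneq i j) => [->//|ij]; apply/funext => v.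
rewrite {1}/tot (rint_updC _ _ _ _ i j v cf); apply: eq_rint => y _; apply: eq_rint => x _.
by rewrite updC.
Qed.

Lemma prims_rem i l f : cts f -> i \in l -> prims l f = prim i (prims (rem i l) f).
Proof.
move=> cf; elim: l => //= j l IH; rewrite inE; case: (eqVneq j i) => [->//|ji].
rewrite /= => il; by rewrite (IH il) (primC j i (cts_prims (rem i l) cf)).
Qed.

Lemma perm_prims l l' f : cts f -> perm_eq l l' -> prims l f = prims l' f.
Proof.
move=> cf; elim: l l' => [|i l IH] l' ll'.
  by move: ll'; rewrite perm_sym => /perm_nilP ->.
have il' : i \in l' by rewrite -(perm_mem ll') inE eqxx.
rewrite (prims_rem cf il')/= (IH (rem i l'))//.
by have := perm_trans ll' (perm_to_rem il'); rewrite perm_cons.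
Qed.

Lemma tots_rem i l f : cts f -> i \in l -> tots l f = tots (rem i l) (tot i f).
Proof.
move=> cf; elim: l => //= j l IH; rewrite inE; case: (eqVneq j i) => [->|ji].
  move=> _; elim: l {IH} => //= k l IH.
  by rewrite totC -?IH//; exact: cts_tots.
by rewrite /= => il; rewrite IH.
Qed.

Lemma tot0 i : tot i (fun=> 0) = fun=> 0.
Proof. by apply/funext => v; rewrite /tot rint_cst ?mul0r//; lra. Qed.

Lemma tots0 l : tots l (fun=> 0) = fun=> 0.
Proof. by elim: l => //= i l ->; rewrite tot0. Qed.

(** By Fubini, the vanishing integration may be performed first. *)
Lemma tots_tot0 i l f : cts f -> i \in l -> tot i f = (fun=> 0) ->
  tots l f = fun=> 0.
Proof. by move=> cf il f0; rewrite (tots_rem cf il) f0 tots0. Qed.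

Lemma totsD l f g : cts f -> cts g ->
  tots l (fun v => f v + g v) = fun v => tots l f v + tots l g v.
Proof.
move=> cf cg; elim: l => //= i l ->; apply/funext => v.
by rewrite /tot rintD//; apply: cts_section; exact: cts_tots.
Qed.

Lemma totsZ l c f : cts f -> tots l (fun v => c * f v) = fun v => c * tots l f v.
Proof.
move=> cf; elim: l => //= i l ->; apply/funext => v.
by rewrite /tot rintZ//; apply: cts_section; exact: cts_tots.
Qed.

Lemma tots_sum (I : Type) (r : seq I) (P : pred I) (F : I -> (J -> R) -> R) l :
  (forall x, cts (F x)) ->
  tots l (fun v => \sum_(x <- r | P x) F x v) = fun v => \sum_(x <- r | P x) tots l (F x) v.
Proof.
move=> cF; elim: r => [|x r IH].
  rewrite (_ : (fun v => _) = fun=> 0); last by apply/funext => v; rewrite big_nil.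
  by rewrite tots0; apply/funext => v; rewrite big_nil.
have cS : cts (fun v => \sum_(x <- r | P x) F x v) by exact: (@cts_sum R J I r P F cF).
case Pi : (P x); last first.
  rewrite (_ : (fun v => _) = fun v => \sum_(x <- r | P x) F x v).
    by rewrite IH; apply/funext => v; rewrite big_cons Pi.
  by apply/funext => v; rewrite big_cons Pi.
rewrite (_ : (fun v => _) = fun v => F x v + \sum_(x <- r | P x) F x v).
  by rewrite totsD// IH; apply/funext => v; rewrite big_cons Pi.
by apply/funext => v; rewrite big_cons Pi.
Qed.

Lemma tots_bound l f B v : cts f -> box 2 v -> (forall u, box 2 u -> `|f u| <= B) ->
  `|tots l f v| <= B * 4 ^+ size l.
Proof.
move=> cf v2 fB; elim: l v v2 => [|i l IH] v v2 /=; first by rewrite expr0 mulr1 fB.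
apply: (@le_trans _ _ (B * 4 ^+ size l * (2 - -2))).
  apply: rint_bound; [lra|by apply: cts_section; exact: cts_tots|].
  by move=> t t2; apply: IH; apply: box_upd => //; rewrite ler_norml.
by rewrite exprSr mulrA; apply: ler_wpM2l; [apply: mulr_ge0; [|exact: exprn_ge0]|];
  try lra; apply: le_trans (fB _ v2).
Qed.

Lemma tot_derive0 i f f' : cts f' ->
  (forall v t, is_derive t (1 : R) (fun t => f (upd v i t)) (f' (upd v i t))) ->
  (forall v, f (upd v i 2) = f (upd v i (-2))) -> tot i f' = fun=> 0.
Proof.
move=> cf' ff' f2; apply/funext => v.
rewrite /tot (@rint_FTC _ _ _ _ (fun t => f (upd v i t))) ?f2 ?subrr//; first by lra.
exact: cts_section.
Qed.

(** Vanishing near the faces s_i = 0, uniformly in the other coordinates, is preserved by primitives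
    and removes the boundary terms there. The margin e depends on k. *)
Definition test_fun k : Prop :=
  cts k /\ exists2 e : R, 0 < e & forall s, (exists i, s i <= e) -> k s = 0.

Lemma test_prim i k : test_fun k -> test_fun (prim i k).
Proof.
move=> [ck [e e0 ke]]; split; first exact: cts_prim.
exists e => // s [j sj]; rewrite /prim.
have [s2|s2] := ltP (s i) (-2); first by rewrite rint_gt.
rewrite (@eq_rint _ _ _ _ (fun=> 0)) ?rint_cst ?mul0r// => t /andP[_ ts].
apply: ke; exists j; case: (eqVneq i j) sj => [<-|ij] sj; rewrite ?dfwithin ?dfwithout//.
exact: le_trans sj.
Qed.

Lemma test_prims l k : test_fun k -> test_fun (prims l k).
Proof. by move=> tk; elim: l => //= i l; exact: test_prim. Qed.

Lemma prim_derive i k v x : test_fun k ->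
  is_derive x (1 : R) (fun t => prim i k (upd v i t)) (k (upd v i x)).
Proof.
move=> [ck [e e0 ke]].
rewrite (_ : (fun t => _) = fun t => rint (-2) t (fun t => k (upd v i t))); last first.
  by apply/funext => t; rewrite prim_upd.
have [x2|x2] := ltP (-2) x; first by apply: rint_derive => //; exact: cts_section.
(* For x at most -2, k vanishes at x and the primitive vanishes on the neighbourhood of x of radius
   (e - x) / 2. *)
rewrite ke; last by exists i; rewrite dfwithin; lra.
apply: (@near_eq_is_derive R R R (fun=> 0)).
have m0 : 0 < (e - x) / 2 by lra.
apply: filterS (near_dist x m0) => t /ler_normlP [xt _].
have [t2|t2] := ltP t (-2); first by rewrite rint_gt.
rewrite (@eq_rint _ _ _ _ (fun=> 0)) ?rint_cst ?mul0r// => u /andP[_ ut].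
by apply: ke; exists i; rewrite dfwithin; lra.
Qed.

End Primitives.

(** * Integration over discs *)

Section Derivation.
Variable R : realType.
Implicit Types (f g : R -> R) (x a b : R).

Definition drv f x a : Prop := is_derive x (1 : R) f a.

Lemma drv_eq f x a b : drv f x a -> a = b -> drv f x b.
Proof. by move=> ? <-. Qed.

Lemma drv_cst c x : drv (fun=> c) x 0.
Proof. exact: is_derive_cst. Qed.

Lemma drv_id x : drv id x 1.
Proof. exact: is_derive_id. Qed.

Lemma drvD f g x a b : drv f x a -> drv g x b -> drv (fun t => f t + g t) x (a + b).
Proof. exact: is_deriveD. Qed.

Lemma drvM f g x a b : drv f x a -> drv g x b ->
  drv (fun t => f t * g t) x (a * g x + f x * b).
Proof.
move=> df dg; apply: drv_eq (is_deriveM df dg) _.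
by rewrite /GRing.scale/= addrC mulrC.
Qed.

Lemma drvZ c f x a : drv f x a -> drv (fun t => c * f t) x (c * a).
Proof. exact: is_deriveZ. Qed.

Lemma drvN f x a : drv f x a -> drv (fun t => - f t) x (- a).
Proof. exact: is_deriveN. Qed.

Lemma drv_comp f g x a b : drv f (g x) a -> drv g x b -> drv (fun t => f (g t)) x (a * b).
Proof. exact: is_derive1_comp. Qed.

Lemma drv_sum (I : Type) (r : seq I) (P : pred I) (F : I -> R -> R) (D : I -> R) x :
  (forall i, drv (F i) x (D i)) ->
  drv (fun t => \sum_(i <- r | P i) F i t) x (\sum_(i <- r | P i) D i).
Proof.
move=> FD; elim: r => [|i r IH].
  rewrite big_nil (_ : (fun t => _) = fun=> 0); first exact: drv_cst.
  by apply/funext => t; rewrite big_nil.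
rewrite big_cons (_ : (fun t => _) = fun t => (if P i then F i t else 0) +
    \sum_(i <- r | P i) F i t); last first.
  by apply/funext => v; rewrite big_cons; case: ifP; rewrite ?add0r.
case: (P i); first exact: drvD.
by rewrite -[X in drv _ _ X]add0r; apply: drvD => //; exact: drv_cst.
Qed.

Lemma drv_continuous f : (forall x, exists a, drv f x a) -> continuous f.
Proof.
move=> df x; apply: differentiable_continuous; apply/derivable1_diffP.
by have [a [d _]] := df x.
Qed.

End Derivation.

Section DiscIntegral.
Variables (R : realType) (Lam : finType).
Local Notation C := (Lam * bool)%type.
Local Notation upd v i t := (@dfwith _ (fun=> R) v i t).
Local Notation point := (Lam -> R * R).
Implicit Types (u v : C -> R) (i j m a : Lam) (b : bool) (k : (Lam -> R) -> R).

Definition pt (v : C -> R) : point := fun i => (v (i, false), v (i, true)).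

(** The degree-0 parts of the z_i^2. The coordinate (i, false) stands for x_i, and (i, true) for
    y_i. *)
Definition sq (v : C -> R) : Lam -> R :=
  fun i => 1 - v (i, false) ^+ 2 - v (i, true) ^+ 2.

Definition coords (s : seq Lam) : seq C :=
  flatten [seq [:: (i, false); (i, true)] | i <- s].

Definition Int (g : (C -> R) -> R) : R := tots (coords (enum Lam)) g (fun=> 0).

Lemma mem_coords s i b : ((i, b) \in coords s) = (i \in s).
Proof.
elim: s => //= j s IH; rewrite !inE IH !xpair_eqE.
by case: b IH => _; rewrite /= ?andbT ?andbF /= ?orbF.
Qed.

Let pair_ft i : (i, false) != (i, true) :> C. Proof. by rewrite xpair_eqE andbF. Qed.
Let pair_tf i : (i, true) != (i, false) :> C. Proof. by rewrite xpair_eqE andbF. Qed.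
#[local] Hint Resolve pair_ft pair_tf : core.

Lemma updf v i x y : upd (upd v (i, false) x) (i, true) y (i, false) = x.
Proof. by rewrite dfwithout// dfwithin. Qed.

Lemma updt v i x y : upd (upd v (i, false) x) (i, true) y (i, true) = y.
Proof. by rewrite dfwithin. Qed.

Lemma pt_upd v i q :
  pt (upd (upd v (i, false) q.1) (i, true) q.2) =
  @dfwith Lam (fun=> (R * R)%type) (pt v) i q.
Proof.
apply/funext => j; rewrite /pt; case: (eqVneq i j) => [<-|ij].
  by rewrite updf updt dfwithin; case: q.
by rewrite !dfwithout// xpair_eqE (negPf ij).
Qed.

Lemma sq_upd v i b t :
  sq (upd v (i, b) t) = upd (sq v) i (1 - t ^+ 2 - v (i, ~~ b) ^+ 2).
Proof.
apply/funext => j; rewrite /sq; case: (eqVneq i j) => [<-|ij]; last first.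
  by rewrite !dfwithout// xpair_eqE (negPf ij).
by rewrite dfwithin; case: b => /=; rewrite dfwithin dfwithout//; ring.
Qed.

Lemma cts_sq i : cts (fun v => sq v i).
Proof.
apply: ctsB; last by apply: ctsM; exact: cts_proj.
by apply: ctsB; [exact: cts_cst|apply: ctsM; exact: cts_proj].
Qed.

Lemma cts_sqc k : cts k -> cts (fun v => k (sq v)).
Proof. by move=> ck; apply: (cts_comp ck) => i; exact: cts_sq. Qed.

Lemma tots_ext l (f g : (C -> R) -> R) v :
  (forall u, (forall c, c \notin l -> u c = v c) -> f u = g u) ->
  tots l f v = tots l g v.
Proof.
elim: l v => [|c l IH] v fg /=; first exact: fg.
apply: eq_rint => t _; apply: IH => u uv; apply: fg => d; rewrite inE negb_or.
by move=> /andP[dc dl]; rewrite uv// dfwithout// eq_sym.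
Qed.

(** As F vanishes off the disc, the disc can be replaced with the square [-2, 2]^2, to which Fubini
    applies. *)
Lemma disc_tot (F : (C -> R) -> R) v i : cts F ->
  (forall x y, ~ disc (x, y) -> F (upd (upd v (i, false) x) (i, true) y) = 0) ->
  \int[(@lebesgue_measure R \x @lebesgue_measure R)%E]_(q in @disc R)
     F (upd (upd v (i, false) q.1) (i, true) q.2) =
  tot (i, false) (tot (i, true) F) v.
Proof.
move=> cF F0.
pose h x y := F (upd (upd v (i, false) x) (i, true) y).
have [M M0 vM] := box_ge v.
have [B B0 FB] := cts_bounded (M + 2) cF.
rewrite /tot -[RHS](@rint_prod _ _ _ _ _ B h).
- rewrite [LHS]Rintegral_mkcond [RHS]Rintegral_mkcond.
  apply: eq_Rintegral => -[x y] _; rewrite /patch.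
  case: ifPn; rewrite ?inE/= ?notin_setE => xy; case: ifPn => //; rewrite ?inE ?notin_setE => xy'.
    exfalso; apply: xy'; move: xy; rewrite /disc/= => xy; split; rewrite /= in_itv/=.
      by apply/andP; split; nra.
    by apply/andP; split; nra.
  by rewrite /h F0.
- apply: (@measurable_caratheodory R _ _ h); last first.
    by move=> x; apply: continuous_measurable_fun; exact: cts_section.
  move=> y; rewrite (_ : (fun x => h x y) = fun x => F (upd (upd v (i, true) y) (i, false) x)).
    exact: cts_section.
  by apply/funext => x; rewrite /h updC.
- move=> x y x2 y2; apply: FB; apply: box_upd; first apply: box_upd.
  + by apply: boxW vM; rewrite lerDl.
  + by rewrite ler_norml; move: x2; lra.
  + by rewrite ler_norml; move: y2; lra.
Qed.

(** The coefficient functions are controlled inside the discs only. They are replaced there with a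
    function g that is continuous on the whole space and zero off the discs. *)
Lemma disc_integral_tots s (g : (C -> R) -> R) (f : point -> R) v : uniq s -> cts g ->
  (forall u i, i \in s -> ~ disc (pt u i) -> g u = 0) ->
  (forall u, (forall c, c \notin coords s -> u c = v c) ->
     (forall i, i \in s -> disc (pt u i)) -> f (pt u) = g u) ->
  disc_integral s f (pt v) = tots (coords s) g v.
Proof.
elim: s v => [|i s IH] v; first by move=> _ _ _ fg; exact: fg.
move=> /= /andP[si us] cg g0 fg.
have uv q u : (forall c, c \notin coords s ->
    u c = upd (upd v (i, false) q.1) (i, true) q.2 c) -> pt u i = q.
  move=> uq; rewrite /pt !uq ?mem_coords// updf updt; by case: q {uq}.
rewrite -disc_tot; last 2 first.
- exact: cts_tots.
- move=> x y xy; rewrite (@tots_ext _ _ (fun=> 0)) ?tots0// => u uxy.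
  by apply: (g0 _ i); [rewrite inE eqxx|rewrite (uv (x, y))].
apply: eq_Rintegral => q; rewrite inE => qd; rewrite -pt_upd IH//.
  by move=> u j js; apply: g0; rewrite inE js orbT.
move=> u uq ud; apply: fg => [c|j].
  rewrite !inE !negb_or => /and3P[cf ct cs].
  by rewrite uq// !dfwithout// eq_sym.
by rewrite inE => /predU1P[->|/ud//]; rewrite (uv q).
Qed.

Lemma disc_integral_Int (g : (C -> R) -> R) (f : point -> R) : cts g ->
  (forall u i, ~ disc (pt u i) -> g u = 0) ->
  (forall u, (forall i, disc (pt u i)) -> f (pt u) = g u) ->
  disc_integral (enum Lam) f (fun=> (0, 0)) = Int g.
Proof.
move=> cg g0 fg; rewrite -[fun=> (0, 0)]/(pt (fun=> 0)).
apply: disc_integral_tots => //; first exact: enum_uniq.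
  by move=> u i _; exact: g0.
by move=> u _ ud; apply: fg => i; apply: ud; rewrite mem_enum.
Qed.

Lemma IntD f g : cts f -> cts g -> Int (fun v => f v + g v) = Int f + Int g.
Proof. by move=> cf cg; rewrite /Int totsD. Qed.

Lemma IntZ c f : cts f -> Int (fun v => c * f v) = c * Int f.
Proof. by move=> cf; rewrite /Int totsZ. Qed.

Lemma Int_sum (I : Type) (r : seq I) (P : pred I) (F : I -> (C -> R) -> R) :
  (forall x, cts (F x)) ->
  Int (fun v => \sum_(x <- r | P x) F x v) = \sum_(x <- r | P x) Int (F x).
Proof. by move=> cF; rewrite /Int tots_sum. Qed.

Lemma Int_derive c f f' : cts f' ->
  (forall v t, drv (fun t => f (upd v c t)) t (f' (upd v c t))) ->
  (forall v, f (upd v c 2) = f (upd v c (-2))) -> Int f' = 0.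
Proof.
move=> cf' ff' f2; rewrite /Int (@tots_tot0 _ _ c)//; last exact: (tot_derive0 cf' ff').
by case: c {ff' f2} => i b; rewrite mem_coords mem_enum.
Qed.

Variable beta : Lam -> Lam -> R.

Definition S0 (v : C -> R) : R :=
  2^-1 * \sum_i \sum_j beta i j * (v (i, false) * v (j, false) + v (i, true) * v (j, true)).

Definition weight (v : C -> R) : R := expR (S0 v).

Lemma cts_S0 : cts S0.
Proof.
apply: ctsZ; apply: cts_sum => i; apply: cts_sum => j; apply: ctsZ.
by apply: ctsD; apply: ctsM; exact: cts_proj.
Qed.

Lemma cts_weight : cts weight.
Proof. by apply: cts_comp1; [exact: cts1_expR|exact: cts_S0]. Qed.

Hypothesis beta_sym : forall i j, beta i j = beta j i.

Lemma S0_derive v m b t : drv (fun t => S0 (upd v (m, b) t)) t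
  (\sum_j beta m j * upd v (m, b) t (j, b)).
Proof.
have D c x : drv (fun t => upd v (m, b) t c) x ((m, b) == c)%:R.
  case: (eqVneq (m, b) c) => [<-|mc].
    by rewrite (_ : (fun t => _) = id); [exact: drv_id|apply/funext => y; rewrite dfwithin].
  rewrite (_ : (fun t => _) = fun=> v c); first exact: drv_cst.
  by apply/funext => y; rewrite dfwithout.
set u := upd v (m, b) t.
have H : drv (fun t => S0 (upd v (m, b) t)) t (2^-1 * \sum_i \sum_j beta i j *
    ((((m, b) == (i, false))%:R * u (j, false) + u (i, false) * ((m, b) == (j, false))%:R) +
     (((m, b) == (i, true))%:R * u (j, true) + u (i, true) * ((m, b) == (j, true))%:R))).
  apply: drvZ; apply: drv_sum => i; apply: drv_sum => j; apply: drvZ.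
  by apply: drvD; apply: drvM; exact: D.
apply: drv_eq H _.
have E i j : ((((m, b) == (i, false))%:R * u (j, false) + u (i, false) * ((m, b) == (j, false))%:R) +
     (((m, b) == (i, true))%:R * u (j, true) + u (i, true) * ((m, b) == (j, true))%:R)) =
     (m == i)%:R * u (j, b) + u (i, b) * (m == j)%:R.
  by rewrite !xpair_eqE; case: b {D} @u => u; rewrite /= ?andbT ?andbF !mul0r !mulr0 ?addr0 ?add0r.
under eq_bigr do under eq_bigr do rewrite E mulrDr.
under eq_bigr do rewrite big_split/=.
rewrite big_split/= (bigD1 m)//= [X in (_ + X) + _]big1 ?addr0; last first.
  by move=> i im; rewrite big1// => j _; rewrite eq_sym (negPf im) mul0r mulr0.
have -> : \sum_i \sum_j beta i j * (u (i, b) * (m == j)%:R) = \sum_i beta m i * u (i, b).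
  apply: eq_bigr => i _; rewrite (bigD1 m)//= big1 ?addr0.
    by rewrite eqxx mulr1 beta_sym.
  by move=> j jm; rewrite eq_sym (negPf jm) !mulr0.
under eq_bigr do rewrite eqxx mul1r.
lra.
Qed.

(** The total integral of the derivative in the coordinate (m, b) of v (a, b) times the weight times
    the primitive of k. The right-hand side comes from this primitive, since s_m = 1 - x_m^2 - y_m^2
    has derivative - 2 x_m in x_m, and likewise in y_m. *)
Lemma Int_by_parts k a m b : test_fun k ->
  (a == m)%:R * Int (fun v => weight v * prim m k (sq v)) +
  \sum_j beta m j * Int (fun v => v (a, b) * v (j, b) * (weight v * prim m k (sq v))) =
  2 * Int (fun v => v (a, b) * v (m, b) * (weight v * k (sq v))).
Proof.
move=> tk; have [ck [e e0 ke]] := tk.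
have tp := test_prim m tk; have [cp [e' e'0 pe]] := tp.
have cw : cts weight := cts_weight.
have cps : cts (fun v => prim m k (sq v)) by exact: cts_sqc.
have cks : cts (fun v => k (sq v)) by exact: cts_sqc.
have cxx i j : cts (fun v : C -> R => v (i, b) * v (j, b)).
  by apply: ctsM; exact: cts_proj.
have c1 : cts (fun v => weight v * prim m k (sq v)) by exact: ctsM.
have c2 i j : cts (fun v => v (i, b) * v (j, b) * (weight v * prim m k (sq v))).
  exact: ctsM.
have c3 i j : cts (fun v => v (i, b) * v (j, b) * (weight v * k (sq v))).
  by apply: ctsM => //; exact: ctsM.
under eq_bigr do rewrite -IntZ//.
rewrite -!IntZ// -Int_sum; last by move=> j; exact: ctsZ.
rewrite -IntD; [|exact: ctsZ|by apply: cts_sum => j; exact: ctsZ].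
apply/eqP; rewrite -subr_eq0; apply/eqP.
rewrite -[- Int _]mulN1r -IntZ; last exact: ctsZ.
rewrite -IntD; last 2 first.
- by apply: ctsD; [exact: ctsZ|apply: cts_sum => j; exact: ctsZ].
- by apply: ctsZ; exact: ctsZ.
apply: (@Int_derive (m, b) (fun v => v (a, b) * (weight v * prim m k (sq v)))).
- apply: ctsD; last by apply: ctsZ; exact: ctsZ.
  by apply: ctsD; [exact: ctsZ|apply: cts_sum => j; exact: ctsZ].
- move=> v t; set u := upd v (m, b) t.
  have H : drv (fun t => upd v (m, b) t (a, b) *
      (weight (upd v (m, b) t) * prim m k (sq (upd v (m, b) t)))) t
      ((a == m)%:R * (weight u * prim m k (sq u)) + u (a, b) *
       ((weight u * \sum_j beta m j * u (j, b)) * prim m k (sq u) +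
        weight u * (k (sq u) * (- (2 * t))))).
    apply: drvM; last apply: drvM.
    + case: (eqVneq a m) => [->|am].
        by rewrite (_ : (fun t => _) = id); [exact: drv_id|apply/funext => y; rewrite dfwithin].
      rewrite (_ : (fun t => _) = fun=> v (a, b)); first exact: drv_cst.
      by apply/funext => y; rewrite dfwithout// xpair_eqE eq_sym (negPf am).
    + apply: (drv_comp (f := expR)); first exact: is_derive_expR.
      exact: S0_derive.
    + rewrite (_ : (fun t => _) = fun t => prim m k (upd (sq v) m
          (1 - t ^+ 2 - v (m, ~~ b) ^+ 2))); last by apply/funext => y; rewrite sq_upd.
      rewrite sq_upd; apply: (drv_comp (f := fun x => prim m k (upd (sq v) m x))).
        exact: prim_derive.
      rewrite (_ : (fun t => _) = fun t => - (t * t) + (1 - v (m, ~~ b) ^+ 2)); last first.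
        by apply/funext => y; ring.
      apply: drv_eq; first apply: drvD (drv_cst _ _); first apply: drvN; first apply: drvM; try exact: drv_id.
      by rewrite /=; ring.
  apply: drv_eq H _; rewrite /= -/u.
  have -> : u (m, b) = t by rewrite /u dfwithin.
  under [in RHS]eq_bigr do rewrite mulrA.
  rewrite -mulr_suml.
  have -> : \sum_j beta m j * (u (a, b) * u (j, b)) = u (a, b) * \sum_j beta m j * u (j, b).
    by rewrite big_distrr/=; apply: eq_bigr => j _; ring.
  by ring.
(* At both ends s_m is negative, where the primitive vanishes. *)
- move=> v; have H x : x ^+ 2 = 4 -> upd v (m, b) x (a, b) * (weight (upd v (m, b) x) *
      prim m k (sq (upd v (m, b) x))) = 0.
    move=> x2; rewrite pe ?mulr0//; exists m; rewrite sq_upd dfwithin x2.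
    by have := sqr_ge0 (v (m, ~~ b)); lra.
  by rewrite !H//; ring.
Qed.

End DiscIntegral.

(** * Radial functions on the disc *)

Section PolarCoordinates.
Variable R : realType.
Implicit Types (f h : R -> R) (a b c x y : R).

Lemma rint_scale c a b f : continuous f -> 0 <= c -> a <= b ->
  rint a b (fun u => c * f (c * u)) = rint (c * a) (c * b) f.
Proof.
move=> cf c0 ab; have cab : c * a <= c * b by exact: ler_wpM2l.
have cl : continuous (fun u : R => c * u : R).
  by apply: drv_continuous => u; exists (c * 1); apply: drvZ; exact: drv_id.
have cfl : continuous (fun u : R => c * f (c * u)).
  move=> u; apply: cvgM; first exact: cvg_cst.
  exact: (cvg_comp _ _ (cl u) (cf _)).
pose m := c * a - 1.
have H (t : R) : a <= t <= b -> drv (fun u => rint m (c * u) f) t (c * f (c * t)).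
  move=> /andP[a_t tb]; apply: (@drv_eq _ _ _ (f (c * t) * (c * 1))); last by ring.
  apply: (drv_comp (f := fun x => rint m x f)); last by apply: drvZ; exact: drv_id.
  by apply: rint_derive => //; have := ler_wpM2l c0 a_t; rewrite /m; lra.
rewrite (rint_FTC ab cfl H) (@rint_split _ m (c * a) (c * b))//; last by rewrite /m; lra.
by rewrite addrAC subrr add0r.
Qed.

Lemma rint_opp a b f : continuous f -> a <= b ->
  rint a b (fun u => f (- u)) = rint (- b) (- a) f.
Proof.
move=> cf ab.
have cfl : continuous (fun u : R => f (- u)).
  by move=> u; exact: (cvg_comp _ _ (cvgN cvg_id) (cf _)).
pose m := - b - 1.
have H (t : R) : a <= t <= b -> drv (fun u => - rint m (- u) f) t (f (- t)).
  move=> /andP[a_t tb]; apply: (@drv_eq _ _ _ (- (f (- t) * (- 1)))); last by ring.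
  apply: drvN; apply: (drv_comp (f := fun x => rint m x f)).
    by apply: rint_derive => //; rewrite /m; lra.
  by apply: drvN; exact: drv_id.
rewrite (rint_FTC ab cfl H) (@rint_split _ m (- b) (- a))//; last 2 first.
- by rewrite /m; lra.
- by rewrite lerN2.
by rewrite opprK addrC addrAC subrr add0r.
Qed.

Lemma rint_even f c : continuous f -> 0 <= c -> (forall x, f (- x) = f x) ->
  rint (- c) c f = 2 * rint 0 c f.
Proof.
move=> cf c0 fe; rewrite (@rint_split _ (- c) 0 c)//; last by rewrite oppr_le0.
have -> : rint (- c) 0 f = rint 0 c f; last by ring.
rewrite -[X in rint _ X]oppr0 -rint_opp//.
by apply: eq_rint => t _; rewrite fe.
Qed.

(* On the square [0, c]^2, a symmetric function is integrated over the triangle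
   [y <= x] and its mirror image. *)
Lemma rint_triangle (h : R -> R -> R) c M : 0 <= c ->
  measurable_fun [set: R * R] (fun q : R * R => h q.1 q.2) ->
  (forall x, continuous (h x : R -> R)) ->
  (forall x y, 0 <= x <= c -> 0 <= y <= c -> `|h x y| <= M) ->
  (forall x y, h x y = h y x) ->
  rint 0 c (fun x => rint 0 c (h x)) = 2 * rint 0 c (fun x => rint 0 x (h x)).
Proof.
move=> c0 mh ch hM hs.
pose h1 x y := if y <= x then h x y else 0; pose h2 x y := if x < y then h x y else 0.
have m1 : measurable_fun [set: R * R] (fun q : R * R => h1 q.1 q.2).
  apply: measurable_fun_if => //.
  - exact: measurable_fun_ler.
  - exact: measurable_funS mh.
have m2 : measurable_fun [set: R * R] (fun q : R * R => h2 q.1 q.2).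
  apply: measurable_fun_if => //.
  - exact: measurable_fun_ltr.
  - exact: measurable_funS mh.
have M0 : 0 <= M by apply: le_trans (hM 0 0 _ _); rewrite ?lexx ?c0.
have hM1 x y : 0 <= x <= c -> 0 <= y <= c -> `|h1 x y| <= M.
  by rewrite /h1; case: ifP => _; [exact: hM|rewrite normr0].
have hM2 x y : 0 <= x <= c -> 0 <= y <= c -> `|h2 x y| <= M.
  by rewrite /h2; case: ifP => _; [exact: hM|rewrite normr0].
rewrite -(rint_prod mh hM).
have -> : (fun q : R * R => h q.1 q.2) = (fun q : R * R => h1 q.1 q.2 + h2 q.1 q.2).
  by apply/funext => -[x y] /=; rewrite /h1 /h2; case: ltP => _; rewrite ?addr0 ?add0r.
rewrite RintegralD; [|by apply: measurableX|exact: (rectangle_integrable m1 hM1)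
  |exact: (rectangle_integrable m2 hM2)].
rewrite (rint_prod m1 hM1) (rint_prod m2 hM2) (rint_swap m2 hM2).
have -> : rint 0 c (fun x => rint 0 c (h1 x)) = rint 0 c (fun x => rint 0 x (h x)).
  apply: eq_rint => x /andP[x0 xc]; rewrite /rint.
  rewrite [LHS]Rintegral_mkcond [RHS]Rintegral_mkcond; apply: eq_Rintegral => y _.
  rewrite /patch /h1 !mem_setE !in_itv/=; case: (leP y x) => yx; rewrite ?andbT ?andbF ?if_same//.
  by rewrite (le_trans yx xc) andbT.
have -> : rint 0 c (fun y => rint 0 c (h2^~ y)) = rint 0 c (fun x => rint 0 x (h x)).
  apply: eq_rint => x /andP[x0 xc]; rewrite /rint -[RHS]Rintegral_itv_bndo_bndc; last first.
    apply: (@integrableS _ _ _ lebesgue_measure `[0, x] `[0, x[) => //; first exact: subset_itv_co_cc.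
    exact: continuous_integrable.
  rewrite [LHS]Rintegral_mkcond [RHS]Rintegral_mkcond; apply: eq_Rintegral => y _.
  rewrite /patch /h2 !mem_setE !in_itv/= [h y x]hs.
  case: (ltP y x) => yx; rewrite ?andbT ?andbF ?if_same//.
  by rewrite (le_trans (ltW yx) xc) andbT.
by ring.
Qed.

Lemma rint_invD_sqr : rint 0 1 (fun u : R => (1 + u ^+ 2)^-1) = pi / 4.
Proof.
have c1 : continuous (fun u : R => (1 + u ^+ 2)^-1).
  move=> u; apply: cvgV; first by rewrite gt_eqF// ltr_pwDl ?sqr_ge0.
  apply: cvgD; first exact: cvg_cst.
  exact: exprn_continuous.
rewrite (rint_FTC ler01 c1 (F := atan)).
by rewrite atan1 atan0 subr0.
Qed.

Lemma cts_rint (J : finType) (f : (J -> R) -> R) i a b : cts f -> -2 <= a -> a <= b ->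
  cts (fun v => rint a b (fun t => f (@dfwith _ (fun=> R) v i t))).
Proof.
move=> cf a2 ab.
rewrite (_ : (fun v => _) = fun v => prim i f (@dfwith _ (fun=> R) v i b) -
    prim i f (@dfwith _ (fun=> R) v i a)).
  by apply: ctsB; apply: cts_upd; first [exact: cts_prim|exact: cts_cst].
apply/funext => v; rewrite !prim_upd (rint_split (@cts_section _ _ f v i cf) a2 ab).
by rewrite addrAC subrr add0r.
Qed.

(* In the octant [0 <= y <= x], the substitution [y = x u] replaces polar
   coordinates: the angular integral becomes [\int_0^1 du / (1 + u^2)]. *)
Lemma rint_disc (k : R -> R) B e : cts1 k -> 0 < e -> (forall s, s <= e -> k s = 0) ->
  (forall s, s <= 1 -> `|k s| <= B) ->
  rint (-2) 2 (fun x => rint (-2) 2 (fun y => k (1 - x ^+ 2 - y ^+ 2))) =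
  pi * rint (-2) 1 k.
Proof.
move=> ck e0 k0 kB; pose h x y := k (1 - x ^+ 2 - y ^+ 2); pose K s := rint (-2) s k.
pose f (v : bool -> R) := k (1 - v false ^+ 2 - v true ^+ 2).
have cX c (i : bool) : cts (fun v : bool -> R => c - v i ^+ 2).
  by apply: ctsB; [exact: cts_cst|apply: ctsM; exact: cts_proj].
have cf : cts f.
  apply: cts_comp1 => //; apply: ctsB; last by apply: ctsM; exact: cts_proj.
  by apply: ctsB; [exact: cts_cst|apply: ctsM; exact: cts_proj].
pose v2 x y : bool -> R := fun i => if i then y else x.
have v2x x y t : @dfwith _ (fun=> R) (v2 x y) true t = v2 x t.
  by apply/funext => -[]; [rewrite dfwithin|rewrite dfwithout].
have v2y x y t : @dfwith _ (fun=> R) (v2 x y) false t = v2 t y.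
  by apply/funext => -[]; [rewrite dfwithout|rewrite dfwithin].
have chy x : continuous (h x : R -> R).
  rewrite (_ : h x = fun t => f (@dfwith _ (fun=> R) (v2 x 0) true t)).
    exact: cts_section.
  by apply/funext => t; rewrite v2x.
have hs x y : h x y = h y x by rewrite /h addrAC.
have chx y : continuous (fun x => h x y : R).
  rewrite (_ : (fun x => h x y) = h y); first exact: chy.
  by apply/funext => z; exact: hs.
have mh : measurable_fun [set: R * R] (fun q : R * R => h q.1 q.2).
  by apply: measurable_caratheodory => // x; apply: continuous_measurable_fun.
have cA a b : -2 <= a -> a <= b -> continuous (fun x => rint a b (h x) : R).
  move=> a2 ab; rewrite (_ : (fun x => _) = fun x =>
    (fun v => rint a b (fun t => f (@dfwith _ (fun=> R) v true t)))
       (@dfwith _ (fun=> R) (v2 0 0) false x)).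
    by apply: (cts_section (f := fun v => rint a b (fun t => f (@dfwith _ (fun=> R) v true t))));
      exact: cts_rint.
  by apply/funext => x; apply: eq_rint => t _; rewrite v2y v2x.
have hB x y : `|h x y| <= B.
  by apply: kB; have := sqr_ge0 x; have := sqr_ge0 y; lra.
have kc : continuous k.
  have c1 : cts (fun v : unit -> R => k (v tt)) by apply: cts_comp1 => //; exact: cts_proj.
  rewrite (_ : k = fun t => k (@dfwith _ (fun=> R) (fun=> 0) tt t tt)).
    exact: (@cts_section _ _ _ (fun=> 0) tt c1).
  by apply/funext => t; rewrite dfwithin.
have dK s : drv K s (k s).
  have tk : test_fun (fun v : unit -> R => k (v tt)).
    split; first by apply: cts_comp1 => //; exact: cts_proj.
    by exists e => // v [[] ve]; exact: k0.
  have := prim_derive tt (fun=> 0) s tk; rewrite dfwithin.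
  rewrite (_ : (fun t => prim _ _ _) = K)//; apply/funext => t.
  by rewrite prim_upd; apply: eq_rint => x _; rewrite dfwithin.
rewrite (@eq_rint _ _ _ _ (fun x => 2 * rint 0 2 (h x))); last first.
  move=> x _; apply: (rint_even (chy x)); [lra|by move=> y; rewrite /h sqrrN].
rewrite rintZ; last by apply: cA; lra.
rewrite rint_even//; last 2 first.
- by apply: cA; lra.
- by move=> x; apply: eq_rint => y _; rewrite /h sqrrN.
rewrite (@rint_triangle h _ B)//.
pose H x u := x * k (1 - x ^+ 2 - (x * u) ^+ 2).
rewrite (@eq_rint _ _ _ _ (fun x => rint 0 1 (H x))); last first.
  by move=> x /andP[x0 _]; rewrite (rint_scale (chy x))// mulr0 mulr1.
have cH : cts (fun v : bool -> R => H (v false) (v true)).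
  apply: ctsM; first exact: cts_proj.
  apply: cts_comp1 => //; apply: ctsB => //.
  by apply: ctsM; apply: ctsM; exact: cts_proj.
have cHx x : continuous (H x : R -> R).
  rewrite (_ : H x = fun t => (fun v : bool -> R => H (v false) (v true))
      (@dfwith _ (fun=> R) (v2 x 0) true t)).
    exact: (@cts_section _ _ _ _ true cH).
  by apply/funext => t; rewrite v2x.
have cHu u : continuous (fun x => H x u : R).
  rewrite (_ : (fun x => H x u) = fun t => (fun v : bool -> R => H (v false) (v true))
      (@dfwith _ (fun=> R) (v2 0 u) false t)).
    exact: (@cts_section _ _ _ _ false cH).
  by apply/funext => t; rewrite v2y.
rewrite (@rint_swap _ _ _ _ _ (2 * B)); last 2 first.
- by apply: measurable_caratheodory => // x; apply: continuous_measurable_fun.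
- move=> x y /andP[x0 x2] _; rewrite normrM ger0_norm//; apply: ler_pM => //.
  by apply: kB; have := sqr_ge0 x; have := sqr_ge0 (x * y); lra.
(* In x, the integrand has the primitive - K (1 - x^2 (1 + u^2)) / (2 (1 + u^2)). At x = 2 the
   argument of K lies below -2, and K vanishes. *)
rewrite (@eq_rint _ _ _ _ (fun u => K 1 / 2 * (1 + u ^+ 2)^-1)); last first.
  move=> u _; have u1 : 0 < 1 + u ^+ 2 by rewrite ltr_pwDl ?sqr_ge0.
  have HF (t : R) : 0 <= t <= 2 -> drv (fun x => - (2 * (1 + u ^+ 2))^-1 *
      K (1 - x ^+ 2 - (x * u) ^+ 2)) t (H t u).
    move=> _; apply: (@drv_eq _ _ _ (- (2 * (1 + u ^+ 2))^-1 *
      (k (1 - t ^+ 2 - (t * u) ^+ 2) * (- (2 * t) - 2 * t * u ^+ 2)))).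
      apply: drvZ; apply: (drv_comp (f := K)) => //.
      rewrite (_ : (fun x => _) = fun x => - (1 + u ^+ 2) * (x * x) + 1); last first.
        by apply/funext => x; ring.
      apply: drv_eq; first apply: drvD (drv_cst _ _); first apply: drvZ;
        first apply: drvM; try exact: drv_id.
      by rewrite /=; ring.
    by rewrite /H; field; rewrite gt_eqF.
  rewrite (rint_FTC _ (cHu u) HF); last by lra.
  rewrite /K rint_gt; last by have := sqr_ge0 (2 * u); lra.
  rewrite expr0n /= mul0r expr0n/= !subr0; field; by rewrite gt_eqF.
rewrite rintZ; last first.
  move=> u; apply: cvgV; first by rewrite gt_eqF// ltr_pwDl ?sqr_ge0.
  by apply: cvgD; [exact: cvg_cst|exact: exprn_continuous].
by rewrite rint_invD_sqr /K; field.
Qed.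

End PolarCoordinates.

(** * The bosonic integral without interaction *)

Section FreeCase.
Variables (R : realType) (Lam : finType).
Local Notation C := (Lam * bool)%type.
Local Notation upd v i t := (@dfwith _ (fun=> R) v i t).
Implicit Types (v : C -> R) (w : Lam -> R) (s : seq Lam) (k : (Lam -> R) -> R).

Let pin s w : Lam -> R := fun j => if j \in s then 1 else w j.

Lemma cts1_section k w i : cts k -> cts1 (fun t => k (upd w i t)).
Proof.
move=> ck M e e0; have [N N0 wN] := box_ge w.
have [d d0 kd] := ck (Num.max M N) e e0; exists d => // x y xM yM xyd; apply: kd.
- by apply: box_upd; [apply: boxW wN; rewrite le_max lexx orbT|rewrite le_max xM].
- by apply: box_upd; [apply: boxW wN; rewrite le_max lexx orbT|rewrite le_max yM].
- move=> j; case: (eqVneq i j) => [<-|ij]; first by rewrite !dfwithin.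
  by rewrite !dfwithout// subrr normr0 ltW.
Qed.

(** By [rint_disc], each pair (x_i, y_i) with i in s contributes a factor pi and the primitive of k
    up to s_i = 1; [pin] records these values 1. *)
Lemma tots_sq s k v : uniq s -> test_fun k ->
  tots (coords s) (fun u => k (sq u)) v = pi ^+ size s * prims s k (pin s (sq v)).
Proof.
move=> + tk; elim: s v => [|i s IH] v /=.
  by rewrite expr0 mul1r => _; congr k; apply/funext => j; rewrite /pin in_nil.
move=> /andP[si us]; have [ck [e e0 ke]] := test_prims s tk.
pose w := pin s (sq v).
have E x y : tots (coords s) (fun u => k (sq u)) (upd (upd v (i, false) x) (i, true) y) =
    pi ^+ size s * prims s k (upd w i (1 - x ^+ 2 - y ^+ 2)).
  rewrite IH//; congr (_ * prims s k _); apply/funext => j; rewrite /w /pin.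
  rewrite sq_upd sq_upd upd_upd /= dfwithin.
  case: (eqVneq i j) => [<-|ij].
    by rewrite (negPf si) !dfwithin; ring.
  by rewrite !dfwithout.
have [B B0 kB] := cts_bounded (1 + \sum_j `|w j|) ck.
rewrite /tot (@eq_rint _ _ _ _ (fun x => rint (-2) 2 (fun y =>
    pi ^+ size s * prims s k (upd w i (1 - x ^+ 2 - y ^+ 2))))); last first.
  by move=> x _; apply: eq_rint => y _; exact: E.
rewrite (@rint_disc _ (fun t => pi ^+ size s * prims s k (upd w i t)) (pi ^+ size s * B) e)//.
- rewrite rintZ; last exact: cts_section.
  rewrite exprS -mulrA; congr (_ * (_ * _)); rewrite -prim_upd.
  congr (prim i _ _); apply/funext => j; rewrite /w /pin inE.
  case: (eqVneq j i) => [->|ji]; first by rewrite dfwithin.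
  by rewrite dfwithout 1?eq_sym.
- move=> M e' e'0; have pi0 : 0 < pi ^+ size s :> R by rewrite exprn_gt0// pi_gt0.
  have [d d0 kd] := cts1_section w i ck M (divr_gt0 e'0 pi0).
  exists d => // x y xM yM xy; rewrite -mulrBr normrM gtr0_norm// mulrC.
  by rewrite -ler_pdivlMr//; exact: kd.
- by move=> t te; rewrite ke ?mulr0//; exists i; rewrite dfwithin.
- move=> t t1; rewrite normrM ger0_norm ?exprn_ge0 ?pi_ge0//; apply: ler_wpM2l.
    by rewrite exprn_ge0 ?pi_ge0.
  have [te|et] := leP t e; first by rewrite ke ?normr0//; exists i; rewrite dfwithin.
  apply: kB; apply: box_upd.
    by move=> j; rewrite (bigD1 j)//= addrCA lerDl addr_ge0// sumr_ge0.
  rewrite ger0_norm; last by rewrite ltW// (lt_trans e0).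
  by apply: le_trans t1 _; rewrite lerDl sumr_ge0.
Qed.

Lemma Int_sq k : test_fun k ->
  Int (fun v => k (sq v)) = pi ^+ #|Lam| * prims (enum Lam) k (fun=> 1).
Proof.
move=> tk; rewrite /Int tots_sq ?enum_uniq// -cardE.
by congr (_ * prims _ _ _); apply/funext => j; rewrite /pin mem_enum.
Qed.

End FreeCase.

(** * The Ward identity and localization *)

Section Ward.
Variables (R : realType) (Lam : finType).
Local Notation C := (Lam * bool)%type.
Implicit Types (u v : C -> R) (i j m a l : Lam) (b : bool) (k : (Lam -> R) -> R).
Implicit Types (A : {set Lam}) (beta : Lam -> Lam -> R).

(* With K the iterated primitive of k in all variables, this is the derivative
   of K in the variables of A. *)
Definition Kset k A : (Lam -> R) -> R := prims (enum (finset.setC A)) k.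

Definition Yint beta k A : R := Int (fun v => weight beta v * Kset k A (sq v)).

Definition Xint beta k b a j A : R :=
  Int (fun v => v (a, b) * v (j, b) * (weight beta v * Kset k A (sq v))).

Lemma test_Kset k A : test_fun k -> test_fun (Kset k A).
Proof. exact: test_prims. Qed.

Lemma KsetD1 k A m : test_fun k -> m \notin A ->
  prim m (Kset k (m |: A)) = Kset k A.
Proof.
move=> [ck _] mA; rewrite /Kset -[prim m _]/(prims (m :: enum (finset.setC (m |: A))) k).
apply: perm_prims => //; apply: uniq_perm; rewrite /= ?enum_uniq ?andbT//.
  by rewrite mem_enum finset.in_setC finset.setU11.
by move=> j; rewrite inE !mem_enum !finset.in_setC !finset.in_setU1 negb_or;
  case: (eqVneq j m) => [->|].
Qed.

Lemma Kset_prim k A i : test_fun k -> Kset (prim i k) A = prim i (Kset k A).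
Proof.
move=> [ck _]; rewrite /Kset.
elim: (enum _) => //= j s IH; rewrite IH primC//; exact: cts_prims.
Qed.

Section Fixed.
Variable beta : Lam -> Lam -> R.
Hypothesis beta_sym : forall i j, beta i j = beta j i.

(** As m is not in A, [Kset k A] is the primitive in the variable m of [Kset k (m |: A)]. *)
Lemma Xint_by_parts k b a m A : test_fun k -> m \notin A ->
  (a == m)%:R * Yint beta k A + \sum_j beta m j * Xint beta k b a j A =
  2 * Xint beta k b a m (m |: A).
Proof.
move=> tk mA; have := Int_by_parts beta_sym a m b (test_Kset (m |: A) tk).
by rewrite KsetD1.
Qed.

(* Since [x d_eta]- and [xi d_x]-variations cancel, the bosonic correlation of
   [x_i] and [x_j] is the fermionic one of [xi_i] and [eta_j]. *)
Lemma susy k b i j : test_fun k ->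
  \sum_(A : {set Lam}) 2 ^+ #|A| * (coefc beta A * Xint beta k b i j A) =
  \sum_(A : {set Lam}) 2 ^+ #|A| * (coefd beta i j A * Yint beta k A).
Proof.
move=> tk.
(* The sum over l with a Kronecker delta prepares for the cofactor expansion. *)
transitivity (\sum_(A : {set Lam}) \sum_l 2 ^+ #|A| * (((l == j)%:R * coefc beta A) * Xint beta k b i l A)).
  apply: eq_bigr => A _; rewrite -mulr_sumr (bigD1 j)//= eqxx mul1r big1 ?addr0//.
  by move=> l lj; rewrite (negPf lj) !mul0r.
under eq_bigr do under eq_bigr do rewrite coef_expand mulrBl mulrBr.
under eq_bigr do rewrite big_split/=.
rewrite big_split/=.
have -> : \sum_(A : {set Lam}) \sum_l 2 ^+ #|A| * ((l \in A)%:R * coefd beta l j (A :\ l) * Xint beta k b i l A) =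
  \sum_l \sum_(A : {set Lam}) 2 ^+ #|A| * (coefd beta l j A * (2 * Xint beta k b i l (l |: A))).
  rewrite exchange_big/=; apply: eq_bigr => l _.
  rewrite (bigID (fun A : {set Lam} => l \in A))/= [X in _ + X]big1 ?addr0; last first.
    by move=> A /negPf ->; rewrite !mul0r mulr0.
  rewrite [RHS](bigID (fun A : {set Lam} => l \in A))/= [X in X + _]big1 ?add0r; last first.
    by move=> A lA; rewrite coefd0// mul0r mulr0.
  (* Removing l from A turns the weight 2 ^ #|A| into twice the new weight: this is the factor 2 of
     the integration by parts. *)
  rewrite (reindex_onto (fun A => l |: A) (fun A => A :\ l))/=; last first.
    by move=> A lA; rewrite finset.setD1K.
  apply: eq_big => [A|A lA].
    rewrite finset.setU11/=; apply/eqP/idP => [<-|lA]; first by rewrite !inE eqxx.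
    by rewrite finset.setU1K.
  have lA' : l \notin A.
    by case/andP: lA => _ /eqP <-; rewrite !inE eqxx.
  rewrite finset.setU11 mul1r finset.setU1K// finset.cardsU1 lA' add1n exprS; ring.
have -> : \sum_l \sum_(A : {set Lam}) 2 ^+ #|A| * (coefd beta l j A * (2 * Xint beta k b i l (l |: A))) =
  \sum_l \sum_(A : {set Lam}) 2 ^+ #|A| * (coefd beta l j A *
    ((i == l)%:R * Yint beta k A + \sum_m beta l m * Xint beta k b i m A)).
  apply: eq_bigr => l _; apply: eq_bigr => A _.
  (* The sets containing l have coefficient zero, and integration by parts applies to all others. *)
  case: (boolP (l \in A)) => lA; first by rewrite coefd0// !mul0r.
  by rewrite -Xint_by_parts.
rewrite exchange_big/= -big_split/=; apply: eq_bigr => A _.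
under eq_bigr do rewrite mulrDr mulrDr.
rewrite big_split/= (bigD1 i)//= eqxx mul1r [X in _ + X + _ + _]big1 ?addr0; last first.
  by move=> l li; rewrite eq_sym (negPf li) mul0r !mulr0.
rewrite -addrA -[RHS]addr0; congr (_ + _).
(* Two double sums remain, one from the cofactor expansion and one from the integration by parts;
   they agree after an exchange. *)
rewrite sumrN; apply/eqP; rewrite subr_eq0; apply/eqP.
rewrite -!mulr_sumr; congr (_ * _).
under eq_bigr do rewrite mulr_sumr.
under [in RHS]eq_bigr do rewrite mulr_suml.
rewrite exchange_big/=; apply: eq_bigr => l _; apply: eq_bigr => m _; ring.
Qed.

(* The superexpectations of K (z^2) and x_a x_j K (z^2): the terms with om_set A
   come from the Taylor expansion of K at s + 2 xi eta. *)
Definition mean k : R :=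
  (2 * pi) ^- #|Lam| * \sum_(A : {set Lam}) 2 ^+ #|A| * (coefc beta A * Yint beta k A).

Definition corr a j k : R :=
  (2 * pi) ^- #|Lam| * \sum_(A : {set Lam}) 2 ^+ #|A| * (coefc beta A * Xint beta k false a j A).

(** Integration by parts in x_i for each set A. Here A is kept and k is replaced with its primitive,
    which is possible since [Kset] commutes with primitives. *)
Lemma ward a i k : test_fun k ->
  2 * corr a i k = \sum_j beta i j * corr a j (prim i k) + (a == i)%:R * mean (prim i k).
Proof.
move=> tk; rewrite /corr /mean.
transitivity ((2 * pi) ^- #|Lam| * \sum_(A : {set Lam}) 2 ^+ #|A| * (coefc beta A *
  ((a == i)%:R * Yint beta (prim i k) A + \sum_j beta i j * Xint beta (prim i k) false a j A))).
  rewrite mulrCA mulr_sumr; congr (_ * _); apply: eq_bigr => A _.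
  have := Int_by_parts beta_sym a i false (test_Kset A tk).
  rewrite -Kset_prim// -/(Yint _ _ _) => E.
  by rewrite [in RHS]E /Xint; ring.
have -> : \sum_j beta i j * ((2 * pi) ^- #|Lam| *
     (\sum_(A : {set Lam}) 2 ^+ #|A| * (coefc beta A * Xint beta (prim i k) false a j A))) =
  (2 * pi) ^- #|Lam| * \sum_(A : {set Lam}) 2 ^+ #|A| * (coefc beta A *
     \sum_j beta i j * Xint beta (prim i k) false a j A).
  under eq_bigr do rewrite mulrCA mulr_sumr.
  rewrite -mulr_sumr exchange_big/=; congr (_ * _); apply: eq_bigr => A _.
  by rewrite !mulr_sumr; apply: eq_bigr => j _; ring.
rewrite mulrCA -mulrDr; congr (_ * _); rewrite [X in _ + X]mulr_sumr -big_split/=.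
by apply: eq_bigr => A _; ring.
Qed.

End Fixed.
End Ward.

(** * Independence of the partition function from beta *)

Section Localization.
Variables (R : realType) (Lam : finType).
Local Notation C := (Lam * bool)%type.
Implicit Types (u v : C -> R) (i j m a l : Lam) (b : bool) (k : (Lam -> R) -> R).
Implicit Types (A : {set Lam}).

Lemma expR_quadratic (x : R) : `|x| <= 2^-1 -> `|expR x - 1 - x| <= 2 * x ^+ 2.
Proof.
rewrite ler_norml => /andP[x1 x2]; have e1 := expR_ge1Dx x.
rewrite ger0_norm; last by lra.
have := expR_ge1Dx (- x); rewrite expRN => e2.
have e0 := expR_gt0 x; have h : (1 - x) * expR x <= 1.
  by rewrite -ler_pdivlMr// div1r.
by nra.
Qed.

Lemma drv_quadratic (f : R -> R) (x a B d : R) : 0 < d -> 0 <= B ->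
  (forall h, `|h| <= d -> `|f (x + h) - f x - h * a| <= B * h ^+ 2) -> drv f x a.
Proof.
move=> d0 B0 fB.
have H : (fun h => h^-1 *: ((f \o shift x) (h *: 1) - f x)) @ 0^' --> a.
  apply/cvgrPdist_le => e e0.
  have m0 : 0 < Num.min d (e / (B + 1)) by rewrite lt_min d0 divr_gt0// ltr_wpDl.
  near=> h; have h0 : h != 0 by near: h; exact: nbhs_dnbhs_neq.
  have : `|0 - h| <= Num.min d (e / (B + 1)).
    by near: h; apply: nbhs_dnbhs; exact: near_dist.
  rewrite sub0r normrN le_min => /andP[hd he].
  rewrite /= /GRing.scale/= mulr1 [h + x]addrC.
  have -> : a - h^-1 * (f (x + h) - f x) = - (h^-1 * (f (x + h) - f x - h * a)).
    by field.
  rewrite normrN normrM normfV ler_pdivrMl ?normr_gt0//.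
  apply: le_trans (fB _ hd) _; rewrite -real_normK ?num_real// expr2 mulrA mulrC.
  apply: ler_wpM2l => //; move: he; rewrite ler_pdivlMr ?ltr_wpDl// => he.
  by have := normr_ge0 h; nra.
apply: DeriveDef; first by apply/cvg_ex; exists a.
exact: cvg_lim H.
Unshelve. all: by end_near. Qed.

(** Differentiation under the integral: S and f are bounded on the domain of integration, hence the
    remainder of the exponential is quadratic in h, uniformly. *)
Lemma drv_Int (S f : (C -> R) -> R) t : cts S -> cts f ->
  drv (fun t => Int (fun v => expR (t * S v) * f v)) t
    (Int (fun v => S v * (expR (t * S v) * f v))).
Proof.
move=> cS cf.
have cE r : cts (fun v => expR (r * S v)).
  by apply: cts_comp1; [exact: cts1_expR|exact: ctsZ].
have [B B0 SB] := cts_bounded 2 cS.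
have cEf r : cts (fun v => expR (r * S v) * f v) by exact: ctsM.
have [D D0 fD] := cts_bounded 2 (cEf t).
(* The radius keeps |h S| at most 1 / 2, as [expR_quadratic] requires; 4 is the length of each
   interval of integration. *)
apply: (@drv_quadratic _ _ _ (2 * B ^+ 2 * D * 4 ^+ size (coords (enum Lam))) (2 * (B + 1))^-1).
- by rewrite invr_gt0 mulr_gt0// ltr_wpDl.
- by rewrite !mulr_ge0// exprn_ge0.
move=> h hB; rewrite -IntZ; last exact: ctsM.
rewrite -![- Int _]mulN1r -!IntZ; [|by apply: ctsZ; exact: ctsM|exact: cEf].
rewrite -IntD; [|exact: cEf|exact: ctsZ].
rewrite -IntD; [|by apply: ctsD => //; exact: ctsZ|by apply: ctsZ; apply: ctsZ; exact: ctsM].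
rewrite /Int; apply: le_trans (tots_bound (B := 2 * B ^+ 2 * D * h ^+ 2) _ _ _ _) _.
- by apply: ctsD; [apply: ctsD => //; exact: ctsZ|apply: ctsZ; apply: ctsZ; exact: ctsM].
- by move=> j; rewrite normr0.
- move=> u u2; have Su := SB _ u2.
  have -> : expR ((t + h) * S u) * f u + -1 * (expR (t * S u) * f u) +
      -1 * (h * (S u * (expR (t * S u) * f u))) =
      (expR (h * S u) - 1 - h * S u) * (expR (t * S u) * f u).
    by rewrite mulrDl expRD; ring.
  rewrite normrM.
  have hS : `|h * S u| <= 2^-1.
    rewrite normrM; apply: (@le_trans _ _ ((2 * (B + 1))^-1 * (B + 1))).
      by apply: ler_pM => //; apply: le_trans Su _; rewrite lerDl.
    by rewrite invfM mulfVK// gt_eqF// ltr_wpDl.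
  apply: le_trans (_ : (2 * (h * S u) ^+ 2) * D <= _).
    by apply: ler_pM => //; [exact: expR_quadratic|exact: fD].
  rewrite exprMn.
  have : (S u) ^+ 2 <= B ^+ 2 by rewrite -real_normK ?num_real// ler_pXn2r ?nnegrE.
  have -> : 2 * B ^+ 2 * D * h ^+ 2 = 2 * (h ^+ 2 * B ^+ 2) * D by ring.
  move=> ?; apply: ler_wpM2r => //; apply: ler_wpM2l => //.
  by apply: ler_wpM2l => //; exact: sqr_ge0.
by rewrite le_eqVlt; apply/orP; left; apply/eqP; ring.
Qed.

(** Each factor is affine in t. Its derivative has lost the factor itself, which can be put back
    since the square of xi_i eta_j is zero. *)
Lemma drv_gexp (beta : Lam -> Lam -> R) (r : seq (Lam * Lam))
    (F : grassmann R (Lam + Lam)%type) t :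
  let E t := \prod_(p <- r) (1 - (t * beta p.1 p.2) *: (Defs.xi R p.1 * Defs.eta R p.2)) in
  drv (fun t => berezin (F * E t)) t
   (- \sum_(p <- r) beta p.1 p.2 * berezin (F * (Defs.xi R p.1 * Defs.eta R p.2) * E t)).
Proof.
elim: r F => [|p r IH] F /=.
  rewrite big_nil oppr0 (_ : (fun t => _) = fun=> berezin F); first exact: drv_cst.
  by apply/funext => x; rewrite big_nil mulr1.
set q := Defs.xi R p.1 * Defs.eta R p.2.
pose E t := \prod_(p <- r) (1 - (t * beta p.1 p.2) *: (Defs.xi R p.1 * Defs.eta R p.2)).
have EM x (H : grassmann R (Lam + Lam)%type) :
    berezin (H * \prod_(p <- p :: r) (1 - (x * beta p.1 p.2) *: (Defs.xi R p.1 * Defs.eta R p.2))) =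
    berezin (H * E x) - x * beta p.1 p.2 * berezin (H * q * E x).
  rewrite big_cons mulrA mulrBr mulr1 mulrBl berezinD -scaleN1r berezinZ mulN1r.
  by rewrite -scalerAr -scalerAl berezinZ.
rewrite (_ : (fun t => _) = fun x => berezin (F * E x) +
    (- (x * (beta p.1 p.2 * berezin (F * q * E x))))); last first.
  by apply/funext => x; rewrite EM mulrA.
have cq : central q by exact: central_generatorM.
apply: drv_eq.
  apply: drvD; first exact: IH.
  apply: drvN; apply: drvM; first exact: drv_id.
  by apply: drvZ; exact: IH.
rewrite /= big_cons EM -/q -/E.
have qq : F * q * q = 0 by rewrite -mulrA generatorM_sqr0 mulr0.
rewrite qq mul0r berezin0 mulr0 subr0 mul1r.
under [X in _ = - (_ + X)]eq_bigr do rewrite EM.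
have -> : \sum_(j <- r) beta j.1 j.2 * (berezin (F * (Defs.xi R j.1 * Defs.eta R j.2) * E t) -
     t * beta p.1 p.2 * berezin (F * (Defs.xi R j.1 * Defs.eta R j.2) * q * E t)) =
   \sum_(j <- r) beta j.1 j.2 * berezin (F * (Defs.xi R j.1 * Defs.eta R j.2) * E t) -
   t * beta p.1 p.2 * \sum_(j <- r) beta j.1 j.2 * berezin (F * q * (Defs.xi R j.1 * Defs.eta R j.2) * E t).
  rewrite mulr_sumr -sumrB; apply: eq_bigr => j _.
  rewrite -[F * _ * q]mulrA -(cq (Defs.xi R j.1 * _)) [F * (q * _)]mulrA; ring.
ring.
Qed.

Lemma drv_coefc (beta : Lam -> Lam -> R) A t :
  drv (fun t => coefc (fun i j => t * beta i j) A) t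
    (- \sum_i \sum_j beta i j * coefd (fun i j => t * beta i j) i j A).
Proof.
apply: drv_eq (drv_gexp beta (index_enum _) (om_set R A) t) _.
congr (- _); rewrite pair_bigA/=; apply: eq_bigr => p _; congr (_ * _).
rewrite /coefd; congr berezin.
by rewrite (even_om_set R A).1 -[LHS]mulrA.
Qed.

(** Interpolate by t beta. Differentiating [coefc] gives - [coefd]; differentiating the weight gives
    one half of the x-correlations and one half of the y-correlations, each of which [susy] turns
    into [coefd]. The total is -1 + 1/2 + 1/2 = 0. At t = 0 only the full set contributes, and
    [Int_sq] evaluates it. *)
Lemma mean_localized (beta : Lam -> Lam -> R) k : (forall i j, beta i j = beta j i) ->
  test_fun k -> mean beta k = prims (enum Lam) k (fun=> 1).
Proof.
move=> bs tk; pose bt t := fun i j => t * beta i j : R.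
have bts t i j : bt t i j = bt t j i by rewrite /bt bs.
have S0t t v : S0 (bt t) v = t * S0 beta v.
  rewrite /S0 mulrCA; congr (_ * _); rewrite !mulr_sumr; apply: eq_bigr => i _.
  by rewrite mulr_sumr; apply: eq_bigr => j _; rewrite mulrA.
have cK A : cts (fun v => Kset k A (sq v)) by apply: cts_sqc; case: (test_Kset A tk).
have dY A t : drv (fun t => Yint (bt t) k A) t
    (2^-1 * \sum_i \sum_j beta i j * (Xint (bt t) k false i j A + Xint (bt t) k true i j A)).
  rewrite (_ : (fun t => _) = fun t => Int (fun v => expR (t * S0 beta v) * Kset k A (sq v))); last first.
    by apply/funext => x; congr Int; apply/funext => v; rewrite /weight S0t.
  apply: drv_eq (drv_Int t (cts_S0 beta) (cK A)) _.
  rewrite (_ : (fun v => _) = fun v => 2^-1 * \sum_i \sum_j beta i j *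
      (v (i, false) * v (j, false) * (weight (bt t) v * Kset k A (sq v)) +
       v (i, true) * v (j, true) * (weight (bt t) v * Kset k A (sq v)))); last first.
    apply/funext => v; rewrite /S0 -mulrA mulr_suml; congr (_ * _); apply: eq_bigr => i _.
    rewrite mulr_suml; apply: eq_bigr => j _; rewrite /weight S0t; ring.
  have cXX i j b : cts (fun v => v (i, b) * v (j, b) * (weight (bt t) v * Kset k A (sq v))).
    by apply: ctsM; [apply: ctsM; exact: cts_proj|apply: ctsM => //; exact: cts_weight].
  have cXD i j : cts (fun v => beta i j *
      (v (i, false) * v (j, false) * (weight (bt t) v * Kset k A (sq v)) +
       v (i, true) * v (j, true) * (weight (bt t) v * Kset k A (sq v)))).
    by apply: ctsZ; apply: ctsD.
  rewrite IntZ; last by apply: cts_sum => i; exact: cts_sum.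
  congr (_ * _); rewrite Int_sum; last by move=> i; exact: cts_sum.
  apply: eq_bigr => i _; rewrite Int_sum//; apply: eq_bigr => j _.
  by rewrite IntZ ?IntD//; apply: ctsD.
have dF t : drv (fun t => mean (bt t) k) t 0.
  apply: drv_eq.
    apply: drvZ; apply: drv_sum => A; apply: drvZ.
    by apply: drvM; [exact: drv_coefc|exact: dY].
  apply/eqP; rewrite mulf_eq0; apply/orP; right; apply/eqP.
  have E A : 2 ^+ #|A| * (- (\sum_i \sum_j beta i j * coefd (bt t) i j A) * Yint (bt t) k A +
      coefc (bt t) A * (2^-1 * \sum_i \sum_j beta i j *
        (Xint (bt t) k false i j A + Xint (bt t) k true i j A))) =
    \sum_i \sum_j beta i j * (2^-1 * (2 ^+ #|A| * (coefc (bt t) A * Xint (bt t) k false i j A)) +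
      2^-1 * (2 ^+ #|A| * (coefc (bt t) A * Xint (bt t) k true i j A)) -
      2 ^+ #|A| * (coefd (bt t) i j A * Yint (bt t) k A)).
    rewrite mulNr mulr_suml !mulr_sumr -sumrN -big_split/= mulr_sumr; apply: eq_bigr => i _.
    rewrite mulr_suml !mulr_sumr -sumrN -big_split/= mulr_sumr; apply: eq_bigr => j _.
    by field.
  under eq_bigr do rewrite E.
  rewrite exchange_big/= big1// => i _; rewrite exchange_big/= big1// => j _.
  rewrite -mulr_sumr sumrB big_split/= -!mulr_sumr !susy//.
  by apply/eqP; rewrite mulf_eq0; apply/orP; right; apply/eqP; field.
have := @is_derive_0_is_cst R (fun t => mean (bt t) k) 1 0 dF => /=.
have -> : bt 1 = beta by apply/funext => i; apply/funext => j; rewrite /bt mul1r.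
move=> ->; rewrite /mean (bigD1 (finset.setTfor Lam))//= big1 ?addr0; last first.
  move=> A AT; rewrite (_ : coefc _ A = 0) ?mul0r ?mulr0//.
  rewrite /coefc /gexp big1 ?mulr1 ?berezin_om_set ?(negPf AT)// => p _.
  by rewrite /bt mul0r scale0r subr0.
rewrite (_ : coefc _ _ = 1); last first.
  rewrite /coefc /gexp big1 ?mulr1 ?berezin_om_set ?eqxx// => p _.
  by rewrite /bt mul0r scale0r subr0.
rewrite (_ : Yint _ _ _ = Int (fun v => k (sq v))); last first.
  congr Int; apply/funext => v; rewrite /weight S0t mul0r expR0 mul1r /Kset.
  by rewrite finset.setCT enum_set0.
rewrite mul1r Int_sq// finset.cardsT mulrA mulrA.
rewrite -exprMn mulVf ?mul1r// expf_neq0// gt_eqF// mulr_gt0//.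
by rewrite pi_gt0.
Qed.

End Localization.

(** * Uniqueness for the homogeneous identity *)

Section Contraction.
Variables (R : realType) (Lam : finType).
Implicit Types (i j : Lam) (k : (Lam -> R) -> R) (s : Lam -> R).
Local Notation upd v i t := (@dfwith _ (fun=> R) v i t).

Definition unit_cube s : Prop := forall j, 0 <= s j <= 1.

Lemma unit_cube_upd s i t : unit_cube s -> 0 <= t <= 1 -> unit_cube (upd s i t).
Proof.
by move=> s01 t01 j; case: (eqVneq i j) => [<-|ij]; rewrite ?dfwithin ?dfwithout.
Qed.

Lemma prim0 k i s : test_fun k -> 0 <= s i ->
  prim i k s = rint 0 (s i) (fun t => k (upd s i t)).
Proof.
move=> [ck [e e0 ke]] s0; rewrite /prim (@rint_split _ (-2) 0)//; last first.
  exact: cts_section.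
rewrite (@eq_rint _ _ _ _ (fun=> 0)) ?rint_cst ?mul0r ?add0r// => t /andP[_ t0].
by apply: ke; exists i; rewrite dfwithin (le_trans t0)// ltW.
Qed.

Lemma prim_bound k i B : test_fun k -> (forall s, unit_cube s -> `|k s| <= B) ->
  forall s, unit_cube s -> `|prim i k s| <= B.
Proof.
move=> tk kB s s01; have /andP[s0 s1] := s01 i; rewrite prim0//.
have B0 : 0 <= B by apply: le_trans (kB _ s01).
apply: (@le_trans _ _ (B * (s i - 0))); last by rewrite subr0 ler_piMr.
apply: rint_bound => //; first by apply: cts_section; case: tk.
move=> t /andP[t0 ts]; apply/kB/unit_cube_upd => //; by rewrite t0 (le_trans ts).
Qed.

Lemma prims_bound k l B : test_fun k -> (forall s, unit_cube s -> `|k s| <= B) ->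
  forall s, unit_cube s -> `|prims l k s| <= B.
Proof.
move=> tk kB; elim: l => //= i l; apply: prim_bound; exact: test_prims.
Qed.

(** The integral of exp (c t) over [0, s_i] is at most exp (c s_i) / c. *)
Lemma prim_weighted_bound k i B c : test_fun k -> 0 < c ->
  (forall s, unit_cube s -> `|k s| <= B * expR (c * \sum_j s j)) ->
  forall s, unit_cube s -> `|prim i k s| <= B / c * expR (c * \sum_j s j).
Proof.
move=> tk c0 kB s s01; have /andP[s0 s1] := s01 i; rewrite prim0//.
pose m := \sum_(j | j != i) s j; pose g t := B * expR (c * (t + m)).
have B0 : 0 <= B.
  by have := le_trans (normr_ge0 _) (kB _ s01); rewrite pmulr_lge0// expR_gt0.
have dg t : drv (fun t => B / c * expR (c * (t + m))) t (g t).
  apply: drv_eq; first apply: drvZ.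
    apply: (drv_comp (f := expR)); first exact: is_derive_expR.
    by apply: drvZ; apply: drvD; [exact: drv_id|exact: drv_cst].
  by rewrite /g /=; field; rewrite gt_eqF.
have cg : continuous g.
  apply: drv_continuous => t; exists (B * (expR (c * (t + m)) * (c * (1 + 0)))).
  apply: drvZ; apply: (drv_comp (f := expR)); first exact: is_derive_expR.
  by apply: drvZ; apply: drvD; [exact: drv_id|exact: drv_cst].
have ck : continuous (fun t => k (upd s i t)) by apply: cts_section; case: tk.
have kg t : 0 <= t <= s i -> `|k (upd s i t)| <= g t.
  move=> /andP[t0 ts]; apply: le_trans (kB _ _) _.
    by apply: unit_cube_upd => //; rewrite t0 (le_trans ts).
  rewrite /g (bigD1 i)//= dfwithin /m; apply: ler_wpM2l => //.
  by under eq_bigr => j ji do rewrite dfwithout 1?eq_sym//.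
apply: (@le_trans _ _ (rint 0 (s i) g)).
  rewrite ler_norml -[- rint _ _ g]mulN1r -rintZ//; apply/andP; split; apply: rint_le => //.
  - by move=> t; apply: cvgM; [exact: cvg_cst|exact: cg].
  - by move=> t /kg; rewrite ler_norml mulN1r => /andP[].
  - by move=> t /kg; rewrite ler_norml => /andP[].
rewrite (rint_FTC s0 cg (fun t _ => dg t)) (bigD1 i)//= gerBl mulr_ge0 ?expR_ge0// divr_ge0//; exact: ltW.
Qed.

(* In the norm weighted by exp (c \sum_j s_j), integration is a contraction. *)
Lemma contraction (D : Lam -> ((Lam -> R) -> R) -> R) (beta : Lam -> Lam -> R) C :
  (forall i k, test_fun k -> 2 * D i k = \sum_j beta i j * D j (prim i k)) ->
  (forall i k B, test_fun k -> (forall s, unit_cube s -> `|k s| <= B) -> `|D i k| <= C * B) ->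
  forall i k, test_fun k -> D i k = 0.
Proof.
move=> DE DB.
(* Every row sum of |beta| is at most b < c, which the gain 1 / c absorbs; the factor 2 in the
   identity then halves the bound at each iteration. *)
pose b := \sum_i \sum_j `|beta i j|; pose c := b + 1.
have b0 : 0 <= b by apply: sumr_ge0 => i _; exact: sumr_ge0.
have c0 : 0 < c by rewrite ltr_wpDl.
pose E := expR (c * #|Lam|%:R).
have H n i k B : test_fun k ->
    (forall s, unit_cube s -> `|k s| <= B * expR (c * \sum_j s j)) ->
    `|D i k| <= `|C| * E * B * 2^-1 ^+ n.
  elim: n i k B => [|n IH] i k B tk kB.
    have B0 : 0 <= B.
      have z : unit_cube (fun=> 0 : R) by move=> j; rewrite lexx ler01.
      by have := le_trans (normr_ge0 _) (kB _ z); rewrite pmulr_lge0// expR_gt0.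
    rewrite expr0 mulr1; apply: (@le_trans _ _ (C * (B * E))).
      apply: DB => // s s01; apply: le_trans (kB _ s01) _; apply: ler_wpM2l => //.
      rewrite ler_expR; apply: ler_wpM2l; first exact: ltW.
      by rewrite -sum1_card natr_sum; apply: ler_sum => j _; case/andP: (s01 j).
    rewrite mulrA -mulrA [B * E]mulrC mulrA; apply: ler_wpM2r => //.
    by apply: ler_wpM2r; [exact: expR_ge0|exact: ler_norm].
  have B0 : 0 <= B.
    have z : unit_cube (fun=> 0 : R) by move=> j; rewrite lexx ler01.
    by have := le_trans (normr_ge0 _) (kB _ z); rewrite pmulr_lge0// expR_gt0.
  have -> : D i k = 2^-1 * \sum_j beta i j * D j (prim i k) by rewrite -DE//; field.
  rewrite normrM ger0_norm//.
  have -> : `|C| * E * B * 2^-1 ^+ n.+1 = 2^-1 * (`|C| * E * B * 2^-1 ^+ n).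
    by rewrite exprS; ring.
  apply: ler_wpM2l => //; apply: le_trans (ler_norm_sum _ _ _) _.
  apply: (@le_trans _ _ (\sum_j `|beta i j| * (`|C| * E * (B / c) * 2^-1 ^+ n))).
    apply: ler_sum => j _; rewrite normrM; apply: ler_wpM2l => //.
    apply: IH; first exact: test_prim.
    exact: prim_weighted_bound.
  rewrite -mulr_suml; apply: (@le_trans _ _ (c * (`|C| * E * (B / c) * 2^-1 ^+ n))).
    apply: ler_wpM2r.
      by rewrite !mulr_ge0 ?exprn_ge0 ?expR_ge0 ?invr_ge0// ltW.
    have : \sum_j `|beta i j| <= b.
      by rewrite /b [leRHS](bigD1 i)//= lerDl sumr_ge0// => l _; exact: sumr_ge0.
    by rewrite /c; lra.
  by rewrite le_eqVlt; apply/orP; left; apply/eqP; field; rewrite gt_eqF.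
move=> i k tk; apply/eqP; rewrite -normr_le0.
have [B B0 kB] := cts_bounded 1 tk.1.
have kB' s : unit_cube s -> `|k s| <= B * expR (c * \sum_j s j).
  move=> s01; apply: le_trans (kB _ _) _.
    by move=> j; have /andP[s0 s1] := s01 j; rewrite ger0_norm.
  rewrite ler_peMr// -[leLHS]expR0 ler_expR mulr_ge0 ?(ltW c0)// sumr_ge0// => j _.
  by case/andP: (s01 j).
have M0 : 0 <= `|C| * E * B by rewrite !mulr_ge0// expR_ge0.
rewrite leNgt; apply/negP => D0.
(* As n < 2^n, after n halvings the bound is smaller than |D i k|, a contradiction. *)
pose n := (Num.truncn (`|C| * E * B / `|D i k|)).+1.
have := H n i k B tk kB'; apply/negP; rewrite -ltNge exprVn ltr_pdivrMr ?exprn_gt0//.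
rewrite [ltRHS]mulrC -ltr_pdivrMr//; apply: lt_trans (truncnS_gt _) _.
by rewrite -natrX ltr_nat; exact: ltn_expl.
Qed.

End Contraction.

Section CorrelationBound.
Variables (R : realType) (Lam : finType) (beta : Lam -> Lam -> R).

(** The integrand vanishes where some s_j is at most the margin of the test function. Elsewhere s
    lies in the unit cube, where primitives do not increase the bound B; the factor 4 bounds x_a
    x_i. *)
Lemma corr_bound (a : Lam) : exists C, forall (i : Lam) k B, test_fun k ->
  (forall s, unit_cube s -> `|k s| <= B) -> `|corr beta a i k| <= C * B.
Proof.
have [W W0 wW] := cts_bounded 2 (cts_weight beta).
pose c (A : {set Lam}) : R := 4 * W * 4 ^+ size (coords (enum Lam)) * `|2 ^+ #|A| * coefc beta A|.
exists (`|(2 * pi) ^- #|Lam| : R| * \sum_(A : {set Lam}) c A) => i k B tk kB.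
have B0 : 0 <= B.
  have z : unit_cube (fun _ : Lam => 0 : R) by move=> j; rewrite lexx ler01.
  exact: le_trans (kB _ z).
rewrite /corr normrM -mulrA; apply: ler_wpM2l => //.
apply: le_trans (ler_norm_sum _ _ _) _; rewrite mulr_suml; apply: ler_sum => A _.
rewrite mulrA normrM mulrC /c -[leRHS]mulrA [_ * B]mulrC mulrA.
apply: ler_wpM2r => //; rewrite /Xint /Int.
have [cK [e e0 Ke]] := test_Kset A tk.
apply: le_trans (tots_bound (B := 4 * (W * B)) _ _ _ _) _.
- apply: ctsM; first by apply: ctsM; exact: cts_proj.
  by apply: ctsM; [exact: cts_weight|exact: cts_sqc].
- by move=> j; rewrite normr0.
- move=> v v2; rewrite !normrM; apply: ler_pM => //; last first.
    apply: ler_pM => //; first exact: wW.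
    have [[j vj]|Nv] := pselect (exists j, sq v j <= e).
      by rewrite Ke ?normr0//; exists j.
    rewrite /Kset; apply: prims_bound => // j; apply/andP; split.
      by rewrite leNgt; apply/negP => vj; apply: Nv; exists j; rewrite ltW// (lt_trans vj).
    by rewrite /sq; have := sqr_ge0 (v (j, false)); have := sqr_ge0 (v (j, true)); lra.
  have -> : 4 = 2 * 2 :> R by ring.
  by apply: ler_pM.
by rewrite le_eqVlt; apply/orP; left; apply/eqP; ring.
Qed.

End CorrelationBound.

(** * Bounded random variables *)

Section Measurability.
Variable R : realType.

Lemma floor_grid_cvg (x : R) :
  (Num.floor (n.+1%:R * x) + 1)%:~R / n.+1%:R @[n --> \oo] --> x.
Proof.
rewrite (_ : (fun n => _) = fun n => (Num.floor (n.+1%:R * x))%:~R / n.+1%:R + n.+1%:R^-1).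
  rewrite -[X in _ --> X]addr0; apply: cvgD; last exact: cvg_harmonic.
  exact: floor_approx_cvg.
by apply/funext => n; rewrite intrD mulrDl mul1r.
Qed.

Lemma floor_grid_gt (x : R) n : x < (Num.floor (n.+1%:R * x) + 1)%:~R / n.+1%:R.
Proof. by rewrite ltr_pdivlMr// mulrC; case/andP: (floor_itv (n.+1%:R * x)). Qed.

Lemma measurable_floor_fiber (c : R) (m : int) : 0 < c ->
  measurable [set x : R | Num.floor (c * x) = m].
Proof.
move=> c0; rewrite [X in measurable X](_ : _ = `[m%:~R / c, (m + 1)%:~R / c[%classic)//.
apply/seteqP; split => [x|x] /=; rewrite in_itv/= ler_pdivrMr// ltr_pdivlMr// [x * _]mulrC.
  by move=> <-; exact: floor_itv.
exact: floor_def.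
Qed.

(** Rounding to the next grid point strictly to the right lets right continuity suffice. *)
Lemma measurable_right_continuous d (T : measurableType d) (h : R -> T -> R) :
  (forall r, measurable_fun setT (h r)) ->
  (forall (y : T) (r : R), h s y @[s --> r^'+] --> h r y) ->
  measurable_fun [set: R * T] (fun q : R * T => h q.1 q.2).
Proof.
move=> mh ch.
apply: (@measurable_fun_cvg _ _ _ setT
  (fun n (q : R * T) => h ((Num.floor (n.+1%:R * q.1) + 1)%:~R / n.+1%:R) q.2)).
  move=> n _ Y mY; rewrite setTI.
  rewrite [X in measurable X](_ : _ = \bigcup_(m in [set: int])
    ([set x : R | Num.floor (n.+1%:R * x) = m] `*`
     (h ((m + 1)%:~R / n.+1%:R) @^-1` Y))); last first.
    apply/seteqP; split => [[x y] /= xy|[x y] [m _ [/= <- ]]//].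
    by exists (Num.floor (n.+1%:R * x)).
  apply: countable_bigcupT_measurable => // m; apply: measurableX.
    exact: measurable_floor_fiber.
  by rewrite -[X in measurable X]setTI; apply: mh.
move=> [x y] _ /=; have /cvg_at_rightP := ch y x; apply; split.
  by move=> n; exact: floor_grid_gt.
exact: floor_grid_cvg.
Qed.

(** The vector rounded to a grid takes countably many values, so measurability reduces to the fibres
    of the floor function. *)
Lemma measurable_cts d (T : measurableType d) (J : finType) (X : J -> T -> R)
    (F : (J -> R) -> R) :
  (forall j, measurable_fun setT (X j)) -> cts F ->
  measurable_fun setT (fun w => F (X^~ w)).
Proof.
move=> mX cF.
apply: (@measurable_fun_cvg _ _ _ setT
  (fun n (w : T) => F (fun j => (Num.floor (n.+1%:R * X j w))%:~R / n.+1%:R))).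
  move=> n _ Y mY; rewrite setTI.
  rewrite [X in measurable X](_ : _ = \bigcup_(m in [set: {ffun J -> int}])
    [set w | (forall j, Num.floor (n.+1%:R * X j w) = m j) /\
       Y (F (fun j => (m j)%:~R / n.+1%:R))]); last first.
    apply/seteqP; split => [w /= wY|w [m _ [/= wm Ym]]].
      exists [ffun j => Num.floor (n.+1%:R * X j w)] => //; split => [j|]; first by rewrite ffunE.
      by under eq_fun do rewrite ffunE.
    by under eq_fun do rewrite wm.
  apply: countable_bigcupT_measurable => // m.
  have [Ym|Ym] := pselect (Y (F (fun j => (m j)%:~R / n.+1%:R))); last first.
    by rewrite [X in measurable X](_ : _ = set0)//; apply/seteqP; split => // w [].
  rewrite [X in measurable X](_ : _ = \bigcap_(j in [set: J])
     (X j @^-1` [set x | Num.floor (n.+1%:R * x) = m j])); last first.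
    by apply/seteqP; split => [w [wm _] j _|w wm]; [exact: wm|split => // j; exact: wm].
  apply: fin_bigcap_measurable; first exact: finite_finset.
  move=> j _; rewrite -[X in measurable X]setTI; apply: mX => //.
  exact: measurable_floor_fiber.
move=> w _ /=; apply/cvgrPdist_le => e e0.
pose M := 1 + \sum_j `|X j w|.
have [D D0 FD] := cF M e e0.
have m0 : 0 < Num.min D 1 by rewrite lt_min D0/=.
have H : \forall n \near \oo, forall j, `|X j w - (Num.floor (n.+1%:R * X j w))%:~R / n.+1%:R| <= Num.min D 1.
  have Hj j : \forall n \near \oo, `|X j w - (Num.floor (n.+1%:R * X j w))%:~R / n.+1%:R| <= Num.min D 1.
    have /cvgrPdist_le := @floor_approx_cvg _ (X j w); exact.
  exact: filter_forall.
near=> n; have Hn : forall j, `|X j w - (Num.floor (n.+1%:R * X j w))%:~R / n.+1%:R| <= Num.min D 1.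
  by near: n.
have XM j : `|X j w| + 1 <= M by rewrite /M addrC lerD2l (bigD1 j)//= lerDl sumr_ge0.
apply: FD => j.
- by apply: le_trans (XM j); rewrite lerDl.
- apply: le_trans (XM j); have := Hn j; rewrite le_min => /andP[_].
  set y := _ / _; rewrite -[y](subrK (X j w)) => h.
  by apply: le_trans (ler_normD _ _) _; rewrite addrC lerD2l; move: h; rewrite subrK distrC.
- by have := Hn j; rewrite le_min => /andP[].
Unshelve. all: by end_near. Qed.

End Measurability.

Section Expectation.
Context d (T : measurableType d) (R : realType) (P : probability T R).
Implicit Types (f g : T -> R) (A : set T).

Definition Ex f : R := \int[P]_w f w.

Definition bmf f : Prop := measurable_fun setT f /\ exists M : R, forall w, `|f w| <= M.

Lemma bmf_integrable f : bmf f -> P.-integrable setT (EFin \o f).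
Proof.
move=> [mf [M fM]]; apply: measurable_bounded_integrable => //.
  by rewrite (@le_lt_trans _ _ 1%E) ?probability_le1// ltry.
by exists M; split; [exact: num_real|move=> N MN w _; exact: le_trans (fM w) (ltW MN)].
Qed.

Lemma ExD f g : bmf f -> bmf g -> Ex (fun w => f w + g w) = Ex f + Ex g.
Proof. by move=> bf bg; rewrite /Ex RintegralD//; exact: bmf_integrable. Qed.

Lemma ExB f g : bmf f -> bmf g -> Ex (fun w => f w - g w) = Ex f - Ex g.
Proof. by move=> bf bg; rewrite /Ex RintegralB//; exact: bmf_integrable. Qed.

Lemma ExZ c f : bmf f -> Ex (fun w => c * f w) = c * Ex f.
Proof. by move=> bf; rewrite /Ex RintegralZl//; exact: bmf_integrable. Qed.

Lemma Ex_cst c : Ex (fun=> c) = c.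
Proof.
rewrite /Ex Rintegral_cst// [X in c * X](_ : _ = 1) ?mulr1//.
by have := @probability_setT _ _ _ P => /= ->.
Qed.

Lemma bmf_cst c : bmf (fun=> c).
Proof. by split => //; exists `|c|. Qed.

Lemma bmfD f g : bmf f -> bmf g -> bmf (fun w => f w + g w).
Proof.
move=> [mf [M fM]] [mg [N gN]]; split; first exact: measurable_funD.
by exists (M + N) => w; apply: le_trans (ler_normD _ _) _; rewrite lerD.
Qed.

Lemma bmfM f g : bmf f -> bmf g -> bmf (fun w => f w * g w).
Proof.
move=> [mf [M fM]] [mg [N gN]]; split; first exact: measurable_funM.
by exists (M * N) => w; rewrite normrM; apply: ler_pM.
Qed.

Lemma bmfZ c f : bmf f -> bmf (fun w => c * f w).
Proof. by move=> bf; apply: bmfM => //; exact: bmf_cst. Qed.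

Lemma bmfB f g : bmf f -> bmf g -> bmf (fun w => f w - g w).
Proof.
move=> bf bg; rewrite (_ : (fun w => _) = fun w => f w + -1 * g w).
  by apply: bmfD => //; exact: bmfZ.
by apply/funext => w; rewrite mulN1r.
Qed.

Lemma bmf_sum (I : Type) (r : seq I) (Q : pred I) (F : I -> T -> R) :
  (forall i, bmf (F i)) -> bmf (fun w => \sum_(i <- r | Q i) F i w).
Proof.
move=> bF; elim: r => [|i r IH].
  by rewrite (_ : (fun w => _) = fun=> 0); [exact: bmf_cst|apply/funext => w; rewrite big_nil].
rewrite (_ : (fun w => _) = fun w => (if Q i then F i w else 0) + \sum_(i <- r | Q i) F i w).
  by apply: bmfD => //; case: (Q i) => //; exact: bmf_cst.
by apply/funext => w; rewrite big_cons; case: ifP; rewrite ?add0r.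
Qed.

Lemma Ex_sum (I : Type) (r : seq I) (Q : pred I) (F : I -> T -> R) :
  (forall i, bmf (F i)) ->
  Ex (fun w => \sum_(i <- r | Q i) F i w) = \sum_(i <- r | Q i) Ex (F i).
Proof.
move=> bF; elim: r => [|i r IH].
  rewrite big_nil -[RHS](Ex_cst 0); congr Ex; by apply/funext => w; rewrite big_nil.
rewrite big_cons (_ : (fun w => _) = fun w => (if Q i then F i w else 0) +
    \sum_(i <- r | Q i) F i w); last first.
  by apply/funext => w; rewrite big_cons; case: ifP; rewrite ?add0r.
case: (Q i); last by rewrite -IH; congr Ex; apply/funext => w; rewrite add0r.
by rewrite ExD ?IH//; exact: bmf_sum.
Qed.

Lemma Ex_le f g : bmf f -> bmf g -> (forall w, f w <= g w) -> Ex f <= Ex g.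
Proof. by move=> bf bg fg; apply: le_Rintegral => //; exact: bmf_integrable. Qed.

Lemma Ex_norm f g : bmf f -> bmf g -> (forall w, `|f w| <= g w) -> `|Ex f| <= Ex g.
Proof.
move=> bf bg fg; rewrite ler_norml -[- Ex g]mulN1r -ExZ//; apply/andP; split.
  apply: Ex_le; [exact: bmfZ|exact: bf|move=> w].
  by have := fg w; rewrite ler_norml mulN1r => /andP[].
apply: Ex_le; [exact: bf|exact: bg|move=> w].
by have := fg w; rewrite ler_norml => /andP[].
Qed.

Lemma Ex_bound f M : bmf f -> (forall w, `|f w| <= M) -> `|Ex f| <= M.
Proof. by move=> bf fM; rewrite -(Ex_cst M); apply: Ex_norm => //; exact: bmf_cst. Qed.

Definition ind A : T -> R := \1_A.

Lemma bmf_ind A : measurable A -> bmf (ind A).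
Proof.
move=> mA; split; first exact: measurable_indic.
by exists 1 => w; rewrite /ind indicE; case: (_ \in _); rewrite ?normr0 ?normr1.
Qed.

Lemma Ex_ind A : measurable A -> Ex (ind A) = fine (P A).
Proof. by move=> mA; rewrite /Ex /Rintegral integral_indic// setIT. Qed.

Lemma Ex_cvg (f_ : nat -> T -> R) f M : (forall n, measurable_fun setT (f_ n)) ->
  (forall w, f_ n w @[n --> \oo] --> f w) -> (forall n w, `|f_ n w| <= M) ->
  Ex (f_ n) @[n --> \oo] --> Ex f.
Proof.
move=> mf ff fM.
have mff : measurable_fun setT f by apply: measurable_fun_cvg => // w _; exact: ff.
have bM : bmf (fun=> M) by exact: bmf_cst.
have [] := @dominated_convergence _ _ _ P setT measurableT (fun n w => (f_ n w)%:E)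
  (EFin \o f) (fun=> M%:E).
- by move=> n; exact/measurable_EFinP.
- exact/measurable_EFinP.
- by apply: aeW => w _; apply: cvg_EFin; [exact: nearW|exact: ff].
- exact: (bmf_integrable bM).
- by apply: aeW => w n _; rewrite /= lee_fin.
move=> intf _ h; rewrite /Ex /Rintegral.
apply: fine_cvg; rewrite fineK//.
by apply: integrable_fin_num.
Qed.

End Expectation.

(** * The jump process *)

Section Paths.
Context (R : realType) (Lam : finType) d (Omega : measurableType d).
Context (P : probability Omega R) (beta : Lam -> Lam -> R) (a : Lam) (X : R -> Omega -> Lam).
Hypothesis vd : is_vdjp P beta a (fun=> 1) X.
Local Notation mu := (@lebesgue_measure R).
Implicit Types (r s t : R) (w : Omega) (i j : Lam).

(** Not stopped at the lifetime: the entry of the vertex at which X freezes keeps decreasing, past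
    0. *)
Definition left_time t w j : R := remaining (fun=> 1) X t w j.

Definition past_events t : set (set Omega) :=
  [set B | exists r i, [/\ 0 <= r, r <= t & B = [set w | X r w = i]]].

(** A copy of the sample space carrying the sigma-algebra of the history up to t, so that
    [measurable_fun] can express measurability with respect to the past. *)
Definition past t : Type := g_sigma_algebraType (past_events t).
HB.instance Definition _ t := Measurable.copy (past t) (g_sigma_algebraType (past_events t)).

(** Clamping times to [0, t] makes [visit] right-continuous on the whole line and measurable for the
    past of t. *)
Let clamp t r := Num.max 0 (Num.min r t).

Let clamp_in t r : 0 <= t -> 0 <= clamp t r <= t.
Proof. by move=> t0; rewrite /clamp le_max lexx/= ge_max t0 ge_min lexx orbT. Qed.

Let clampE t r : 0 <= r <= t -> clamp t r = r.
Proof. by move=> /andP[r0 rt]; rewrite /clamp min_l// max_r. Qed.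

Definition visit t j r w : R := (X (clamp t r) w == j)%:R.

Lemma visitE t j r w : 0 <= r <= t -> visit t j r w = (X r w == j)%:R.
Proof. by move=> rt; rewrite /visit clampE. Qed.

Lemma visit_right_continuous t j w r : 0 <= t ->
  visit t j s w @[s --> r^'+] --> visit t j r w.
Proof.
move=> t0; apply: cvg_near_cst.
have [tr|rt] := leP t r.
  apply: filterS (nbhs_right_gt r) => s rs.
  by rewrite /visit /clamp !min_r// (le_trans tr)// ltW.
have [r0|r0] := ltP r 0.
  near=> s; have s0 : s < 0 by near: s; exact: nbhs_right_lt.
  have st : s <= t by rewrite ltW// (lt_le_trans s0).
  by rewrite /visit /clamp !min_l ?(ltW rt)// !max_l// ltW.
near=> s; have st : s < t by near: s; exact: nbhs_right_lt.
have rs : r < s by near: s; exact: nbhs_right_gt.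
rewrite /visit clampE; last by rewrite (ltW st) (le_trans r0 (ltW rs)).
rewrite clampE; last by rewrite r0 ltW.
suff -> : X s w = X r w by [].
by near: s; exact: (vdjp_right_continuous vd).
Unshelve. all: by end_near. Qed.

Lemma past_measurable_visit t j r : 0 <= t ->
  measurable_fun setT (visit t j r : past t -> R).
Proof.
move=> t0.
rewrite (_ : visit t j r = \1_[set w | X (clamp t r) w = j]).
  apply: measurable_indic; apply: sub_sigma_algebra.
  by have /andP[c0 ct] := clamp_in r t0; exists (clamp t r), j.
apply/funext => w; rewrite indicE /visit; congr (_%:R).
by congr nat_of_bool; apply/eqP/idP; rewrite inE.
Qed.

Lemma past_measurable_visit2 t j : 0 <= t ->
  measurable_fun [set: R * past t] (fun q => visit t j q.1 q.2).
Proof.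
move=> t0; apply: (@measurable_right_continuous R _ (past t) (visit t j)).
  by move=> r; exact: past_measurable_visit.
by move=> w r; exact: visit_right_continuous.
Qed.

Lemma measurable_visit t j w : 0 <= t -> measurable_fun setT (fun r => visit t j r w).
Proof.
move=> t0; exact: (measurableT_comp (past_measurable_visit2 j t0) (pair2_measurable (w : past t))).
Qed.

Lemma visit_le1 t j r w : `|visit t j r w| <= 1.
Proof. by rewrite /visit; case: (_ == _); rewrite ?normr0 ?normr1. Qed.

Lemma visit_integrable t j w s u : 0 <= t ->
  mu.-integrable `[s, u] (EFin \o (fun r => visit t j r w)).
Proof.
move=> t0; apply: measurable_bounded_integrable => //.
- by rewrite /= lebesgue_measure_itv/=; case: ifP => _; rewrite ?ltry.
- by apply: measurable_funTS; exact: measurable_visit.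
- exists 1; split => // N N1 r _; apply: le_trans (ltW N1); exact: visit_le1.
Qed.

Lemma left_timeE t T w j : 0 <= t <= T ->
  left_time t w j = 1 - rint 0 t (fun r => visit T j r w).
Proof.
move=> /andP[t0 tT]; rewrite /left_time /remaining; congr (1 - _).
apply: eq_rint => r /andP[r0 rt]; rewrite visitE// r0/=; exact: le_trans tT.
Qed.

(** Right continuity gives joint measurability, and Tonelli then gives that of the time integral. *)
Lemma past_measurable_left_time t j : 0 <= t ->
  measurable_fun setT (left_time t ^~ j : past t -> R).
Proof.
move=> t0.
rewrite (_ : (left_time t ^~ j) = fun w => 1 - rint 0 t (fun r => visit t j r w)); last first.
  by apply/funext => w; rewrite (@left_timeE t t)// t0 lexx.
apply: measurable_funB => //.
pose g (q : R * past t) : \bar R := ((visit t j q.1 q.2) * \1_(`[0, t]%classic) q.1)%:E.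
have mg : measurable_fun setT g.
  apply/measurable_EFinP; apply: measurable_funM; first exact: past_measurable_visit2.
  have m1 : measurable_fun setT (\1_(`[0, t]%classic) : R -> R) by exact: measurable_indic.
  exact: (measurableT_comp m1 measurable_fst).
have := @measurable_fun_fubini_tonelli_G _ _ _ _ R mu g mg.
have g0 q : (0 <= g q)%E.
  by rewrite /g lee_fin mulr_ge0// /visit indicE; case: (_ \in _).
move=> /(_ g0) mG.
rewrite (_ : (fun w => rint _ _ _) = fine \o fubini_G mu g).
  by apply: measurableT_comp.
apply/funext => w; rewrite /rint /Rintegral/= /fubini_G; congr fine.
rewrite [LHS]integral_mkcond; apply: (@eq_integral _ _ _ mu) => r _.
by rewrite /g patchE indicE/=; case: ifP => rt; rewrite ?mulr1 ?mulr0.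
Qed.

Lemma past_measurable t (A : set Omega) : 0 <= t ->
  measurable (A : set (past t)) -> measurable A.
Proof.
move=> t0 mA; apply: (smallest_sub (sigma_algebra_measurable _) _ mA).
by move=> _ [r [i [r0 rt ->]]]; exact: (vdjp_measurable vd).
Qed.

Lemma past_measurable_fun t (f : Omega -> R) : 0 <= t ->
  measurable_fun setT (f : past t -> R) -> measurable_fun setT f.
Proof.
move=> t0 mf _ Y mY; apply: (past_measurable t0); exact: mf.
Qed.

Lemma measurable_left_time t j : 0 <= t -> measurable_fun setT (left_time t ^~ j).
Proof. by move=> t0; apply: (past_measurable_fun t0); exact: past_measurable_left_time. Qed.

Lemma measurable_at t i : 0 <= t -> measurable [set w | X t w = i].
Proof. by move=> t0; exact: (vdjp_measurable vd). Qed.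

Lemma left_time_diff s t w j : 0 <= s <= t ->
  0 <= left_time s w j - left_time t w j <= t - s.
Proof.
move=> /andP[s0 st]; have t0 : 0 <= t by exact: le_trans st.
rewrite (@left_timeE s t) ?s0// (@left_timeE t t) ?t0 ?lexx//.
have -> (x y : R) : 1 - x - (1 - y) = y - x by ring.
rewrite /rint Rintegral_itvB ?bnd_simp//; last exact: visit_integrable.
apply/andP; split; first by apply: Rintegral_ge0 => r _; rewrite /visit.
have E : t - s = \int[mu]_(r in `]s, t]) (1 : R).
  rewrite Rintegral_cst//= lebesgue_measure_itv/= lte_fin mul1r.
  by move: st; rewrite le_eqVlt => /predU1P[->|->//]; rewrite ltxx subrr.
rewrite E; apply: le_Rintegral => //.
- apply: (@integrableS _ _ _ mu `[s, t] `]s, t]) => //; first exact: subset_itv_oc_cc.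
  exact: visit_integrable.
- apply: (@integrableS _ _ _ mu `[s, t] `]s, t]) => //; first exact: subset_itv_oc_cc.
  by apply: continuous_integrable; exact: cst_continuous.
- by move=> r _; have := visit_le1 t j r w; rewrite ler_norml => /andP[].
Qed.

Lemma left_time_const s t w i j : 0 <= s <= t ->
  (forall r, s < r <= t -> X r w = i) ->
  left_time t w j = left_time s w j - (t - s) * (i == j)%:R.
Proof.
move=> /andP[s0 st] Xi; have t0 : 0 <= t by exact: le_trans st.
rewrite (@left_timeE s t) ?s0// (@left_timeE t t) ?t0 ?lexx//.
suff : rint 0 t (fun r => visit t j r w) - rint 0 s (fun r => visit t j r w) =
  (t - s) * (i == j)%:R by lra.
rewrite /rint Rintegral_itvB ?bnd_simp//; last exact: visit_integrable.
rewrite (@eq_Rintegral _ _ _ _ _ (fun=> (i == j)%:R)); last first.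
  move=> r; rewrite inE/= in_itv/= => /andP[sr rt].
  by rewrite visitE ?Xi ?sr// (le_trans s0 (ltW sr)).
rewrite Rintegral_cst//= lebesgue_measure_itv/= lte_fin mulrC.
by move: st; rewrite le_eqVlt => /predU1P[->|->//]; rewrite ltxx subrr !mul0r.
Qed.

Lemma left_time0 w j : left_time 0 w j = 1.
Proof. by rewrite (@left_timeE 0 0) ?lexx// rintxx subr0. Qed.

(** Exactly one vertex is occupied at each time. Consequently the left times cannot all be positive
    from time #|Lam| on. *)
Lemma sum_left_time t w : 0 <= t -> \sum_j left_time t w j = #|Lam|%:R - t.
Proof.
move=> t0; under eq_bigr do rewrite (@left_timeE t t) ?t0 ?lexx//.
rewrite sumrB sumr_const -[LHS]/(_ - _); congr (_ - _).
have H (l : seq Lam) : \sum_(j <- l) rint 0 t (fun r => visit t j r w) =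
    rint 0 t (fun r => \sum_(j <- l) visit t j r w) /\
    mu.-integrable `[0, t] (EFin \o (fun r => \sum_(j <- l) visit t j r w)).
  elim: l => [|j l [IH1 IH2]].
    rewrite big_nil; under [X in rint _ _ X]eq_fun do rewrite big_nil.
    rewrite rint_cst// mul0r; split => //.
    rewrite (_ : _ \o _ = EFin \o (fun=> 0)); last by apply/funext => r /=; rewrite big_nil.
    by apply: continuous_integrable; exact: cst_continuous.
  rewrite big_cons IH1 /rint -RintegralD//; last exact: visit_integrable.
  split; first by apply: eq_Rintegral => r _; rewrite big_cons.
  rewrite (_ : _ \o _ = ((EFin \o (fun r => visit t j r w)) \+
     (EFin \o (fun r => \sum_(j <- l) visit t j r w)%R))%E); last first.
    by apply/funext => r /=; rewrite big_cons EFinD.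
  by apply: integrableD => //; exact: visit_integrable.
have [-> _] := H (index_enum Lam).
rewrite (@eq_rint _ _ _ _ (fun=> 1)); first by rewrite rint_cst// mul1r subr0.
move=> r _; rewrite /visit (bigD1 (X (clamp t r) w))//= eqxx big1 ?addr0// => j jX.
by rewrite eq_sym (negPf jX).
Qed.

(** The lifetime is an infimum, so a strict inequality needs a margin e, a positive lower bound of
    the left times at t: they are 1-Lipschitz, and stay positive until t + e. *)
Lemma lt_lifetime t w : 0 <= t ->
  (t%:E < lifetime (fun=> 1%R) X w)%E <-> forall j, 0 < left_time t w j.
Proof.
move=> t0; split => [tz j|tz].
  rewrite ltNge; apply/negP => tj; move: tz; rewrite ltNge => /negP; apply.
  by apply: ereal_inf_lbound; exists t => //; split => //; exists j.
have [e [e0 ej]] : exists e : R, 0 < e /\ forall j, e <= left_time t w j.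
  have [e e0 eP] := @finite_witness R Lam (fun j e => e <= left_time t w j)
    (fun j x y xj yx => le_trans yx xj) (fun j => ex_intro2 _ _ (left_time t w j) (tz j) (lexx _)).
  by exists e.
apply: (@lt_le_trans _ _ (t + e)%:E); first by rewrite lte_fin ltrDl.
apply: le_ereal_inf_tmp => _ [r [r0 [j rj]] <-]; rewrite lee_fin.
have [rt|tr] := leP r t.
  have /andP[h _] := @left_time_diff r t w j (ltac:(by rewrite r0)).
  have := ej j; rewrite -/(left_time r w j) in rj; lra.
have /andP[_ h] := @left_time_diff t r w j (ltac:(by rewrite t0 ltW)).
by have := ej j; rewrite -/(left_time r w j) in rj; lra.
Qed.

Lemma left_time_box t w : 0 <= t -> box (1 + t) (left_time t w).
Proof.
move=> t0 j; have := @left_time_diff 0 t w j (ltac:(by rewrite lexx)).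
by rewrite left_time0 subr0 ler_norml => /andP[h1 h2]; apply/andP; split; lra.
Qed.

End Paths.

(** * Right derivatives and the fundamental theorem of calculus *)

Section RightDerivative.
Variable R : realType.
Implicit Types (f phi psi : R -> R) (a b B : R).

(** With a slack e, the last point where the graph is not above the line of slope B + e would be
    followed by another such point. *)
Lemma dini_le f a b B : a <= b -> continuous f ->
  (forall t, a <= t < b -> forall e, 0 < e ->
    \forall h \near 0^'+, f (t + h) - f t <= (B + e) * h) ->
  f b - f a <= B * (b - a).
Proof.
move=> ab cf fB; rewrite leNgt; apply/negP => lt.
have ab' : a < b.
  by rewrite lt_neqAle ab andbT; apply/eqP => E; move: lt; rewrite E !subrr mulr0 ltxx.
have ba : 0 < b - a by rewrite subr_gt0.
(* Half of the excess slope, so that f still ends strictly above the line of slope B + e. *)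
pose e := (f b - f a - B * (b - a)) / (2 * (b - a)).
have e0 : 0 < e by rewrite divr_gt0 ?mulr_gt0 ?subr_gt0.
pose G t := f t - f a - (B + e) * (t - a).
have cG : continuous G.
  move=> t; apply: cvgB; first by apply: cvgB; [exact: cf|exact: cvg_cst].
  apply: cvgM; first exact: cvg_cst.
  by apply: cvgB; [exact: cvg_id|exact: cvg_cst].
have Ga : G a = 0 by rewrite /G !subrr mulr0 subr0.
have Gb : 0 < G b.
  rewrite /G; have -> : f b - f a - (B + e) * (b - a) = e * (b - a).
    rewrite {2}/e; rewrite (_ : _ / (2 * _) = e)//.
    have : e * (b - a) = (f b - f a - B * (b - a)) / 2.
      by rewrite /e; field; rewrite gt_eqF.
    lra.
  exact: mulr_gt0.
pose S := [set t | a <= t <= b /\ G t <= 0].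
have Sa : S a by split; rewrite ?lexx ?ab// Ga.
have hS : has_sup S by split; [exists a|exists b => t [/andP[]]].
have as_ : a <= sup S by exact: sup_upper_bound.
have sb : sup S <= b by apply: ge_sup; [exists a|move=> t [/andP[]]].
have Gs : G (sup S) <= 0.
  rewrite leNgt; apply/negP => Gs.
  have /nbhs_ballP[r /= r0 rP] : \forall t \near sup S, 0 < G t.
    have /cvgrPdist_lt/(_ _ Gs) := cG (sup S).
    by apply: filterS => t; rewrite ltr_norml => /andP[_]; lra.
  have [t St tr] := sup_adherent r0 hS.
  have ts := sup_upper_bound hS St.
  have : 0 < G t by apply: rP; rewrite /ball/= ger0_norm; lra.
  by have [_ h] := St; rewrite ltNge h.
have sb' : sup S < b.
  by rewrite lt_neqAle sb andbT; apply/eqP => E; move: Gs; rewrite E leNgt Gb.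
have : \forall h \near 0^'+, (f (sup S + h) - f (sup S) <= (B + e) * h) /\
   (0 < h) /\ sup S + h <= b.
  near=> h; split; last split.
  - by near: h; apply: fB; rewrite ?as_.
  - by near: h; exact: nbhs_right_gt.
  - rewrite -lerBrDl ltW//; near: h; apply: nbhs_right_lt; rewrite subr_gt0//.
move=> /filter_ex[h [h1 [h0 h2]]].
have : S (sup S + h).
  split; first by rewrite h2 andbT; lra.
  move: Gs h1; rewrite /G => Gs h1.
  have -> : (B + e) * (sup S + h - a) = (B + e) * (sup S - a) + (B + e) * h by ring.
  lra.
by move/(sup_upper_bound hS); lra.
Unshelve. all: by end_near. Qed.

(** The function phi minus a primitive of psi has right derivative zero; [dini_le] for both signs
    makes it constant. *)
Lemma right_FTC phi psi a b : a <= b -> continuous phi -> continuous psi ->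
  (forall t, a <= t < b -> (phi (t + h) - phi t) / h @[h --> 0^'+] --> psi t) ->
  rint a b psi = phi b - phi a.
Proof.
move=> ab cphi cpsi phiP.
pose F t := phi t - rint (a - 1) t psi.
have dF t : a <= t -> drv (fun u => rint (a - 1) u psi) t (psi t).
  by move=> at_; apply: rint_derive => //; lra.
(* Continuity is wanted on the whole line, whereas the primitive is differentiated only to the right
   of its base point a - 1. *)
pose c t := Num.max a t.
have cc : continuous c by move=> t; apply: (continuous_max (f := fun=> a)) => //; exact: cvg_cst.
have cF : continuous (F \o c).
  move=> t; apply: continuous_comp; first exact: cc.
  apply: cvgB; first exact: cphi.
  have act : a <= c t by rewrite /c le_max lexx.
  apply: differentiable_continuous; apply/derivable1_diffP.
  by have [dd _] := dF _ act.
have F0 t : a <= t < b -> (F (t + h) - F t) / h @[h --> 0^'+] --> (0 : R).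
  move=> /andP[at_ tb].
  suff : (F (t + h) - F t) / h @[h --> 0^'+] --> psi t - psi t by rewrite subrr.
  have -> : (fun h => (F (t + h) - F t) / h) =
     fun h => (phi (t + h) - phi t) / h -
       (rint (a - 1) (t + h) psi - rint (a - 1) t psi) / h.
    by apply/funext => h; rewrite /F; ring.
  apply: cvgB; first by apply: phiP; rewrite at_.
  have [dd <-] := dF _ at_.
  have -> : (fun h => (rint (a - 1) (t + h) psi - rint (a - 1) t psi) / h) =
    (fun h => h^-1 *: (rint (a - 1) (h *: 1 + t) psi - rint (a - 1) t psi)).
    by apply/funext => h; rewrite /GRing.scale/= mulr1 [h + t]addrC mulrC.
  by apply: cvg_dnbhs_at_right; exact: dd.
have sgn (s : R) : `|s| = 1 -> s * (F b - F a) <= 0.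
  move=> s1.
  have cs : continuous (fun t => s * (F \o c) t).
    by move=> t; apply: cvgM; [exact: cvg_cst|exact: cF].
  have := @dini_le (fun t => s * (F \o c) t) a b 0 ab cs.
  rewrite /= /c maxxx (max_r ab) mul0r -mulrBr; apply.
  move=> t /andP[at_ tb] e e0; rewrite add0r.
  have /cvgrPdist_le/(_ e e0) H := F0 t (ltac:(by rewrite at_)).
  near=> h; have h0 : 0 < h by near: h; exact: nbhs_right_gt.
  rewrite !max_r//; last by rewrite (le_trans at_)// lerDl ltW.
  rewrite -mulrBr -ler_pdivrMr// -mulrA (le_trans (ler_norm _))// normrM s1 mul1r.
  by rewrite -normrN -sub0r; near: h.
have /eqP : F b - F a = 0.
  by apply/le_anti; have := sgn 1 (normr1 _); have := sgn (-1) (normrN1 _); lra.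
rewrite /F => /eqP.
rewrite (@rint_split _ (a - 1) a b psi)//; lra.
Unshelve. all: by end_near. Qed.

End RightDerivative.

(** * Functions with continuous partial derivatives *)

Section Differentiable.
Variables (R : realType) (J : finType).
Local Notation upd v i t := (@dfwith _ (fun=> R) v i t).
Implicit Types (f g k : (J -> R) -> R).

Definition c1 f : Prop := cts f /\
  forall j, exists2 g, cts g & forall v x, drv (fun t => f (upd v j t)) x (g (upd v j x)).

Lemma c1_cst c : c1 (fun=> c).
Proof.
split; first exact: cts_cst.
by move=> j; exists (fun=> 0); [exact: cts_cst|move=> v x; exact: drv_cst].
Qed.

Lemma c1_proj i : c1 (fun v => v i).
Proof.
split; first exact: cts_proj.
move=> j; exists (fun=> (i == j)%:R); first exact: cts_cst.
move=> v x; have [<-|ij] := eqVneq i j.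
  by under eq_fun do rewrite dfwithin; exact: drv_id.
by under eq_fun do rewrite dfwithout 1?eq_sym//; exact: drv_cst.
Qed.

Lemma c1D f g : c1 f -> c1 g -> c1 (fun v => f v + g v).
Proof.
move=> [cf df] [cg dg]; split; first exact: ctsD.
move=> j; have [f' cf' f'P] := df j; have [g' cg' g'P] := dg j.
by exists (fun v => f' v + g' v); [exact: ctsD|move=> v x; exact: drvD].
Qed.

Lemma c1M f g : c1 f -> c1 g -> c1 (fun v => f v * g v).
Proof.
move=> [cf df] [cg dg]; split; first exact: ctsM.
move=> j; have [f' cf' f'P] := df j; have [g' cg' g'P] := dg j.
exists (fun v => f' v * g v + f v * g' v); first by apply: ctsD; exact: ctsM.
by move=> v x; exact: (drvM (f'P v x) (g'P v x)).
Qed.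

Lemma c1_sum (I : Type) (r : seq I) (P : pred I) (F : I -> (J -> R) -> R) :
  (forall i, c1 (F i)) -> c1 (fun v => \sum_(i <- r | P i) F i v).
Proof.
move=> cF; elim: r => [|i r IH].
  by under eq_fun do rewrite big_nil; exact: c1_cst.
under eq_fun do rewrite big_cons; case: (P i) => //.
exact: c1D.
Qed.

Lemma c1_prod (I : Type) (r : seq I) (P : pred I) (F : I -> (J -> R) -> R) :
  (forall i, c1 (F i)) -> c1 (fun v => \prod_(i <- r | P i) F i v).
Proof.
move=> cF; elim: r => [|i r IH].
  by under eq_fun do rewrite big_nil; exact: c1_cst.
under eq_fun do rewrite big_cons; case: (P i) => //.
exact: c1M.
Qed.

Lemma drv_expR x : drv (@expR R) x (expR x).
Proof. exact: is_derive_expR. Qed.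

Lemma c1_exp f : c1 f -> c1 (fun v => expR (f v)).
Proof.
move=> [cf df]; split; first exact: (cts_comp1 (@cts1_expR R)).
move=> j; have [f' cf' f'P] := df j.
exists (fun v => expR (f v) * f' v).
  by apply: ctsM => //; exact: (cts_comp1 (@cts1_expR R)).
by move=> v x; exact: (drv_comp (drv_expR _) (f'P v x)).
Qed.

(** Unlike x^2 it keeps negative arguments negative, where test functions vanish; it is still C^1 at
    0. *)
Definition sqabs (x : R) : R := x * `|x|.

Lemma cts_norm f : cts f -> cts (fun v => `|f v|).
Proof.
apply: cts_comp1 => M e e0; exists e => // x y _ _; apply: le_trans.
exact: ler_dist_dist.
Qed.

Lemma cts_sqabs j : cts (fun v : J -> R => sqabs (v j)).
Proof. by apply: ctsM; [exact: cts_proj|apply: cts_norm; exact: cts_proj]. Qed.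

Lemma drv_sqabs x : drv sqabs x (2 * `|x|).
Proof.
apply: (@drv_quadratic R sqabs x _ 2 1) => // h _; rewrite /sqabs ler_norml.
have := sqr_ge0 h => h2.
have [x0|x0] := leP 0 x; have [h0|h0] := leP 0 (x + h);
  rewrite ?(ger0_norm x0) ?(ltr0_norm x0) ?(ger0_norm h0) ?(ltr0_norm h0);
  apply/andP; split; nra.
Qed.

Definition sqabsv (v : J -> R) : J -> R := fun j => sqabs (v j).

Lemma cts_sqabsv f : cts f -> cts (fun v => f (sqabsv v)).
Proof.
move=> cf; exact: (@cts_comp _ _ _ f (fun j v => sqabs (v j)) cf (fun j => cts_sqabs j)).
Qed.

Lemma sqabsv_upd v j x : sqabsv (upd v j x) = upd (sqabsv v) j (sqabs x).
Proof.
apply/funext => i; rewrite /sqabsv; have [->|ij] := eqVneq i j.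
  by rewrite !dfwithin.
by rewrite !dfwithout// eq_sym.
Qed.

Lemma drv_prim_sqabsv k j v x : test_fun k ->
  drv (fun t => prim j k (sqabsv (upd v j t))) x
    (k (sqabsv (upd v j x)) * (2 * `|x|)).
Proof.
move=> tk; under eq_fun do rewrite sqabsv_upd; rewrite sqabsv_upd.
exact: (@drv_comp R (fun t => prim j k (upd (sqabsv v) j t)) sqabs x _ _
  (prim_derive _ _ _ tk) (drv_sqabs x)).
Qed.

Lemma c1_prims_sqabsv k : test_fun k -> c1 (fun v => prims (enum J) k (sqabsv v)).
Proof.
move=> tk; have ck := tk.1; split; first by apply: cts_sqabsv; exact: cts_prims.
move=> j; have jJ : j \in enum J by rewrite mem_enum.
exists (fun v => prims (rem j (enum J)) k (sqabsv v) * (2 * `|v j|)).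
  apply: ctsM; first by apply: cts_sqabsv; exact: cts_prims.
  by apply: ctsZ; apply: cts_norm; exact: cts_proj.
move=> v x; rewrite (prims_rem ck jJ) dfwithin.
by apply: drv_prim_sqabsv; exact: test_prims.
Qed.

End Differentiable.

(** * Jump rates weighted by functionals of the past *)

Section Rates.
Context (R : realType) (Lam : finType) d (Omega : measurableType d).
Context (P : probability Omega R) (beta : Lam -> Lam -> R) (a : Lam) (X : R -> Omega -> Lam).
Hypothesis vd : is_vdjp P beta a (fun=> 1) X.
Implicit Types (r s t : R) (w : Omega) (i j k : Lam) (u g : (Lam -> R) -> R).
Local Notation left_time := (left_time X).
Local Notation ind := (@ind _ _ R).

Definition at_ t i w : R := (X t w == i)%:R.

Lemma at_ind t i : at_ t i = ind [set w | X t w = i].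
Proof.
apply/funext => w; rewrite /ind indicE /at_; congr (_%:R).
by congr nat_of_bool; apply/eqP/idP; rewrite inE.
Qed.

Lemma at_eq s t i w : X s w = X t w -> at_ s i w = at_ t i w.
Proof. by rewrite /at_ => ->. Qed.

Lemma at_neq t i w : X t w <> i -> at_ t i w = 0.
Proof. by rewrite /at_ => /eqP/negPf ->. Qed.

Lemma at_lt1 t i w : `|at_ t i w| < 1 -> at_ t i w = 0.
Proof. by rewrite /at_; case: (_ == _); rewrite // normr1 ltxx. Qed.

Lemma at_self t w : at_ t (X t w) w = 1.
Proof. by rewrite /at_ eqxx. Qed.

Lemma bmf_at t i : 0 <= t -> bmf (at_ t i).
Proof. by move=> t0; rewrite at_ind; apply: bmf_ind; exact: (measurable_at vd). Qed.

Lemma at_norm t i w : `|at_ t i w| <= 1.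
Proof. by rewrite /at_; case: (_ == _); rewrite ?normr0 ?normr1. Qed.

Lemma bmf_path u t : cts u -> 0 <= t -> bmf (fun w => u (left_time t w)).
Proof.
move=> cu t0; split; first by apply: measurable_cts cu => j; exact: (measurable_left_time vd).
have [B B0 BP] := cts_bounded (1 + t) cu.
by exists B => w; apply: BP; exact: (left_time_box vd).
Qed.

Lemma bmf_left_time t j : 0 <= t -> bmf (fun w => left_time t w j).
Proof. by move=> t0; apply: (bmf_path (cts_proj j)). Qed.

Lemma Ex_lincomb (I : Type) (r : seq I) (c : I -> R) (f : I -> Omega -> R) f1 f2 :
  (forall m, bmf (fun w => f m w * f1 w * f2 w)) ->
  Ex P (fun w => (\sum_(m <- r) c m * f m w) * f1 w * f2 w) =
  \sum_(m <- r) c m * Ex P (fun w => f m w * f1 w * f2 w).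
Proof.
move=> bf; rewrite (eq_bigr (fun m => Ex P (fun w => c m * (f m w * f1 w * f2 w)))).
  rewrite -Ex_sum; last by move=> m; exact: bmfZ.
  congr Ex; apply/funext => w; rewrite !mulr_suml.
  by apply: eq_bigr => m _; rewrite !mulrA.
by move=> m _; rewrite ExZ.
Qed.

(** By [lt_lifetime], the event that t precedes the lifetime. *)
Definition alive t : set Omega := [set w | forall j, 0 < left_time t w j].

Lemma past_measurable_alive t : 0 <= t -> measurable (alive t : set (past X t)).
Proof.
move=> t0; rewrite (_ : alive t = \big[setI/setT]_(j <- enum Lam) [set w | 0 < left_time t w j]).
  apply: bigsetI_measurable => j _.
  rewrite (_ : [set _ | _] = setT `&` (left_time t ^~ j) @^-1` `]0, +oo[); last first.
    by apply/seteqP; split=> w /=; rewrite in_itv/= andbT; [split|case].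
  exact: (past_measurable_left_time vd).
apply/seteqP; split => [w wa|w]; rewrite -bigcap_seq.
  by move=> j _; exact: wa.
by move=> wa j; apply: wa; rewrite /= mem_enum.
Qed.

Lemma measurable_alive t : 0 <= t -> measurable (alive t).
Proof. by move=> t0; exact: (past_measurable vd t0 (past_measurable_alive t0)). Qed.

Lemma rates_event t (A : set Omega) i k : 0 <= t -> i != k ->
  measurable (A : set (past X t)) -> A `<=` alive t ->
  Ex P (fun w => ind A w * at_ t i w * at_ (t + h) k w) / h @[h --> 0^'+] -->
  beta i k * Ex P (fun w => ind A w * at_ t i w * left_time t w k).
Proof.
move=> t0 ik mA Aa.
have mA' : measurable A by exact: (past_measurable vd t0 mA).
have := vdjp_rates vd t0 mA ik => /=.
set B := A `&` _.
have BE : B = A `&` [set w | X t w = i].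
  apply/seteqP; split => [w [wA [wi _]]//|w [wA wi]]; split => //; split => //.
  by apply: (proj2 (lt_lifetime vd w t0)); exact: Aa.
have mi := measurable_at vd i t0.
have -> : \int[P]_(w in B) (beta i k * remaining (fun=> 1) X t w k) =
    beta i k * Ex P (fun w => ind A w * at_ t i w * left_time t w k).
  rewrite -ExZ; last first.
    by apply: bmfM; [apply: bmfM; [exact: bmf_ind|exact: bmf_at]|exact: bmf_left_time].
  rewrite /Ex /Rintegral integral_mkcond; congr fine; apply: eq_integral => w _.
  rewrite patchE BE at_ind /ind !indicE in_setI -/(left_time t w k).
  by case: (w \in A); case: (w \in _); rewrite /= ?mul1r ?mul0r ?mulr0.
apply: cvg_trans; apply: near_eq_cvg; near=> h.
have th : 0 <= t + h by rewrite addr_ge0//; near: h; exact: nbhs_right_ge.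
have mk := measurable_at vd k th.
congr (_ / _); rewrite -Ex_ind; last by apply: measurableI => //; rewrite BE; exact: measurableI.
rewrite BE; congr Ex; apply/funext => w; rewrite !at_ind /ind !indicE !in_setI.
by case: (w \in A); case: (w \in _); case: (w \in _); rewrite /= ?mul1r ?mul0r ?mulr0.
Unshelve. all: by end_near. Qed.

(* The weight phi is rounded to the grid of mesh 1 / n. *)
Lemma rates_weighted t (phi : Omega -> R) M i k : 0 <= t -> i != k ->
  measurable_fun setT (phi : past X t -> R) -> (forall w, `|phi w| <= M) ->
  (forall w, ~ alive t w -> phi w = 0) ->
  Ex P (fun w => phi w * at_ t i w * at_ (t + h) k w) / h @[h --> 0^'+] -->
  beta i k * Ex P (fun w => phi w * at_ t i w * left_time t w k).
Proof.
move=> t0 ik mphi phiM phi0.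
have bphi : bmf phi by split; [exact: (past_measurable_fun vd t0 mphi)|exists M].
pose A (n : nat) (m : int) := [set w | Num.floor (n.+1%:R * phi w) = m] `&` alive t.
have mA n m : measurable (A n m : set (past X t)).
  apply: measurableI; last exact: past_measurable_alive.
  have := mphi measurableT _ (@measurable_floor_fiber R n.+1%:R m (ltr0Sn _ _)).
  by rewrite setTI.
have mA' n m : measurable (A n m) by exact: (past_measurable vd t0 (mA n m)).
have mal : measurable (alive t) by exact: measurable_alive.
pose N := (Num.truncn `|M|).+1.
have MN : `|M| < N%:R by have /andP[] := Num.Theory.truncn_itv (normr_ge0 M).
(* Since |phi| < N, all the floors lie in this finite range, and the rounded weight is a finite
   combination of past events. *)
pose ms n := [seq (m%:Z - (n.+1 * N)%:Z)%R | m <- iota 0 (2 * (n.+1 * N))].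
pose phi_ n w := \sum_(m <- ms n) (m%:~R / n.+1%:R) * ind (A n m) w.
have phi_E n w : phi_ n w = (Num.floor (n.+1%:R * phi w))%:~R / n.+1%:R * ind (alive t) w.
  set m0 := Num.floor _.
  have indA m : ind (A n m) w = (m0 == m)%:R * ind (alive t) w.
    rewrite /ind !indicE in_setI -mulnb natrM; congr (_%:R * _); congr nat_of_bool.
    by apply/idP/eqP; rewrite inE.
  have nM : `|n.+1%:R * phi w| < (n.+1 * N)%:R.
    rewrite normrM natrM ger0_norm// ltr_pM2l// (le_lt_trans _ MN)//.
    by rewrite (le_trans (phiM w))// ler_norm.
  have m0ms : m0 \in ms n.
    move: nM; rewrite ltr_norml => /andP[n1 n2].
    have c1 : - (n.+1 * N)%:Z <= m0 by rewrite floor_ge_int mulrNz ltW.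
    have c2 : m0 < (n.+1 * N)%:Z by rewrite floor_lt_int.
    apply/mapP; exists (absz (m0 + (n.+1 * N)%:Z)%R); first by rewrite mem_iota; lia.
    lia.
  have ums : uniq (ms n) by rewrite map_inj_uniq ?iota_uniq// => x y /addIr[].
  rewrite /phi_ (bigD1_seq m0 m0ms ums) indA eqxx mul1r big1 => [|m /negPf mm0].
    exact: addr0.
  by rewrite indA eq_sym mm0 mul0r mulr0.
have bphi_ n : bmf (phi_ n).
  by apply: bmf_sum => m; apply: bmfZ; exact: bmf_ind.
have bat j r : 0 <= r -> bmf (at_ r j) by exact: bmf_at.
have bl : bmf (fun w => left_time t w k) by exact: bmf_left_time.
pose l f := beta i k * Ex P (fun w => f w * at_ t i w * left_time t w k).
pose q f h := Ex P (fun w => f w * at_ t i w * at_ (t + h) k w) / h.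
have q_cvg n : q (phi_ n) h @[h --> 0^'+] --> l (phi_ n).
  have -> : l (phi_ n) = \sum_(m <- ms n) (m%:~R / n.+1%:R) * l (ind (A n m)).
    rewrite /l Ex_lincomb; last first.
      by move=> m; apply: bmfM => //; apply: bmfM; [exact: bmf_ind|exact: bat].
    by rewrite mulr_sumr; apply: eq_bigr => m _; rewrite mulrCA.
  have : \sum_(m <- ms n) (m%:~R / n.+1%:R) * q (ind (A n m)) h @[h --> 0^'+] -->
      \sum_(m <- ms n) (m%:~R / n.+1%:R) * l (ind (A n m)).
    elim: (ms n) => [|m s IH].
      by rewrite big_nil; under eq_fun do rewrite big_nil; exact: cvg_cst.
    rewrite big_cons; under eq_fun do rewrite big_cons.
    apply: cvgD => //; apply: cvgM; first exact: cvg_cst.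
    by apply: rates_event => //; exact: subIsetr.
  apply: cvg_trans; apply: near_eq_cvg; near=> h.
  have th : 0 <= t + h by rewrite addr_ge0//; near: h; exact: nbhs_right_ge.
  have bI m : bmf (fun w => ind (A n m) w * at_ t i w * at_ (t + h) k w).
    by apply: bmfM; [apply: bmfM; [exact: bmf_ind|exact: bat]|exact: bat].
  by rewrite /q Ex_lincomb// mulr_suml; apply: eq_bigr => m _; rewrite mulrA.
have phi_d n w : `|phi w - phi_ n w| <= n.+1%:R^-1 * ind (alive t) w.
  rewrite phi_E /ind indicE; case: (boolP (w \in alive t)) => wa.
    rewrite !mulr1 ger0_norm.
      rewrite lerBlDl -[X in _ + X]mul1r -mulrDl ler_pdivlMr// mulrC.
      by have /andP[_ /ltW] := floor_itv (n.+1%:R * phi w); rewrite intrD.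
    by rewrite subr_ge0 ler_pdivrMr// [leRHS]mulrC floor_le.
  by rewrite phi0 ?mulr0 ?subrr ?normr0// => h; move: wa; rewrite notin_setE; exact.
apply/cvgrPdist_le => e e0.
(* The jump probability on [alive t] divided by h converges, hence is at most c for small h. The
   rounding error is therefore at most c / (n + 1), uniformly in h. *)
have aq := rates_event t0 ik (past_measurable_alive t0) (@subset_refl _ _).
pose c := `|l (ind (alive t))| + 1.
pose K := `|beta i k| * (1 + t) + c.
have K0 : 0 < K by rewrite /K /c ltr_wpDl ?mulr_ge0 ?addr_ge0// ltr_wpDl.
have [n nK] : exists n, n.+1%:R^-1 * K <= e / 2.
  exists (Num.truncn (K / (e / 2))).
  rewrite mulrC ler_pdivrMr// -ler_pdivrMl ?divr_gt0// mulrC ltW//.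
  by have /andP[] := Num.Theory.truncn_itv (x := K / (e / 2)) (ltac:(by rewrite ?divr_ge0 ?ltW)).
have E f1 f2 : bmf f1 -> bmf f2 -> Ex P (fun w => phi w * f1 w * f2 w) -
    Ex P (fun w => phi_ n w * f1 w * f2 w) =
    Ex P (fun w => (phi w - phi_ n w) * (f1 w * f2 w)).
  move=> b1 b2; rewrite -ExB; try by apply: bmfM => //; exact: bmfM.
  by congr Ex; apply/funext => w; rewrite mulrBl !mulrA.
have nv : 0 <= n.+1%:R^-1 :> R by [].
have phi_d' w : `|phi w - phi_ n w| <= n.+1%:R^-1.
  by apply: le_trans (phi_d n w) _; rewrite ler_piMr// /ind indicE; case: (_ \in _).
have d1 : `|l phi - l (phi_ n)| <= n.+1%:R^-1 * (`|beta i k| * (1 + t)).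
  rewrite /l -mulrBr normrM mulrCA ler_wpM2l// E//; last exact: bat.
  apply: Ex_bound; first by apply: bmfM; [exact: bmfB|apply: bmfM => //; exact: bat].
  move=> w; rewrite normrM ler_pM// normrM -[leRHS]mul1r ler_pM//; first exact: at_norm.
  exact: (left_time_box vd).
have e20 : 0 < e / 2 by rewrite divr_gt0.
have /cvgrPdist_le/(_ _ ltr01) aq1 := aq.
have /cvgrPdist_le/(_ _ e20) q1 := q_cvg n.
near=> h.
have h0 : 0 < h by near: h; exact: nbhs_right_gt.
have th : 0 <= t + h by rewrite addr_ge0// ltW.
have d2 : `|q (phi_ n) h - q phi h| <= n.+1%:R^-1 * c.
  apply: (@le_trans _ _ (n.+1%:R^-1 * q (ind (alive t)) h)).
    rewrite distrC /q -mulrBl E//; [|exact: bat|exact: bat].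
    rewrite normrM [X in _ * X <= _]gtr0_norm ?invr_gt0// mulrA ler_pM2r ?invr_gt0//.
    rewrite -ExZ; last by do 2!(apply: bmfM => //; try exact: bat); exact: bmf_ind.
    apply: Ex_norm.
    - by apply: bmfM; [exact: bmfB|apply: bmfM; exact: bat].
    - by apply: bmfZ; do 2!(apply: bmfM => //; try exact: bat); exact: bmf_ind.
    - move=> w; rewrite normrM -mulrA mulrA [`|at_ _ _ _ * _|]ger0_norm ?mulr_ge0//.
      by rewrite ler_wpM2r ?mulr_ge0//; exact: phi_d.
  rewrite ler_wpM2l// /c.
  have : `|l (ind (alive t)) - q (ind (alive t)) h| <= 1 by near: h.
  rewrite ler_norml => /andP[+ _]; have := ler_norm (l (ind (alive t))); lra.
have d3 : `|l (phi_ n) - q (phi_ n) h| <= e / 2 by near: h.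
have := ler_distD (l (phi_ n)) (l phi) (q phi h).
have := ler_distD (q (phi_ n) h) (l (phi_ n)) (q phi h).
rewrite -/(l phi) -/(q phi h); move: nK d1 d2 d3; rewrite /K mulrDr.
move: (n.+1%:R^-1 * c) (n.+1%:R^-1 * _) => x y; lra.
Unshelve. all: by end_near. Qed.

End Rates.

(** * Observables of the process attached to test functions *)

Section Profile.
Variables (R : realType) (Lam : finType) (beta : Lam -> Lam -> R).
Local Notation upd v i t := (@dfwith _ (fun=> R) v i t).
Implicit Types (i j : Lam) (k : (Lam -> R) -> R) (l v : Lam -> R).

Definition envelope l : R := expR (2^-1 * \sum_i \sum_j beta i j * (1 - l i * l j)).

(* Inverse to the passage from g to K (l^2) = g (l) exp (- ...) / \prod l on
   the unit box; [sqabsv] extends l^2 so that test functions composed with it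
   vanish as soon as some l_j <= 0. *)
Definition profile k l : R := envelope l * ((\prod_j l j) * k (sqabsv l)).

(** This is [profile] without its factor l_i. The forward equation is applied to it at the vertex i:
    a jump from j to i has rate beta_ji l_i, which restores [profile]. *)
Definition profile_off i k l : R := envelope l * ((\prod_(j | j != i) l j) * k (sqabsv l)).

Lemma c1_exponent : c1 (fun l : Lam -> R => 2^-1 * \sum_i \sum_j beta i j * (1 - l i * l j)).
Proof.
apply: c1M; first exact: c1_cst.
apply: c1_sum => i; apply: c1_sum => j; apply: c1M; first exact: c1_cst.
rewrite (_ : (fun v => _) = fun v => 1 + (-1) * (v i * v j)); last first.
  by apply/funext => v; rewrite mulN1r.
apply: c1D; first exact: c1_cst.
by apply: c1M; [exact: c1_cst|apply: c1M; exact: c1_proj].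
Qed.

Lemma c1_envelope : c1 envelope.
Proof. exact: (c1_exp c1_exponent). Qed.

Lemma cts_profile k : cts k -> cts (profile k).
Proof.
move=> ck; apply: ctsM; first exact: c1_envelope.1.
by apply: ctsM; [apply: cts_prod => j; exact: cts_proj|exact: cts_sqabsv].
Qed.

Lemma c1_profile_off i k : test_fun k -> c1 (profile_off i (prims (enum Lam) k)).
Proof.
move=> tk; apply: c1M; first exact: c1_envelope.
by apply: c1M; [apply: c1_prod => j; exact: c1_proj|exact: c1_prims_sqabsv].
Qed.

Lemma profile_offM i k l : l i * profile_off i k l = profile k l.
Proof. by rewrite /profile /profile_off mulrCA [in RHS](bigD1 i)//= -[in RHS]mulrA. Qed.

Lemma profile_eq0 k l : test_fun k -> ~ (forall j, 0 < l j) ->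
  forall i, profile_off i k l = 0.
Proof.
move=> [_ [e e0 ke]] /existsNP[j /negP]; rewrite -leNgt => lj i.
rewrite /profile_off ke ?mulr0//; exists j.
by rewrite /sqabsv /sqabs (le_trans _ (ltW e0))// mulr_le0_ge0.
Qed.

Hypothesis beta_sym : forall i j, beta i j = beta j i.

Lemma drv_proj (v : Lam -> R) i j x : drv (fun t => upd v i t j) x (i == j)%:R.
Proof.
have [<-|ij] := eqVneq i j.
  by under eq_fun do rewrite dfwithin; exact: drv_id.
by under eq_fun do rewrite dfwithout//; exact: drv_cst.
Qed.

(** While X sits at i, l_i decreases at unit rate, and the envelope grows at the rate \sum_j beta_ij
    l_j. Up to the term j = i, this is the exit rate of the process. *)
Lemma envelope_derive v i x : drv (fun t => envelope (upd v i t)) x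
  (- (\sum_j beta i j * upd v i x j) * envelope (upd v i x)).
Proof.
set u := upd v i x.
have H : drv (fun t => 2^-1 * \sum_a \sum_b beta a b * (1 - upd v i t a * upd v i t b)) x
    (2^-1 * \sum_a \sum_b beta a b * (0 - ((i == a)%:R * u b + u a * (i == b)%:R))).
  apply: drvZ; apply: drv_sum => a; apply: drv_sum => b; apply: drvZ.
  by apply: drvD; [exact: drv_cst|apply: drvN; apply: drvM; exact: drv_proj].
apply: drv_eq (drv_comp (drv_expR _) H) _.
rewrite -/(envelope (upd v i x)) mulrC; congr (_ * _).
under eq_bigr do under eq_bigr do rewrite sub0r mulrN mulrDr opprD.
under eq_bigr do rewrite big_split/= !sumrN.
rewrite big_split/= !sumrN (bigD1 i)//= [X in - (_ + X)]big1 ?addr0; last first.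
  by move=> a ai; rewrite big1// => b _; rewrite eq_sym (negPf ai) mul0r mulr0.
have -> : \sum_a \sum_b beta a b * (u a * (i == b)%:R) = \sum_a beta i a * u a.
  apply: eq_bigr => a _; rewrite (bigD1 i)//= big1 ?addr0.
    by rewrite eqxx mulr1 beta_sym.
  by move=> b bi; rewrite eq_sym (negPf bi) !mulr0.
under eq_bigr do rewrite eqxx mul1r.
lra.
Qed.

Lemma profile_off_derive i k v x : test_fun k ->
  drv (fun t => profile_off i (prim i k) (upd v i t)) x
    (2 * profile k (upd v i x) -
     (\sum_j beta i j * upd v i x j) * profile_off i (prim i k) (upd v i x)).
Proof.
move=> tk; have := drv_prim_sqabsv i v x tk; set D := _ * (2 * _) => H1.
pose c := \prod_(j | j != i) v j.
have cE t : \prod_(j | j != i) upd v i t j = c.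
  by apply: eq_bigr => j ji; rewrite dfwithout// eq_sym.
have H2 := drvM (envelope_derive v i x) (drvZ c H1).
have -> : (fun t => profile_off i (prim i k) (upd v i t)) =
    fun t => envelope (upd v i t) * (c * prim i k (sqabsv (upd v i t))).
  by apply/funext => t; rewrite /profile_off cE.
apply: drv_eq H2 _.
rewrite -(profile_offM i) /profile_off !cE dfwithin.
(* The derivative of the signed square supplies the missing factor l_i; for x <= 0 the test function
   vanishes. *)
have kx : k (sqabsv (upd v i x)) * `|x| = k (sqabsv (upd v i x)) * x.
  have [x0|x0] := leP 0 x; first by rewrite ger0_norm.
  have [_ [e e0 ke]] := tk; rewrite ke ?mul0r//; exists i.
  by rewrite /sqabsv dfwithin /sqabs (le_trans _ (ltW e0))// mulr_le0_ge0// ltW.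
have -> : D = 2 * (k (sqabsv (upd v i x)) * x) by rewrite /D mulrCA kx.
ring.
Qed.

Lemma prims_prim i s k : cts k -> prims s (prim i k) = prim i (prims s k).
Proof.
move=> ck; elim: s => //= j s IH; rewrite IH primC//; exact: cts_prims.
Qed.

(** The profile vanishes unless all coordinates are positive, so only the values of k on the unit
    cube enter. *)
Lemma profile_bound : exists2 C, 0 <= C & forall k B l, test_fun k ->
  (forall s, unit_cube s -> `|k s| <= B) -> (forall j, l j <= 1) ->
  `|profile (prims (enum Lam) k) l| <= C * B.
Proof.
have [C C0 CP] := cts_bounded 1 c1_envelope.1.
exists C => // k B l tk kB l1.
have B0 : 0 <= B.
  by apply: le_trans (kB (fun=> 0) _) => // j; rewrite lexx ler01.
have [l0|l0] := pselect (forall j, 0 < l j).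
  rewrite /profile normrM ler_pM//.
    by apply: CP => j; rewrite ger0_norm// ltW.
  rewrite normrM -[leRHS]mul1r ler_pM//.
    rewrite normr_prod prodr_ile1// => j _.
    by rewrite normr_ge0/= ger0_norm// ltW.
  apply: prims_bound => // j; have lj0 := ltW (l0 j).
  by rewrite /sqabsv /sqabs ger0_norm// mulr_ge0//= mulr_ile1.
have /existsNP[i _] := l0.
rewrite -(profile_offM i) (profile_eq0 (test_prims _ tk) l0) mulr0 normr0.
exact: mulr_ge0.
Qed.

End Profile.

Section OneSided.
Variable R : realType.

Lemma continuous_right (f : R -> R) t : continuous f -> f (t + h) @[h --> 0^'+] --> f t.
Proof.
move=> cf; apply: cvg_at_right_filter.
have : t + h @[h --> (0 : R)] --> t + 0 by apply: cvgD; [exact: cvg_cst|exact: cvg_id].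
by rewrite addr0 => H; exact: (continuous_cvg _ (cf t) H).
Qed.

Lemma right_cvg_shift (f : R -> R) (t l : R) :
  f (t + h) @[h --> 0^'+] --> l -> f s @[s --> t^'+] --> l.
Proof.
move=> /cvgrPdist_le fl; apply/cvgrPdist_le => e /fl/nbhs_ballP[r /= r0 rP].
apply/nbhs_ballP; exists r => //= s ts st.
have E : t + (s - t) = s by ring.
have := rP (s - t); rewrite /ball/= sub0r normrN subr_gt0 E; apply => //.
by rewrite distrC.
Qed.

Lemma left_cvg_shift (f : R -> R) (t l : R) :
  f (t - h) @[h --> 0^'+] --> l -> f s @[s --> t^'-] --> l.
Proof.
move=> /cvgrPdist_le fl; apply/cvgrPdist_le => e /fl/nbhs_ballP[r /= r0 rP].
apply/nbhs_ballP; exists r => //= s ts st.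
have := rP (t - s); rewrite /ball/= sub0r normrN subr_gt0 subKr => H; exact: (H ts st).
Qed.

End OneSided.

(** * Drift along the paths *)

Section Evolution.
Context (R : realType) (Lam : finType) d (Omega : measurableType d).
Context (P : probability Omega R) (beta : Lam -> Lam -> R) (a : Lam) (X : R -> Omega -> Lam).
Hypothesis vd : is_vdjp P beta a (fun=> 1) X.
Implicit Types (r s t : R) (w : Omega) (i j k : Lam) (u g : (Lam -> R) -> R).
Local Notation upd v i t := (@dfwith _ (fun=> R) v i t).
Local Notation left_time := (left_time X).
Local Notation at_ := (at_ X).

Lemma Ex_right_cvg (f : R -> Omega -> R) f0 M :
  (forall h, 0 < h <= 1 -> measurable_fun setT (f h)) ->
  (forall h w, 0 < h <= 1 -> `|f h w| <= M) ->
  (forall w, f h w @[h --> 0^'+] --> f0 w) ->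
  Ex P (f h) @[h --> 0^'+] --> Ex P f0.
Proof.
move=> mf fM ff0; apply/cvg_at_rightP => hn [hn0 hn_cvg].
(* The bounds are assumed for h at most 1; the capped sequence eventually equals the given one. *)
pose v n := Num.min (hn n) 1.
have v01 n : 0 < v n <= 1 by rewrite /v lt_min hn0 ltr01 ge_min lexx orbT.
have hnv : \forall n \near \oo, v n = hn n.
  have /cvgrPdist_le/(_ 1 ltr01) := hn_cvg; apply: filterS => n.
  by rewrite sub0r normrN (gtr0_norm (hn0 n)) /v => ?; rewrite min_l.
have v_cvg : v n @[n --> \oo] --> 0.
  apply: cvg_trans hn_cvg; apply: near_eq_cvg.
  by apply: filterS hnv => n ->.
have : Ex P (f (v n)) @[n --> \oo] --> Ex P f0.
  apply: (@Ex_cvg _ _ _ _ _ _ M) => [n|w|n w]; [exact: mf| |exact: fM].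
  move/cvg_at_rightP: (ff0 w) => /(_ v); apply; split => // n.
  by have /andP[] := v01 n.
apply: cvg_trans; apply: near_eq_cvg.
by apply: filterS hnv => n ->.
Qed.

Lemma near_at t w : 0 <= t -> \forall h \near 0^'+, forall r, t <= r <= t + h -> X r w = X t w.
Proof.
move=> t0; have /nbhs_ballP[e /= e0 eP] := vdjp_right_continuous vd w t0.
near=> h; move=> r /andP[]; rewrite le_eqVlt => /predU1P[<-//|tr] rh.
have he : h < e by near: h; exact: nbhs_right_lt.
by apply: eP => //; rewrite /ball/= ltr0_norm; lra.
Unshelve. all: by end_near. Qed.

Lemma at_right_cvg i w t : 0 <= t -> at_ (t + h) i w @[h --> 0^'+] --> at_ t i w.
Proof.
move=> t0; apply: cvg_near_cst; near=> h; apply: at_eq.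
have h0 : 0 < h by near: h; exact: nbhs_right_gt.
suff H : forall r, t <= r <= t + h -> X r w = X t w by apply: H; rewrite lerDl ltW/=.
by near: h; exact: near_at.
Unshelve. all: by end_near. Qed.

(** X stays at i for a short time after t, during which the left times move only in the direction i,
    at speed -1. *)
Lemma path_right_derivative t w i u g : 0 <= t -> X t w = i ->
  (forall v x, drv (fun t => u (upd v i t)) x (g (upd v i x))) ->
  (u (left_time (t + h) w) - u (left_time t w)) / h @[h --> 0^'+] --> - g (left_time t w).
Proof.
move=> t0 Xi ug.
have H : drv (fun h => u (upd (left_time t w) i (left_time t w i - h))) 0 (- g (left_time t w)).
  have H1 : drv (fun h : R => left_time t w i - h) 0 (- 1).
    by apply: drv_eq (drvD (drv_cst _ _) (drvN (drv_id 0))) _; rewrite add0r.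
  apply: drv_eq (drv_comp (ug (left_time t w) _) H1) _.
  by rewrite subr0 updK mulrN1.
have [dH <-] := H.
have /cvg_dnbhs_at_right := dH.
apply: cvg_trans; apply: near_eq_cvg; near=> h.
have h0 : 0 < h by near: h; exact: nbhs_right_gt.
suff E : left_time (t + h) w = upd (left_time t w) i (left_time t w i - h).
  by rewrite E [RHS]mulrC /= subr0 updK addr0 /GRing.scale/= mulr1.
apply/funext => j; rewrite (@left_time_const _ _ _ _ _ _ _ _ vd t (t + h) w i j).
- have [<-|ij] := eqVneq i j; first by rewrite dfwithin mulr1; ring.
  by rewrite dfwithout// mulr0 subr0.
- by rewrite t0 lerDl ltW.
- move=> r /andP[tr rh]; rewrite -Xi; move: r tr rh.
  suff : forall r, t <= r <= t + h -> X r w = X t w.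
    by move=> H0 r tr rh; apply: H0; rewrite ltW.
  by near: h; exact: near_at.
Unshelve. all: by end_near. Qed.

Lemma left_time_lipschitz s t w j : 0 <= s -> 0 <= t ->
  `|left_time t w j - left_time s w j| <= `|t - s|.
Proof.
wlog st : s t / s <= t => [H s0 t0|s0 t0].
  have [/H|/ltW/H H'] := leP s t; first exact.
  by rewrite distrC [leRHS]distrC; exact: H'.
have /andP[h1 h2] := @left_time_diff _ _ _ _ _ _ _ _ vd s t w j (ltac:(by rewrite s0)).
by rewrite distrC ger0_norm// ger0_norm// subr_ge0.
Qed.

Lemma left_time_continuous w u : cts u ->
  continuous (fun t : R => u (left_time (Num.max 0 t) w) : R).
Proof.
move=> cu t; apply/cvgrPdist_le => e e0.
have [dl dl0 dP] := cu (1 + (Num.max 0 t + 1)) e e0.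
have t0 : 0 <= Num.max 0 t by rewrite le_max lexx.
have e1 : 0 < Num.min dl 1 by rewrite lt_min dl0 ltr01.
apply: filterS (near_dist t e1) => s; rewrite le_min => /andP[ts ts1].
have s0 : 0 <= Num.max 0 s by rewrite le_max lexx.
have D : `|Num.max 0 t - Num.max 0 s| <= `|t - s|.
  by rewrite /Num.max; case: ltP => h1; case: ltP => h2; rewrite ler_norml; apply/andP; split;
    have := ler_norm (t - s); have := ler_norm (- (t - s)); rewrite normrN; lra.
apply: dP.
- apply: boxW (left_time_box vd w t0); lra.
- apply: boxW (left_time_box vd w s0).
  have := ler_norm (- (Num.max 0 t - Num.max 0 s)); rewrite normrN; lra.
- move=> j; apply: le_trans ts; apply: le_trans D.
  exact: left_time_lipschitz.
Qed.

(** The right derivative along a path is always minus one of finitely many partial derivatives,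
    bounded on a box. The constant is uniform in w, as dominated convergence in [drift] demands. *)
Lemma path_lipschitz u T : c1 u -> 0 <= T -> exists2 C, 0 <= C &
  forall w s t, 0 <= s -> s <= t -> t <= T ->
    `|u (left_time t w) - u (left_time s w)| <= C * (t - s).
Proof.
move=> [cu du] T0.
have [g gP] : {g : Lam -> (Lam -> R) -> R & forall j, cts (g j) /\
    forall v x, drv (fun t => u (upd v j t)) x (g j (upd v j x))}.
  apply: (@choice Lam _ (fun j g => cts g /\
    forall v x, drv (fun t => u (upd v j t)) x (g (upd v j x)))) => j.
  by have [g cg gP] := du j; exists g.
have [B BP] : {B : Lam -> R & forall j, 0 <= B j /\
    forall v, box (1 + T) v -> `|g j v| <= B j}.
  apply: (@choice Lam R (fun j B => 0 <= B /\ forall v, box (1 + T) v -> `|g j v| <= B)) => j.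
  by have [B B0 BP] := cts_bounded (1 + T) (gP j).1; exists B.
have B0 j : 0 <= B j by have [] := BP j.
exists (\sum_j B j); first exact: sumr_ge0.
move=> w s t s0 st tT.
pose f r := u (left_time (Num.max 0 r) w).
have sgn (c : R) : `|c| = 1 -> c * (u (left_time t w) - u (left_time s w)) <=
    (\sum_j B j) * (t - s).
  move=> c1_.
  have := @dini_le R (fun r => c * f r) s t (\sum_j B j) st.
  rewrite -mulrBr /f !max_r// ?(le_trans s0)//; apply.
    by move=> r; apply: cvgM; [exact: cvg_cst|exact: left_time_continuous].
  move=> r /andP[sr rt] e e0.
  have r0 : 0 <= r by exact: le_trans sr.
  have /cvgrPdist_le/(_ e e0) H := path_right_derivative r0 (erefl (X r w)) (gP (X r w)).2.
  near=> h; have h0 : 0 < h by near: h; exact: nbhs_right_gt.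
  rewrite !max_r ?(addr_ge0 r0 (ltW h0))// -mulrBr -ler_pdivrMr// -mulrA.
  apply: le_trans (ler_norm _) _; rewrite normrM c1_ mul1r.
  have gB : `|g (X r w) (left_time r w)| <= \sum_j B j.
    apply: (@le_trans _ _ (B (X r w))).
      apply: (BP _).2; apply: boxW (left_time_box vd w r0); lra.
    by rewrite (bigD1 (X r w))//= lerDl sumr_ge0.
  have : `|- g (X r w) (left_time r w) - (u (left_time (r + h) w) - u (left_time r w)) / h| <= e.
    by near: h; exact: H.
  set q := _ / h; move: gB; set y := g _ _; rewrite -normrN => gB qe.
  have := ler_distD (- y) q 0; rewrite !subr0 [`|q - _|]distrC; lra.
rewrite ler_norml; apply/andP; split.
  by have := sgn (-1) (normrN1 _); lra.
by have := sgn 1 (normr1 _); lra.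
Unshelve. all: by end_near. Qed.

(** One half of the product rule. The indicator is taken at t + h so that in the other half,
    [jumps], the function of the left times is taken at t and belongs to the past. *)
Lemma drift t i u g : c1 u -> cts g -> 0 <= t ->
  (forall v x, drv (fun t => u (upd v i t)) x (g (upd v i x))) ->
  Ex P (fun w => at_ (t + h) i w * (u (left_time (t + h) w) - u (left_time t w))) / h
    @[h --> 0^'+] --> - Ex P (fun w => at_ t i w * g (left_time t w)).
Proof.
move=> cu cg t0 ug.
have [C C0 CP] := path_lipschitz cu (ltac:(lra) : 0 <= t + 1).
have -> : - Ex P (fun w => at_ t i w * g (left_time t w)) =
    Ex P (fun w => at_ t i w * - g (left_time t w)).
  rewrite -mulN1r -ExZ; last first.
    by apply: bmfM; [exact: (bmf_at vd)|exact: (bmf_path vd)].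
  by congr Ex; apply/funext => w; rewrite mulN1r mulrN.
have bF h : 0 < h -> bmf (fun w => at_ (t + h) i w *
    (u (left_time (t + h) w) - u (left_time t w))).
  move=> h0; have th0 : 0 <= t + h by rewrite addr_ge0// ltW.
  by apply: bmfM; [exact: (bmf_at vd)|apply: bmfB; apply: (bmf_path vd) => //; exact: cu.1].
have : Ex P (fun w => h^-1 * (at_ (t + h) i w *
    (u (left_time (t + h) w) - u (left_time t w)))) @[h --> 0^'+] -->
    Ex P (fun w => at_ t i w * - g (left_time t w)).
  apply: (@Ex_right_cvg _ _ C).
  - by move=> h /andP[h0 _]; exact: (bmfZ _ (bF h h0)).1.
  - move=> h w /andP[h0 h1].
    rewrite normrM normrM mulrCA -[leRHS]mul1r ler_pM ?mulr_ge0//; first exact: at_norm.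
    rewrite gtr0_norm ?invr_gt0// mulrC ler_pdivrMr//.
    have := CP w t (t + h) t0; rewrite lerDl lerD2l (ltW h0) h1 => /(_ erefl erefl).
    by rewrite [t + _]addrC addrK.
  move=> w.
  have cat : at_ (t + h) i w @[h --> 0^'+] --> at_ t i w by exact: at_right_cvg.
  have [Xi|Xi] := pselect (X t w = i).
    rewrite (_ : (fun h => _) = fun h => at_ (t + h) i w *
      ((u (left_time (t + h) w) - u (left_time t w)) / h)); last first.
      by apply/funext => h; rewrite mulrC mulrA.
    by apply: cvgM; [exact: cat|exact: (path_right_derivative t0 Xi ug)].
  rewrite (at_neq Xi) mul0r.
  have /cvgrPdist_lt/(_ 1 ltr01) := cat; rewrite (at_neq Xi) => cat0.
  apply: cvg_near_cst; near=> h.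
  have : `|0 - at_ (t + h) i w| < 1 by near: h.
  by rewrite sub0r normrN => /at_lt1 ->; rewrite mul0r mulr0.
apply: cvg_trans; apply: near_eq_cvg; near=> h.
by rewrite ExZ 1?mulrC//; apply: bF; near: h; exact: nbhs_right_gt.
Unshelve. all: by end_near. Qed.

End Evolution.

(** * The forward equation *)

Section KolmogorovForward.
Context (R : realType) (Lam : finType) d (Omega : measurableType d).
Context (P : probability Omega R) (beta : Lam -> Lam -> R) (a : Lam) (X : R -> Omega -> Lam).
Hypothesis vd : is_vdjp P beta a (fun=> 1) X.
Hypothesis beta_sym : forall i j, beta i j = beta j i.
Implicit Types (r s t : R) (w : Omega) (i j : Lam) (k F : (Lam -> R) -> R).
Local Notation left_time := (left_time X).
Local Notation at_ := (at_ X).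

Lemma sum_at t w : \sum_j at_ t j w = 1.
Proof.
rewrite (bigD1 (X t w))//= at_self big1 ?addr0// => j jX.
by apply: at_neq => Xj; rewrite Xj eqxx in jX.
Qed.

(** Gain minus loss: rates are prescribed only for jumps between distinct vertices. *)
Lemma jump_difference s t i w : at_ s i w - at_ t i w =
  \sum_(j | j != i) at_ t j w * at_ s i w - \sum_(j | j != i) at_ t i w * at_ s j w.
Proof.
rewrite -mulr_suml -mulr_sumr.
have E r : \sum_(j | j != i) at_ r j w = 1 - at_ r i w.
  by rewrite -(sum_at r w) [X in X - _](bigD1 i)//= [X in X - _]addrC addrK.
by rewrite !E; ring.
Qed.

Definition occupation F t i : R := Ex P (fun w => at_ t i w * F (left_time t w)).

Lemma bmf_occupation F t i : cts F -> 0 <= t ->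
  bmf (fun w => at_ t i w * F (left_time t w)).
Proof. by move=> cF t0; apply: bmfM; [exact: (bmf_at vd)|exact: (bmf_path vd)]. Qed.

Lemma jumps F t i : cts F -> 0 <= t -> (forall l, ~ (forall j, 0 < l j) -> F l = 0) ->
  Ex P (fun w => (at_ (t + h) i w - at_ t i w) * F (left_time t w)) / h @[h --> 0^'+] -->
  \sum_(j | j != i) beta j i * occupation (fun l => l i * F l) t j -
  \sum_(j | j != i) beta i j * occupation (fun l => l j * F l) t i.
Proof.
move=> cF t0 F0.
pose f w := F (left_time t w).
have bf : bmf f by exact: (bmf_path vd).
have fP i1 i2 : i1 != i2 ->
    Ex P (fun w => f w * at_ t i1 w * at_ (t + h) i2 w) / h @[h --> 0^'+] -->
    beta i1 i2 * occupation (fun l => l i2 * F l) t i1.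
  move=> i12; have [M fM] := bf.2.
  have := @rates_weighted _ _ _ _ _ _ _ _ vd t f M i1 i2 t0 i12; move=> /(_ _ fM).
  rewrite (_ : Ex P (fun w => _ * left_time t w i2) = occupation (fun l => l i2 * F l) t i1).
    apply.
    - by apply: (@measurable_cts _ _ (past X t)) cF => j; exact: (past_measurable_left_time vd).
    - by move=> w wa; exact: F0.
  by congr Ex; apply/funext => w; rewrite /f; ring.
have : \sum_(j | j != i) Ex P (fun w => f w * at_ t j w * at_ (t + h) i w) / h -
    \sum_(j | j != i) Ex P (fun w => f w * at_ t i w * at_ (t + h) j w) / h @[h --> 0^'+] -->
  \sum_(j | j != i) beta j i * occupation (fun l => l i * F l) t j -
  \sum_(j | j != i) beta i j * occupation (fun l => l j * F l) t i.
  have S (g : Lam -> R -> R) (l : Lam -> R) :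
      (forall j, j != i -> g j h @[h --> 0^'+] --> l j) ->
      \sum_(j | j != i) g j h @[h --> 0^'+] --> \sum_(j | j != i) l j.
    move=> gl; elim: (index_enum _) => [|j r IH].
      by rewrite big_nil; under eq_fun do rewrite big_nil; exact: cvg_cst.
    rewrite big_cons; under eq_fun do rewrite big_cons.
    by case: ifPn => // ji; apply: cvgD => //; exact: gl.
  by apply: cvgB; apply: S => j ji; apply: fP => //; rewrite eq_sym.
apply: cvg_trans; apply: near_eq_cvg; near=> h.
have h0 : 0 <= t + h by rewrite addr_ge0//; near: h; exact: nbhs_right_ge.
have bb i1 i2 : bmf (fun w => f w * at_ t i1 w * at_ (t + h) i2 w).
  by apply: bmfM; [apply: bmfM => //|]; exact: (bmf_at vd).
rewrite -!mulr_suml -mulrBl -!Ex_sum//; congr (_ / _).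
rewrite -ExB//; try exact: bmf_sum.
congr Ex; apply/funext => w; rewrite jump_difference mulrBl !mulr_suml.
by congr (_ - _); apply: eq_bigr => j _; rewrite /f; ring.
Unshelve. all: by end_near. Qed.

Lemma occupation_right F t i : cts F -> 0 <= t ->
  occupation F s i @[s --> t^'+] --> occupation F t i.
Proof.
move=> cF t0; apply: right_cvg_shift; have [B B0 BP] := cts_bounded (1 + (t + 1)) cF.
apply: (@Ex_right_cvg _ _ _ P _ _ B).
- move=> h /andP[h0 h1].
  exact: (bmf_occupation i cF (addr_ge0 t0 (ltW h0))).1.
- move=> h w /andP[h0 h1]; rewrite normrM -[leRHS]mul1r ler_pM//; first exact: at_norm.
  apply: BP; apply: boxW (left_time_box vd w (addr_ge0 t0 (ltW h0))); lra.
- move=> w; apply: cvgM; first exact: (at_right_cvg vd).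
  have cw : continuous (fun s : R => F (left_time (Num.max 0 s) w) : R).
    exact: (left_time_continuous vd cF).
  have := @continuous_right _ _ t cw; rewrite (max_r t0).
  apply: cvg_trans; apply: near_eq_cvg; near=> h.
  by rewrite max_r// addr_ge0//; near: h; exact: nbhs_right_ge.
Unshelve. all: by end_near. Qed.

(** A path may jump at t, so left continuity holds in mean only: the absence of fixed jumps makes
    the probability that X differs at s and t tend to 0. *)
Lemma occupation_left F t i : cts F -> 0 < t ->
  occupation F s i @[s --> t^'-] --> occupation F t i.
Proof.
move=> cF t0; have t0' := ltW t0; have [B B0 BP] := cts_bounded (1 + t) cF.
have FB r w : 0 <= r <= t -> `|F (left_time r w)| <= B.
  move=> /andP[r0 rt]; apply: BP; apply: boxW (left_time_box vd w r0); lra.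
pose N s := [set w | X s w <> X t w].
pose D s w := `|F (left_time (Num.max 0 s) w) - F (left_time t w)|.
have mN s : 0 <= s -> measurable (N s).
  move=> s0; rewrite (_ : N s = \big[setU/set0]_(i <- enum Lam)
     ([set w | X s w = i] `\` [set w | X t w = i])).
    by apply: bigsetU_measurable => j _; apply: measurableD; exact: (measurable_at vd).
  rewrite -bigcup_seq; apply/seteqP; split => [w wN|w [j _] [/= <-]].
    by exists (X s w); rewrite /= ?mem_enum//; split => // /esym.
  by move=> /nesym.
have cD : Ex P (D s) @[s --> t^'-] --> (0 : R).
  apply: left_cvg_shift.
  suff : Ex P (D (t - h)) @[h --> 0^'+] --> Ex P (fun=> 0) by rewrite Ex_cst.
  apply: (@Ex_right_cvg _ _ _ P _ _ (B + B)).
  - move=> h _; apply: measurableT_comp; first exact: normr_measurable.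
    by apply: measurable_funB; apply: (bmf_path vd cF _).1 => //; rewrite le_max lexx.
  - move=> h w /andP[h0 _]; rewrite /D normr_id (le_trans (ler_normB _ _))// lerD ?FB ?t0' ?lexx//.
    by rewrite le_max lexx/= ge_max t0' gerBl ltW.
  - move=> w; rewrite /D.
    have c : continuous (fun s : R => `|F (left_time (Num.max 0 (t - s)) w) - F (left_time t w)|).
      move=> s; apply: cvg_norm; apply: cvgB; last exact: cvg_cst.
      have cw : continuous (fun s : R => F (left_time (Num.max 0 s) w) : R).
        exact: (left_time_continuous vd cF).
      apply: (continuous_cvg _ (cw (t - s))).
      by apply: cvgB; [exact: cvg_cst|exact: cvg_id].
    have := @continuous_right _ _ 0 c; rewrite subr0 (max_r t0') subrr normr0.
    by under eq_fun do rewrite add0r.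
have cN : fine (P (N s)) @[s --> t^'-] --> (0 : R).
  exact: (fine_cvg (vdjp_no_fixed_jump vd t0)).
apply/cvgrPdist_le => e e0.
have e4 : 0 < e / 2 by rewrite divr_gt0.
have eB : 0 < e / (2 * (B + 1)) by rewrite divr_gt0// mulr_gt0// ltr_wpDl.
have /cvgrPdist_le/(_ _ e4) hD := cD.
have /cvgrPdist_le/(_ _ eB) hN := cN.
near=> s.
have s0 : 0 <= s by near: s; exact: nbhs_left_ge.
have st : s <= t by near: s; exact: nbhs_left_le.
have D1 : `|0 - Ex P (D s)| <= e / 2 by near: s.
have N1 : `|0 - fine (P (N s))| <= e / (2 * (B + 1)) by near: s.
have bD : bmf (D s).
  split; last first.
    exists (B + B) => w; rewrite /D normr_id (max_r s0) (le_trans (ler_normB _ _))//.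
    by rewrite lerD// FB ?s0 ?t0' ?lexx.
  apply: measurableT_comp; first exact: normr_measurable.
  by apply: measurable_funB; apply: (bmf_path vd cF _).1 => //; rewrite le_max lexx.
have bN : bmf (ind R (N s)) by apply: bmf_ind; exact: mN.
rewrite /occupation -ExB; try exact: bmf_occupation.
(* F varies by D, and the indicator changes only on [N s], where F is bounded by B. *)
apply: (@le_trans _ _ (Ex P (fun w => D s w + B * ind R (N s) w))).
  apply: Ex_norm.
  - by apply: bmfB; exact: bmf_occupation.
  - by apply: bmfD => //; exact: bmfZ.
  move=> w; rewrite /D (max_r s0) /ind indicE.
  case: (boolP (w \in N s)) => [_|]; last first.
    rewrite notin_setE => /contrapT Xst; rewrite (at_eq _ Xst) mulr0 addr0 -mulrBr normrM.
    by rewrite distrC -[leRHS]mul1r ler_wpM2r// at_norm.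
  rewrite mulr1.
  have at01 r : 0 <= at_ r i w <= 1.
    by have [<-|/at_neq ->] := pselect (X r w = i); rewrite ?at_self ?lexx ?ler01.
  rewrite (_ : _ - _ = at_ s i w * (F (left_time t w) - F (left_time s w)) +
    (at_ t i w - at_ s i w) * F (left_time t w)); last by ring.
  rewrite (le_trans (ler_normD _ _))// !normrM lerD//.
    by rewrite [leRHS]distrC -[leRHS]mul1r ler_wpM2r// at_norm.
  rewrite -[leRHS]mul1r ler_pM ?FB ?t0' ?lexx//.
  have /andP[u1 u2] := at01 s; have /andP[u3 u4] := at01 t.
  by rewrite ler_norml; apply/andP; split; lra.
rewrite ExD//; last exact: bmfZ.
rewrite ExZ// Ex_ind; last exact: mN.
move: D1 N1; rewrite !sub0r !normrN => /(le_trans (ler_norm _)) D1 /(le_trans (ler_norm _)).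
rewrite ler_pdivlMr; last by rewrite mulr_gt0// ltr_wpDl.
have : 0 <= fine (P (N s)) by rewrite fine_ge0.
nra.
Unshelve. all: by end_near. Qed.

Lemma occupation_continuous F i : cts F ->
  continuous (fun t : R => occupation F (Num.max 0 t) i : R).
Proof.
move=> cF t; apply/left_right_continuousP.
have [t0|t0|t0] := ltgtP t 0.
- split; apply: cvg_near_cst; near=> s; rewrite max_l//.
    by apply: le_trans (ltW t0); near: s; exact: nbhs_left_le.
  near: s; exact: nbhs_right_le.
- split.
    have := occupation_left (i := i) cF t0; apply: cvg_trans.
    apply: near_eq_cvg; near=> s; rewrite max_r//; near: s; exact: nbhs_left_ge.
  have := occupation_right (i := i) cF (ltW t0); apply: cvg_trans.
  apply: near_eq_cvg; near=> s; rewrite max_r// (le_trans (ltW t0))//.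
- rewrite t0; split.
    apply: cvg_near_cst; near=> s; rewrite max_l//; near: s; exact: nbhs_left_le.
  have := occupation_right (i := i) cF (lexx 0); apply: cvg_trans.
  apply: near_eq_cvg; near=> s; rewrite max_r//; near: s; exact: nbhs_right_ge.
Unshelve. all: by end_near. Qed.

Lemma occupationD F1 F2 t i : cts F1 -> cts F2 -> 0 <= t ->
  occupation (fun l => F1 l + F2 l) t i = occupation F1 t i + occupation F2 t i.
Proof.
move=> c1 c2 t0; rewrite /occupation -ExD; try exact: bmf_occupation.
by congr Ex; apply/funext => w; rewrite mulrDr.
Qed.

Lemma occupationZ c F t i : cts F -> 0 <= t ->
  occupation (fun l => c * F l) t i = c * occupation F t i.
Proof.
move=> c1 t0; rewrite /occupation -ExZ; last exact: bmf_occupation.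
by congr Ex; apply/funext => w; rewrite mulrCA.
Qed.

Lemma occupation_sum (I : finType) (c : I -> R) (F : I -> (Lam -> R) -> R) t i :
  (forall x, cts (F x)) -> 0 <= t ->
  occupation (fun l => \sum_x c x * F x l) t i = \sum_x c x * occupation (F x) t i.
Proof.
move=> cF t0; transitivity (\sum_x occupation (fun l => c x * F x l) t i).
  rewrite /occupation -Ex_sum; last by move=> x; apply: (@bmf_occupation (fun l => c x * F x l)) => //; exact: ctsZ.
  by congr Ex; apply/funext => w; rewrite mulr_sumr.
by apply: eq_bigr => x _; rewrite occupationZ.
Qed.

(** The drift of the envelope cancels the loss by jumps, except for its term j = i, which completes
    the gain by jumps to a sum over all j. The drift of the test function gives the last term. *)
Lemma occupation_derive k t i : test_fun k -> 0 <= t ->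
  let K := prims (enum Lam) k in let K' := prims (enum Lam) (prim i k) in
  let phi t := occupation (profile_off beta i K') t i in
  (phi (t + h) - phi t) / h @[h --> 0^'+] -->
  \sum_j beta i j * occupation (profile beta K') t j - 2 * occupation (profile beta K) t i.
Proof.
move=> tk t0 K K' phi.
have tK : test_fun K by exact: test_prims.
have tK' : test_fun K' by apply: test_prims; exact: test_prim.
have K'E : K' = prim i K by apply: prims_prim; exact: tk.1.
pose U := profile_off beta i K'.
have cU : c1 U by apply: c1_profile_off; exact: test_prim.
pose g l := 2 * profile beta K l - (\sum_j beta i j * l j) * U l.
have cp : cts (profile beta K) by apply: cts_profile; exact: tK.1.
have cs : cts (fun l => \sum_j beta i j * l j) by apply: cts_sum => j; apply: ctsZ; exact: cts_proj.
have cg : cts g by apply: ctsB; [exact: ctsZ|apply: ctsM => //; exact: cU.1].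
have ug v x : drv (fun t => U (@dfwith _ (fun=> R) v i t)) x (g (@dfwith _ (fun=> R) v i x)).
  by have := profile_off_derive beta_sym i v x tK; rewrite -K'E.
have cj j : cts (fun l => l j * U l) by apply: ctsM; [exact: cts_proj|exact: cU.1].
have : Ex P (fun w => at_ (t + h) i w * (U (left_time (t + h) w) - U (left_time t w))) / h +
    Ex P (fun w => (at_ (t + h) i w - at_ t i w) * U (left_time t w)) / h @[h --> 0^'+] -->
    - Ex P (fun w => at_ t i w * g (left_time t w)) +
   (\sum_(j | j != i) beta j i * occupation (fun l => l i * U l) t j -
    \sum_(j | j != i) beta i j * occupation (fun l => l j * U l) t i).
  apply: cvgD; first exact: (drift vd cU cg t0 ug).
  exact: (@jumps U t i cU.1 t0 (fun l l0 => profile_eq0 beta tK' l0 i)).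
have -> : - Ex P (fun w => at_ t i w * g (left_time t w)) +
   (\sum_(j | j != i) beta j i * occupation (fun l => l i * U l) t j -
    \sum_(j | j != i) beta i j * occupation (fun l => l j * U l) t i) =
   \sum_j beta i j * occupation (profile beta K') t j - 2 * occupation (profile beta K) t i.
  have -> : Ex P (fun w => at_ t i w * g (left_time t w)) = 2 * occupation (profile beta K) t i +
      (-1) * \sum_j beta i j * occupation (fun l => l j * U l) t i.
    rewrite -occupation_sum// -!occupationZ//; last first.
      by apply: cts_sum => j; exact: ctsZ.
    rewrite -occupationD//; [|exact: ctsZ|by apply: ctsZ; apply: cts_sum => j; exact: ctsZ].
    rewrite /occupation; congr Ex; apply/funext => w; congr (_ * _).
    rewrite /g mulN1r mulr_suml; congr (_ - _).
    by apply: eq_bigr => j _; rewrite mulrA.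
  have E j : occupation (fun l => l i * U l) t j = occupation (profile beta K') t j.
    by congr Ex; apply/funext => w; rewrite profile_offM.
  have alg (p : R) (x y y' : Lam -> R) : (forall j, y' j = y j) -> x i = y' i ->
      - (2 * p + -1 * \sum_j beta i j * x j) +
      (\sum_(j | j != i) beta j i * y' j - \sum_(j | j != i) beta i j * x j) =
      \sum_j beta i j * y j - 2 * p.
    move=> yy xy; have -> : \sum_(j | j != i) beta j i * y' j = \sum_(j | j != i) beta i j * y j.
      by apply: eq_bigr => j _; rewrite yy beta_sym.
    rewrite (bigD1 i)//= [in RHS](bigD1 i)//= xy yy; ring.
  exact: (alg _ (fun j => occupation (fun l => l j * U l) t i) _
    (fun j => occupation (fun l => l i * U l) t j) E erefl).
apply: cvg_trans; apply: near_eq_cvg; near=> h.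
have th : 0 <= t + h by rewrite addr_ge0//; near: h; exact: nbhs_right_ge.
rewrite -[LHS]/(_ / _ + _ / _) -mulrDl; congr (_ / _).
have b1 s : 0 <= s -> bmf (fun w => at_ s i w) by move=> s0; exact: (bmf_at vd).
have b2 s : 0 <= s -> bmf (fun w => U (left_time s w)).
  by move=> s0; apply: (bmf_path vd) => //; exact: cU.1.
rewrite /phi /occupation -ExB; try by apply: bmfM; [exact: b1|exact: b2].
rewrite -ExD.
- by congr Ex; apply/funext => w; rewrite -/U; ring.
- by apply: bmfM; [exact: b1|apply: bmfB; exact: b2].
- by apply: bmfM; [apply: bmfB; exact: b1|exact: b2].
Unshelve. all: by end_near. Qed.

End KolmogorovForward.

(** * The time-integrated identity for the process *)

Section ProcessWard.
Context (R : realType) (Lam : finType) d (Omega : measurableType d).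
Context (P : probability Omega R) (beta : Lam -> Lam -> R) (a : Lam) (X : R -> Omega -> Lam).
Hypothesis vd : is_vdjp P beta a (fun=> 1) X.
Hypothesis beta_sym : forall i j, beta i j = beta j i.
Implicit Types (r s t : R) (w : Omega) (i j : Lam) (k F : (Lam -> R) -> R).
Local Notation left_time := (left_time X).
Local Notation at_ := (at_ X).
Local Notation occupation := (occupation P X).

(** Later times contribute nothing: some left time is then exhausted, and the profile vanishes. *)
Definition process_corr i k : R :=
  rint 0 #|Lam|%:R (fun t => occupation (profile beta (prims (enum Lam) k)) t i).

Let T : R := #|Lam|%:R.

Lemma process_corrE i k : process_corr i k =
  rint 0 T (fun t => occupation (profile beta (prims (enum Lam) k)) (Num.max 0 t) i).
Proof. by apply: eq_rint => t /andP[t0 _]; rewrite max_r. Qed.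

(** The forward equation integrated over time. The value at time 0, where X is at a and all left
    times are 1, is the inhomogeneous term. *)
Lemma process_ward i k : test_fun k ->
  2 * process_corr i k = \sum_j beta i j * process_corr j (prim i k) +
    (a == i)%:R * prims (enum Lam) (prim i k) (fun=> 1).
Proof.
move=> tk; pose K := prims (enum Lam) k; pose K' := prims (enum Lam) (prim i k).
have tK : test_fun K by exact: test_prims.
have tK' : test_fun K' by apply: test_prims; exact: test_prim.
have T0 : 0 <= T by rewrite /T.
have cp F : test_fun F -> cts (profile beta F) by move=> [cF _]; exact: cts_profile.
have cU : cts (profile_off beta i K') by apply: (c1_profile_off _ _ _).1; exact: test_prim.
pose c0 F j t := occupation F (Num.max 0 t) j.
have cc F j : cts F -> continuous (c0 F j) by move=> cF; exact: (occupation_continuous vd).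
have c1 j : continuous (fun t => beta i j * c0 (profile beta K') j t).
  by move=> t; apply: cvgM; [exact: cvg_cst|apply: cc; exact: cp].
have c2 : continuous (fun t => 2 * c0 (profile beta K) i t).
  by move=> t; apply: cvgM; [exact: cvg_cst|apply: cc; exact: cp].
have [S1 S2] := @rint_sum R Lam (index_enum Lam) 0 T
  (fun j t => beta i j * c0 (profile beta K') j t) c1.
have c3 : continuous (fun t => \sum_j beta i j * c0 (profile beta K') j t -
    2 * c0 (profile beta K) i t) by move=> t; apply: cvgB; [exact: S2|exact: c2].
have c4 : continuous (c0 (profile_off beta i K') i) by exact: cc.
have pd t : 0 <= t < T -> (c0 (profile_off beta i K') i (t + h) -
    c0 (profile_off beta i K') i t) / h @[h --> 0^'+] -->
    \sum_j beta i j * c0 (profile beta K') j t - 2 * c0 (profile beta K) i t.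
  move=> /andP[t0 _]; have := @occupation_derive _ _ _ _ _ _ _ _ vd beta_sym k t i tk t0.
  rewrite /c0 (max_r t0); apply: cvg_trans; apply: near_eq_cvg; near=> h.
  by rewrite max_r// addr_ge0//; near: h; exact: nbhs_right_ge.
have := @right_FTC R _ _ 0 T T0 c4 c3 pd.
rewrite rintB//.
rewrite S1 rintZ; last by apply: cc; exact: cp.
have -> : \sum_j rint 0 T (fun t => beta i j * c0 (profile beta K') j t) =
    \sum_j beta i j * process_corr j (prim i k).
  by apply: eq_bigr => j _; rewrite rintZ ?process_corrE//; apply: cc; exact: cp.
have -> : rint 0 T (c0 (profile beta K) i) = process_corr i k by rewrite process_corrE.
(* At time #|Lam| the left times sum to 0, so they cannot all be positive; a witnesses that there is
   a vertex. *)
have -> : c0 (profile_off beta i K') i T = 0.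
  rewrite /c0 max_r// -[RHS](Ex_cst P); congr Ex; apply/funext => w.
  rewrite (profile_eq0 beta tK') ?mulr0// => Lp.
  have := sum_left_time vd w T0; rewrite /T subrr => /eqP.
  rewrite psumr_eq0; last by move=> j _; exact: ltW.
  by move=> /allP/(_ a); rewrite mem_index_enum => /(_ isT); rewrite /= gt_eqF.
have -> : c0 (profile_off beta i K') i 0 = (a == i)%:R * K' (fun=> 1).
  rewrite /c0 maxxx -[RHS](Ex_cst P); congr Ex; apply/funext => w.
  have -> : left_time 0 w = fun=> 1 by apply/funext => j; exact: left_time0.
  have -> : at_ 0 i w = (a == i)%:R.
    have [<-|/eqP ai] := eqVneq a i; last by apply: at_neq; rewrite (vdjp_start vd).
    by rewrite -(vdjp_start vd w) at_self.
  congr (_ * _).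
  rewrite /profile_off /envelope big1 => [|j _]; last first.
    by rewrite big1// => j' _; rewrite mulr1 subrr mulr0.
  rewrite mulr0 expR0 mul1r big1 ?mul1r//; congr K'.
  by apply/funext => j; rewrite /sqabsv /sqabs normr1 mulr1.
rewrite -/K' sub0r => /eqP; rewrite subr_eq addrC -subr_eq opprK => /eqP <-.
exact: erefl.
Unshelve. all: by end_near. Qed.

Lemma process_corr_bound : exists C : R, forall i k (B : R), test_fun k ->
  (forall s : Lam -> R, unit_cube s -> `|k s| <= B) -> `|process_corr i k| <= C * B.
Proof.
have [C C0 CP] := profile_bound beta.
exists (C * T) => i k B tk kB; rewrite process_corrE.
have cp : cts (profile beta (prims (enum Lam) k)) by apply: cts_profile; exact: (test_prims _ tk).1.
have co := occupation_continuous vd (i := i) cp.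
have := @rint_bound R 0 T _ (C * B) (ler0n _ _) co.
rewrite subr0 mulrAC; apply => t /andP[t0 _]; rewrite (max_r t0).
apply: Ex_bound; first exact: (bmf_occupation vd).
move=> w; rewrite normrM -[leRHS]mul1r ler_pM ?at_norm//; apply: CP => // j.
have /andP[+ _] := @left_time_diff _ _ _ _ _ _ _ _ vd 0 t w j (ltac:(by rewrite lexx)).
by rewrite left_time0 subr_ge0.
Qed.

End ProcessWard.

(** * Calculus on open sets and functional calculus *)

Section LocalCalculus.
Variables (R : realType) (J : finType).
Local Notation upd v i t := (@dfwith _ (fun=> R) v i t).
Implicit Types (U V : set (J -> R)) (f g : (J -> R) -> R) (u v : J -> R) (i j : J).

Definition close d u v : Prop := forall j, `|u j - v j| <= d.

Definition is_open U : Prop :=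
  forall v, U v -> exists2 d : R, 0 < d & forall u, close d v u -> U u.

Definition continuous_pt f v : Prop :=
  forall e : R, 0 < e -> exists2 d : R, 0 < d & forall u, close d v u -> `|f v - f u| <= e.

(** Connects the product topology, in which smoothness and compactness are stated, with explicit
    distances; this relies on J being finite. *)
Lemma ptws_nbhsP (p : {ptws J -> R}) (A : set {ptws J -> R}) :
  nbhs p A <-> exists2 d : R, 0 < d & forall u, close d p u -> A u.
Proof.
split; last first.
  move=> [e e0 eA].
  have : \forall u \near p, forall j, `|p j - (u : J -> R) j| <= e.
    apply: (@filter_forall _ J (fun j (u : {ptws J -> R}) => `|p j - u j| <= e)
      (nbhs p) (nbhs_filter p)) => j.
    have H : (fun u : {ptws J -> R} => u j : R) u @[u --> p] --> (p j : R).
      exact: (@proj_continuous J (fun=> (R : topologicalType)) j p).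
    by move/cvgrPdist_le: H; apply.
  by apply: (@filterS _ (nbhs p) (nbhs_filter p)) => u; exact: eA.
pose F : set_system {ptws J -> R} :=
  filter_from [set d : R | 0 < d] (fun d => [set u | close d p u]).
have FF : Filter F.
  apply: filter_from_filter; first by exists 1; exact: ltr01.
  move=> d1 d2 /= d10 d20; exists (Num.min d1 d2); first by rewrite /= lt_min d10.
  by move=> u pu; split => j; apply: le_trans (pu j) _; rewrite ge_min lexx ?orbT.
suff : F --> p by apply.
apply/cvg_sup => j.
have surj : (fun u : J -> R => u j) @` setT = setT.
  by apply/seteqP; split => // y _; exists (fun=> y).
apply/cvg_image => // A0 /nbhs_ballP[e /= e0 eA].
exists ((fun u : J -> R => u j) @^-1` A0); last by rewrite image_preimage.
exists (e / 2); first by rewrite /= divr_gt0.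
move=> u pu; apply: eA; rewrite /ball/=; apply: le_lt_trans (pu j) _.
by rewrite ltr_pdivrMr// ltr_pMr// ltr1n.
Qed.

(* Of class C^n on U, for the topology given by [close]. *)
Fixpoint diffn n U f : Prop :=
  (forall v, U v -> continuous_pt f v) /\
  if n is n'.+1 then forall j, exists2 g, diffn n' U g &
    forall v, U v -> drv (fun t => f (upd v j t)) (v j) (g v)
  else True.

Lemma diffn_continuous n U f v : diffn n U f -> U v -> continuous_pt f v.
Proof. by case: n => [|n] [cf _]; exact: cf. Qed.

Lemma diffnW n U f : diffn n.+1 U f -> diffn n U f.
Proof.
elim: n f => [|n IH] f [cf df]; split => // j.
by have [g dg gP] := df j; exists g => //; exact: IH.
Qed.

Lemma diffn_subset n U V f : U `<=` V -> diffn n V f -> diffn n U f.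
Proof.
move=> UV; elim: n f => [|n IH] f [cf df]; split => //; try by move=> v /UV; exact: cf.
by move=> j; have [g dg gP] := df j; exists g; [exact: IH|move=> v /UV; exact: gP].
Qed.

Lemma near_upd U v j : is_open U -> U v -> \forall t \near v j, U (upd v j t).
Proof.
move=> oU /oU[e e0 eU]; apply: filterS (near_dist (v j) e0) => t vt.
apply: eU => i; have [->|ij] := eqVneq i j; first by rewrite dfwithin.
by rewrite dfwithout 1?eq_sym// subrr normr0 ltW.
Qed.

Lemma drv_near (f g : R -> R) x a : (\forall t \near x, f t = g t) ->
  drv f x a -> drv g x a.
Proof. exact: near_eq_is_derive. Qed.

Lemma diffn_ext n U f g : is_open U -> (forall v, U v -> f v = g v) ->
  diffn n U f -> diffn n U g.
Proof.
move=> oU fg.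
have C : (forall v, U v -> continuous_pt f v) -> forall v, U v -> continuous_pt g v.
  move=> cf v Uv e e0; have [d1 d10 d1P] := cf v Uv e e0; have [d2 d20 d2P] := oU v Uv.
  exists (Num.min d1 d2); first by rewrite lt_min d10.
  move=> u vu; rewrite -!fg//.
    by apply: d1P => j; apply: le_trans (vu j) _; rewrite ge_min lexx.
  by apply: d2P => j; apply: le_trans (vu j) _; rewrite ge_min lexx orbT.
case: n => [|n] [cf df]; split => //; try exact: C.
move=> j; have [h dh hP] := df j; exists h => // v Uv.
apply: drv_near (hP v Uv).
by apply: filterS (near_upd j oU Uv) => t; exact: fg.
Qed.

Lemma drv_partial f j v a : drv (fun t => f (upd v j t)) (v j) a -> partial j f v = a.
Proof. by move=> [d da]; rewrite /partial derive1E. Qed.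

Lemma partial_ext U f g j v : is_open U -> (forall v, U v -> f v = g v) -> U v ->
  partial j f v = partial j g v.
Proof.
move=> oU fg Uv; rewrite /partial !derive1E; apply: near_eq_derive.
by apply: filterS (near_upd j oU Uv) => t; exact: fg.
Qed.

Lemma diffn_drv n U f j v : diffn n.+1 U f -> U v ->
  drv (fun t => f (upd v j t)) (v j) (partial j f v).
Proof.
by move=> [_ /(_ j)[g _ gP]] Uv; have := gP v Uv => gv; rewrite (drv_partial gv).
Qed.

Lemma diffn_partial n U f j : is_open U -> diffn n.+1 U f -> diffn n U (partial j f).
Proof.
move=> oU [_ /(_ j)[g dg gP]]; apply: diffn_ext oU _ dg => v Uv.
exact/esym/drv_partial/gP.
Qed.

Lemma continuous_pt_cst c v : continuous_pt (fun=> c) v.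
Proof. by move=> e e0; exists 1 => // u _; rewrite subrr normr0 ltW. Qed.

Lemma continuous_ptD f g v : continuous_pt f v -> continuous_pt g v ->
  continuous_pt (fun u => f u + g u) v.
Proof.
move=> cf cg e e0; have e2 : 0 < e / 2 by rewrite divr_gt0.
have [d1 d10 d1P] := cf _ e2; have [d2 d20 d2P] := cg _ e2.
exists (Num.min d1 d2); first by rewrite lt_min d10.
move=> u vu.
have h1 : `|f v - f u| <= e / 2.
  by apply: d1P => j; apply: le_trans (vu j) _; rewrite ge_min lexx.
have h2 : `|g v - g u| <= e / 2.
  by apply: d2P => j; apply: le_trans (vu j) _; rewrite ge_min lexx orbT.
have -> : f v + g v - (f u + g u) = (f v - f u) + (g v - g u) by ring.
by have := ler_normD (f v - f u) (g v - g u); lra.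
Qed.

Lemma continuous_pt_comp (F : R -> R) f v : {for f v, continuous F} ->
  continuous_pt f v -> continuous_pt (fun u => F (f u)) v.
Proof.
move=> /cvgrPdist_le cF cf e e0; have /nbhs_ballP[r /= r0 rP] := cF e e0.
have r2 : 0 < r / 2 by rewrite divr_gt0.
have [d1 d10 d1P] := cf _ r2; exists d1 => // u vu; apply: rP.
by rewrite /ball/=; have := d1P u vu; lra.
Qed.

Lemma continuous_ptM f g v : continuous_pt f v -> continuous_pt g v ->
  continuous_pt (fun u => f u * g u) v.
Proof.
move=> cf cg e e0.
pose B := `|f v| + `|g v| + 1.
have B0 : 0 < B by rewrite /B ltr_wpDl// addr_ge0.
pose e' := Num.min 1 (e / (2 * B)).
have e'0 : 0 < e' by rewrite /e' lt_min ltr01 divr_gt0// mulr_gt0.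
have [d1 d10 d1P] := cf _ e'0; have [d2 d20 d2P] := cg _ e'0.
exists (Num.min d1 d2); first by rewrite lt_min d10.
move=> u vu.
have h1 : `|f v - f u| <= e'.
  by apply: d1P => j; apply: le_trans (vu j) _; rewrite ge_min lexx.
have h2 : `|g v - g u| <= e'.
  by apply: d2P => j; apply: le_trans (vu j) _; rewrite ge_min lexx orbT.
have e'1 : e' <= 1 by rewrite /e' ge_min lexx.
have e'B : e' * (2 * B) <= e by rewrite -ler_pdivlMr ?mulr_gt0// /e' ge_min lexx orbT.
have -> : f v * g v - f u * g u = (f v - f u) * g u + f v * (g v - g u) by ring.
apply: le_trans (ler_normD _ _) _; rewrite !normrM.
have gu : `|g u| <= B.
  have := ler_normB (g v) (g v - g u); rewrite subKr /B.
  by have := normr_ge0 (f v); lra.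
have fv : `|f v| <= B by rewrite /B; have := normr_ge0 (g v); lra.
apply: le_trans e'B; rewrite mulrCA mulr_natl mulr2n.
apply: lerD; first exact: ler_pM.
by rewrite mulrC; apply: ler_pM.
Qed.

Lemma diffn_cst n U c : diffn n U (fun=> c).
Proof.
elim: n c => [|n IH] c; (split; first by move=> v _; exact: continuous_pt_cst) => //.
by move=> j; exists (fun=> 0) => // v _; exact: drv_cst.
Qed.

Lemma diffn_proj n U i : diffn n U (fun v => v i).
Proof.
have C v : U v -> continuous_pt (fun v => v i) v by move=> _ e e0; exists e.
case: n => [|n]; split => // j.
exists (fun=> (j == i)%:R); first exact: diffn_cst.
by move=> v _; exact: drv_proj.
Qed.

Lemma diffnD n U f g : diffn n U f -> diffn n U g -> diffn n U (fun v => f v + g v).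
Proof.
elim: n f g => [|n IH] f g [cf df] [cg dg]; split => //;
  try by move=> v Uv; apply: continuous_ptD; [exact: cf|exact: cg].
move=> j; have [f' df' f'P] := df j; have [g' dg' g'P] := dg j.
exists (fun v => f' v + g' v); first exact: IH.
by move=> v Uv; apply: drvD; [exact: f'P|exact: g'P].
Qed.

Lemma diffnM n U f g : diffn n U f -> diffn n U g -> diffn n U (fun v => f v * g v).
Proof.
elim: n f g => [|n IH] f g; first move=> [cf _] [cg _].
  by split => // v Uv; apply: continuous_ptM; [exact: cf|exact: cg].
move=> Df Dg; split.
  by move=> v Uv; apply: continuous_ptM; [exact: (diffn_continuous Df)|exact: (diffn_continuous Dg)].
move=> j; have [_ /(_ j)[f' df' f'P]] := Df; have [_ /(_ j)[g' dg' g'P]] := Dg.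
exists (fun v => f' v * g v + f v * g' v).
  by apply: diffnD; apply: IH => //; exact: diffnW.
by move=> v Uv; have := drvM (f'P v Uv) (g'P v Uv); rewrite !updK.
Qed.

Lemma diffn_sum n U (I : Type) (r : seq I) (P : pred I) (F : I -> (J -> R) -> R) :
  (forall x, diffn n U (F x)) -> diffn n U (fun v => \sum_(x <- r | P x) F x v).
Proof.
move=> cF; elim: r => [|i r IH].
  by under eq_fun do rewrite big_nil; exact: diffn_cst.
under eq_fun do rewrite big_cons; case: (P i) => //.
exact: diffnD.
Qed.

Lemma diffn_prod n U (I : Type) (r : seq I) (P : pred I) (F : I -> (J -> R) -> R) :
  (forall x, diffn n U (F x)) -> diffn n U (fun v => \prod_(x <- r | P x) F x v).
Proof.
move=> cF; elim: r => [|i r IH].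
  by under eq_fun do rewrite big_nil; exact: diffn_cst.
under eq_fun do rewrite big_cons; case: (P i) => //.
exact: diffnM.
Qed.

Definition smooth1 (D : set R) (F : R -> R) : Prop :=
  forall n x, D x -> derivable (F^`(n)%classic) x 1.

Lemma smooth1_derive D F : smooth1 D F -> smooth1 D (F^`()%classic).
Proof. by move=> sF n x Dx; rewrite -derive1Sn; exact: sF. Qed.

Lemma smooth1_drv D F x : smooth1 D F -> D x -> drv F x (F^`()%classic x).
Proof. by move=> /(_ 0%N x) + Dx => /(_ Dx) dF; split => //; rewrite derive1E. Qed.

Lemma diffn_comp n U D F f : (forall v, U v -> D (f v)) -> smooth1 D F ->
  diffn n U f -> diffn n U (fun v => F (f v)).
Proof.
move=> UD; elim: n F => [|n IH] F sF df.
  split => // v Uv; apply: continuous_pt_comp; last exact: (diffn_continuous df).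
  apply: differentiable_continuous; apply/derivable1_diffP.
  by have [] := smooth1_drv sF (UD v Uv).
split => [v Uv|j].
  apply: continuous_pt_comp; last exact: (diffn_continuous df).
  apply: differentiable_continuous; apply/derivable1_diffP.
  by have [] := smooth1_drv sF (UD v Uv).
have [_ /(_ j)[f' df' f'P]] := df.
exists (fun v => F^`()%classic (f v) * f' v).
  by apply: diffnM => //; apply: IH; [exact: smooth1_derive|exact: diffnW].
move=> v Uv; apply: (@drv_comp _ F (fun t => f (upd v j t))); last exact: f'P.
by rewrite updK; apply: smooth1_drv sF _; exact: UD.
Qed.

Lemma smooth_diffn (U : set {ptws J -> R}) g n : smooth_on U g -> diffn n (U : set (J -> R)) g.
Proof.
move=> sg.
have H : forall js, diffn n (U : set (J -> R)) (partials js g).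
  elim: n => [|n IH] js; split => //.
  - move=> v /(sg js)[cg _] e e0; have /cvgrPdist_le/(_ e e0) := cg.
    by move=> /ptws_nbhsP[d d0 dP]; exists d.
  - move=> v /(sg js)[cg _] e e0; have /cvgrPdist_le/(_ e e0) := cg.
    by move=> /ptws_nbhsP[d d0 dP]; exists d.
  - move=> j; exists (partials (j :: js) g); first exact: IH.
    move=> v /(sg js)[_ /(_ j) dg]; split => //.
    by rewrite /= /partial derive1E.
exact: (H [::]).
Qed.

End LocalCalculus.

Section SmoothFunctions.
Variable R : realType.

Lemma smooth1_expR : smooth1 setT (@expR R).
Proof.
move=> n x _; suff -> : (@expR R)^`(n)%classic = @expR R by [].
elim: n => // n IH; rewrite derive1Sn -[RHS]IH; congr (_^`(n)%classic).
by apply/funext => y; rewrite derive1E; have [_ ->] := drv_expR y.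
Qed.

Lemma drv_inv_pow (x : R) n : 0 < x ->
  drv (fun y => y^-1 ^+ n.+1) x (- (n.+1%:R) * x^-1 ^+ n.+2).
Proof.
move=> x0; have D1 : drv (@GRing.inv R) x (- x^-1 ^+ 2).
  have x_neq0 : x != 0 by rewrite gt_eqF.
  have := @is_deriveV R id x 1 1 x_neq0 (is_derive_id _ _).
  by move=> /drv_eq; apply; rewrite /GRing.scale/= mulr1 exprVn.
elim: n => [|n IH]; first by apply: drv_eq (D1) _; rewrite mulN1r.
rewrite (_ : (fun y => _) = fun y => y^-1 * y^-1 ^+ n.+1); last first.
  by apply/funext => y; rewrite -exprS.
apply: drv_eq (drvM D1 IH) _; rewrite -(natr1 n.+1) !exprS.
by move: x^-1 (x^-1 ^+ n) (n.+1%:R) => y z c; ring.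
Qed.

Lemma smooth1_inv : smooth1 [set x : R | 0 < x] (@GRing.inv R).
Proof.
have pos (x : R) : 0 < x -> \forall t \near x, 0 < t by move=> x0; exact: (cvgr_gt x cvg_id).
(* The derivative of order n of the inverse at positive y. *)
pose F n (y : R) : R := (-1) ^+ n * n`!%:R * y^-1 ^+ n.+1.
have dF n x : 0 < x -> drv (F n) x (F n.+1 x).
  move=> x0; apply: drv_eq (drvZ _ (drv_inv_pow n x0)) _.
  rewrite /F [(-1) ^+ n.+1]exprS factS natrM.
  by move: (x^-1 ^+ _) ((-1) ^+ n) (n.+1%:R : R) (n`!%:R : R) => y z c e; ring.
have E n (x : R) : 0 < x -> (@GRing.inv R)^`(n)%classic x = F n x.
  elim: n x => [|n IH] x x0; first by rewrite derive1n0 /F expr0 !mul1r expr1.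
  rewrite derive1nS derive1E.
  suff [_ ->] : drv ((@GRing.inv R)^`(n)%classic) x (F n.+1 x) by [].
  by apply: drv_near (dF n x x0); apply: filterS (pos x x0) => y y0; rewrite IH.
move=> n x x0.
suff [] : drv ((@GRing.inv R)^`(n)%classic) x (F n.+1 x) by [].
by apply: drv_near (dF n x x0); apply: filterS (pos x x0) => y y0; rewrite E.
Qed.

End SmoothFunctions.

(** * Functions of forms with nilpotent parts of square zero *)

Section GrassmannCalculus.
Variables (R : realType) (G J : finType).
Local Notation Gr := (grassmann R G).
Local Notation upd v i t := (@dfwith _ (fun=> R) v i t).
Implicit Types (U : set (J -> R)) (f g : (J -> R) -> R) (u v : J -> R) (i j : J)
  (F : R -> R) (V W H : Gr) (l : seq J).

Lemma partials_unit F k (v : unit -> R) :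
  partials (nseq k tt) (fun v : unit -> R => F (v tt)) v = F^`(k)%classic (v tt).
Proof.
elim: k v => [|k IH] v; first by rewrite derive1n0.
rewrite derive1nS -[LHS]/(derive1 (fun t => partials (nseq k tt)
  (fun v : unit -> R => F (v tt)) (@dfwith _ (fun=> R) v tt t)) (v tt)).
by congr (derive1 _ _); apply/funext => t; rewrite IH dfwithin.
Qed.

Lemma gcalc1E F H : gcalc1 F H = taylor (fun k => F^`(k)%classic (body H)) (H - (body H)%:A).
Proof.
rewrite /gcalc1 /gcalc /taylor (reindex (fun k : 'I_#|G|.+1 => [ffun _ : unit => k])) /=.
  apply: eq_bigr => k _; rewrite !(big_pred1 tt) ?ffunE//; try by case.
  congr ((_ * _) *: _).
  rewrite (_ : enum (unit : finType) = [:: tt]); last by rewrite enumT unlock.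
  by rewrite [flatten _]/= cats0 ffunE partials_unit.
exists (fun alpha : {ffun unit -> 'I_#|G|.+1} => alpha tt) => [k _|alpha _].
  by rewrite ffunE.
by apply/ffunP => -[]; rewrite ffunE.
Qed.

Lemma gcalc1A F c : gcalc1 F (c%:A : Gr) = (F c)%:A.
Proof. by rewrite gcalc1E bodyA subrr taylor0 derive1n0. Qed.

Lemma gcalc1D_sqr0 F V W : central W -> W * W = 0 -> body W = 0 ->
  gcalc1 F (V + W) = gcalc1 F V + W * gcalc1 (F^`()%classic) V.
Proof.
move=> cW W2 W0; rewrite !gcalc1E bodyD W0 addr0 addrAC.
rewrite (taylorD_sqr0 _ cW W2 (body_subA _) W0).
congr (_ + W * _); apply: eq_bigr => k _; congr ((_ * _) *: _).
exact: (congr1 (fun h => h (body V)) (derive1Sn F k)).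
Qed.

Variable W : J -> Gr.
Hypothesis eW : forall i, even_elt (W i).
Hypothesis W_sqr0 : forall i, W i * W i = 0.
Hypothesis bodyW : forall i, body (W i) = 0.

Let cW i : central (W i). Proof. exact: (eW i).1. Qed.

(* The value at the forms [v j + W j] of a function of the variables in [l],
   the other variables being set to [v]. *)
Fixpoint expansion l f v : Gr :=
  if l is i :: l' then expansion l' f v + W i * expansion l' (partial i f) v else (f v)%:A.

Lemma even_expansion l f v : even_elt (expansion l f v).
Proof.
elim: l f => [|i l IH] f /=; first exact: evenA.
by apply: evenD => //; exact: evenM.
Qed.

(** Differentiates first in the head of the list, whereas [partials] starts from its end; this is
    why reversed enumerations occur below. *)
Definition derives l f : (J -> R) -> R := foldl (fun h i => partial i h) f l.

Lemma expansion_sets l f v : uniq l -> expansion l f v =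
  \sum_(A : {set J} | A \subset l)
    derives [seq i <- l | i \in A] f v *: \prod_(i <- l | i \in A) W i.
Proof.
elim: l f => [|i l IH] f /=.
  move=> _; rewrite (big_pred1 finset.set0) ?big_nil//.
  by move=> A; rewrite /= -finset.subset0; apply: eq_subset_r => j; rewrite finset.in_set0.
move=> /andP[il ul]; rewrite sum_subsets_cons// !IH//; congr (_ + _).
  apply: eq_bigr => A /fintype.subsetP Al; rewrite big_cons.
  by rewrite (_ : (i \in A) = false)//; apply/negbTE/negP => /Al; apply/negP.
rewrite mulr_sumr; apply: eq_bigr => A /fintype.subsetP Al.
rewrite big_cons finset.setU11 -scalerAr.
have E : {in l, forall j, (j \in (i |: A)%SET) = (j \in A)}.
  move=> j jl; rewrite finset.in_setU1; case: eqP => // ji.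
  by rewrite -ji jl in il.
congr (_ *: (_ * _)); first by rewrite /= (eq_in_filter E).
by rewrite big_seq_cond [RHS]big_seq_cond; apply: eq_bigl => j; case: (boolP (j \in l)) => //= /E ->.
Qed.

(** As W_i^2 = 0, only the exponents 0 and 1 survive in the Taylor expansion; the truncation at #|G|
    > 0 retains both. *)
Lemma gcalc_expansion g v : (0 < #|G|)%N ->
  gcalc g (fun j => (v j)%:A + W j) = expansion (rev (enum J)) g v.
Proof.
move=> G0; rewrite expansion_sets; last by rewrite rev_uniq enum_uniq.
have bE j : body ((v j)%:A + W j) = v j by rewrite bodyD bodyA bodyW addr0.
rewrite /gcalc; case: #|G| G0 => // n _.
under eq_bigr do under [X in _ *: X]eq_bigr do rewrite bE addrAC subrr add0r.
rewrite sum_ffun_le1; last first.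
  move=> alpha j aj; rewrite (_ : \prod_j _ = 0) ?scaler0//.
  rewrite (@prod_centralD1 _ _ _ _ _ _ j) ?mem_index_enum ?index_enum_uniq//.
    by move: aj; case: (nat_of_ord _) => [|[|m]]//= _; rewrite !exprS mulrA W_sqr0 !mul0r.
  by move=> i; exact: (evenX _ (eW i)).1.
apply: eq_big => [A|A _].
  by apply/esym/fintype.subsetP => i _; rewrite mem_rev mem_enum.
have e01 j : ([ffun j => inord (j \in A)] : {ffun J -> 'I_n.+2}) j = (j \in A) :> nat.
  by rewrite ffunE inordK//; case: (_ \in _).
congr (_ *: _).
  rewrite big1 ?invr1 ?mul1r => [|j _]; last by rewrite e01; case: (_ \in _).
  rewrite /derives filter_rev foldl_rev /partials.
  rewrite (_ : (fun j => body _) = v); last by apply/funext => j; exact: bE.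
  congr (foldr _ _ _ _); elim: (enum J) => //= j l IH.
  by rewrite IH e01; case: (_ \in _).
rewrite prod_central_rev// [RHS]big_mkcond/= [index_enum J]unlock -enumT.
by apply: eq_bigr => j _; rewrite e01; case: (_ \in _); rewrite ?expr1 ?expr0.
Qed.

Variable U : set (J -> R).
Hypothesis oU : is_open U.

Lemma expansion_ext l f g v : (forall v, U v -> f v = g v) -> U v ->
  expansion l f v = expansion l g v.
Proof.
elim: l f g => [|i l IH] f g fg Uv /=; first by rewrite fg.
have E : expansion l (partial i f) v = expansion l (partial i g) v.
  by apply: IH => // u Uu; exact: (partial_ext i oU fg Uu).
by rewrite E (IH f g fg Uv).
Qed.

Lemma expansionD l f g v : diffn (size l) U f -> diffn (size l) U g -> U v ->
  expansion l (fun v => f v + g v) v = expansion l f v + expansion l g v.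
Proof.
elim: l f g => [|i l IH] f g df dg Uv /=; first by rewrite scalerDl.
have E : expansion l (partial i (fun v => f v + g v)) v =
    expansion l (partial i f) v + expansion l (partial i g) v.
  rewrite -(IH _ _ (diffn_partial i oU df) (diffn_partial i oU dg) Uv).
  apply: expansion_ext => // u Uu; apply: drv_partial.
  by apply: drvD; [exact: (diffn_drv i df Uu)|exact: (diffn_drv i dg Uu)].
by rewrite E (IH _ _ (diffnW df) (diffnW dg) Uv) mulrDr addrACA.
Qed.

(** Multiplicativity: the product rule gives the terms of first order in W_i, and the term of second
    order contains W_i^2 = 0. *)
Lemma expansionM l f g v : diffn (size l) U f -> diffn (size l) U g -> U v ->
  expansion l (fun v => f v * g v) v = expansion l f v * expansion l g v.
Proof.
elim: l f g => [|i l IH] f g df dg Uv /=.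
  by rewrite -scalerAl mul1r scalerA.
have df' := diffn_partial i oU df; have dg' := diffn_partial i oU dg.
have df0 := diffnW df; have dg0 := diffnW dg.
have E : expansion l (partial i (fun v => f v * g v)) v =
    expansion l (partial i f) v * expansion l g v + expansion l f v * expansion l (partial i g) v.
  rewrite -(IH _ _ df' dg0 Uv) -(IH _ _ df0 dg' Uv).
  rewrite -(expansionD (diffnM df' dg0) (diffnM df0 dg') Uv).
  apply: expansion_ext => // u Uu; apply: drv_partial.
  by have := drvM (diffn_drv i df Uu) (diffn_drv i dg Uu); rewrite !updK.
rewrite E (IH _ _ df0 dg0 Uv).
set a := expansion l f v; set b := expansion l g v.
set a' := expansion l (partial i f) v; set b' := expansion l (partial i g) v.
have aW : a * W i = W i * a by rewrite cW.
have -> : (a + W i * a') * (b + W i * b') = a * b + a * (W i * b') + W i * (a' * b).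
  rewrite mulrDl !mulrDr -!mulrA.
  have -> : W i * (a' * (W i * b')) = 0.
    by rewrite [a' * _]mulrA -[a' * W i]cW !mulrA W_sqr0 !mul0r.
  by rewrite addr0.
by rewrite mulrDr -addrA [W i * (a' * b) + _]addrC [a * (W i * b')]mulrA aW mulrA.
Qed.

Lemma expansion_cst l c v : expansion l (fun=> c) v = c%:A.
Proof.
elim: l c => [|i l IH] c //=.
have -> : partial i (fun=> c) = fun=> 0.
  by apply/funext => u; apply: drv_partial; exact: drv_cst.
by rewrite !IH scale0r mulr0 addr0.
Qed.

Lemma expansion_proj l j v : uniq l -> j \in l ->
  expansion l (fun v => v j) v = (v j)%:A + W j.
Proof.
have H i l' : expansion l' (partial i (fun v => v j)) v = ((i == j)%:R : R)%:A.
  rewrite (_ : partial i _ = fun=> (i == j)%:R) ?expansion_cst//.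
  by apply/funext => u; apply: drv_partial; exact: drv_proj.
have N l' : j \notin l' -> expansion l' (fun v => v j) v = (v j)%:A.
  elim: l' => //= i l' IH; rewrite inE negb_or eq_sym => /andP[ij jl'].
  by rewrite IH// H (negPf ij) scale0r mulr0 addr0.
elim: l => //= i l IH /andP[il ul]; rewrite inE => /predU1P[ji|jl].
  by rewrite H -ji eqxx scale1r mulr1 N// ji.
rewrite IH// H (_ : (i == j) = false) ?scale0r ?mulr0 ?addr0//.
by apply/negbTE/eqP => ij; rewrite -ij (negPf il) in jl.
Qed.

Lemma expansion_prod l (I : Type) (r : seq I) (f : I -> (J -> R) -> R) v :
  (forall x, diffn (size l) U (f x)) -> U v ->
  expansion l (fun v => \prod_(x <- r) f x v) v = \prod_(x <- r) expansion l (f x) v.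
Proof.
move=> df Uv; elim: r => [|x r IH].
  by under eq_fun do rewrite big_nil; rewrite expansion_cst big_nil scale1r.
under eq_fun do rewrite big_cons; rewrite big_cons expansionM ?IH//.
exact: diffn_prod.
Qed.

(** The chain rule against the exact first-order Taylor formula. The bosonic part of the
    superintegrand thereby becomes the expansion of a single scalar function. *)
Lemma gcalc1_expansion l (D : set R) F f v : smooth1 D F -> (forall v, U v -> D (f v)) ->
  diffn (size l) U f -> U v ->
  gcalc1 F (expansion l f v) = expansion l (fun v => F (f v)) v.
Proof.
elim: l F f => [|i l IH] F f sF UD df Uv /=; first exact: gcalc1A.
have df0 := diffnW df; have df' := diffn_partial i oU df.
have sF' := smooth1_derive sF.
have eE := even_expansion l (partial i f) v.
rewrite gcalc1D_sqr0; last 3 first.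
- exact: (evenM (eW i) eE).1.
- by rewrite mulrA -[_ * W i]mulrA eE.1 mulrA W_sqr0 !mul0r.
- by rewrite bodyM bodyW mul0r.
rewrite !IH//; congr (_ + _); rewrite -mulrA; congr (W i * _).
rewrite -expansionM//; last by exact: (diffn_comp UD sF' df0).
apply: expansion_ext => // u Uu; apply/esym/drv_partial.
have dF : drv F (f (upd u i (u i))) (F^`()%classic (f u)).
  by rewrite updK; apply: smooth1_drv sF _; exact: UD.
have := @drv_comp _ F (fun t => f (upd u i t)) _ _ _ dF (diffn_drv i df Uu).
by rewrite mulrC.
Qed.

End GrassmannCalculus.

(** * The superintegrand at a point *)

Section Integrand.
Variables (R : realType) (Lam : finType) (beta : Lam -> Lam -> R).
Hypothesis beta_sym : forall i j, beta i j = beta j i.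
Variables (U : set (Lam -> R)) (g : (Lam -> R) -> R).
Hypothesis oU : is_open U.
Hypothesis U_pos : forall v, U v -> forall i, 0 < v i.
Hypothesis dg : forall n, diffn n U g.
Local Notation C := (Lam * bool)%type.
Local Notation Gr := (grassmann R (Lam + Lam)%type).
Local Notation xi := (@Defs.xi R Lam).
Local Notation eta := (@Defs.eta R Lam).
Implicit Types (i j a b : Lam) (v : Lam -> R) (u : C -> R).

Definition energy v : R := 2^-1 * \sum_i \sum_j beta i j * (1 - v i * v j).

(** K (l^2) as a function of l. *)
Definition density v : R := (\prod_i v i)^-1 * (g v * expR (- energy v)).

Let l := rev (enum Lam).

Lemma diffn_energy n : diffn n U (fun v => - energy v).
Proof.
have -> : (fun v => - energy v) = fun v => (-1) * (2^-1 * \sum_i \sum_j beta i j * (1 + (-1) * (v i * v j))).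
  apply/funext => v; rewrite /energy mulN1r; congr (- (_ * _)).
  by apply: eq_bigr => i _; apply: eq_bigr => j _; rewrite mulN1r.
do 2![apply: diffnM; first exact: diffn_cst].
apply: diffn_sum => i; apply: diffn_sum => j; apply: diffnM; first exact: diffn_cst.
apply: diffnD; first exact: diffn_cst.
apply: diffnM; first exact: diffn_cst.
by apply: diffnM; exact: diffn_proj.
Qed.

Lemma diffn_inv_prod n : diffn n U (fun v => (\prod_i v i)^-1).
Proof.
apply: (@diffn_comp _ _ n U [set x : R | 0 < x] (@GRing.inv R)).
- by move=> v Uv; rewrite /= prodr_gt0// => i _; exact: U_pos.
- exact: smooth1_inv.
- by apply: diffn_prod => i; exact: diffn_proj.
Qed.

Lemma diffn_density n : diffn n U density.
Proof.
apply: diffnM; first exact: diffn_inv_prod.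
apply: diffnM; first exact: dg.
apply: (@diffn_comp _ _ n U setT (@expR R)) => //; first exact: smooth1_expR.
exact: diffn_energy.
Qed.

Section AtPoint.
Variable u : C -> R.
Let rho : Lam -> R := fun i => Num.sqrt (sq u i).
Hypothesis u_disc : forall i, 0 < sq u i.
Hypothesis Urho : U rho.

Let W i : Gr := (rho i)^-1 *: om R i.

Let eW i : even_elt (W i). Proof. by apply: evenZ; exact: even_om. Qed.

Let W_sqr0 i : W i * W i = 0.
Proof. by rewrite /W -scalerAl -scalerAr om_sqr0 !scaler0. Qed.

Let bodyW i : body (W i) = 0.
Proof. by rewrite /W bodyZ body_generatorM mulr0. Qed.

Lemma drv_sqrt (x : R) : 0 < x -> drv Num.sqrt x (2 * Num.sqrt x)^-1.
Proof. by move=> x0; exact: is_derive1_sqrt. Qed.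

(** The square root of s + 2 xi eta is sqrt s + xi eta / sqrt s, because the square of xi eta is
    zero. *)
Lemma zform_pt i : zform i (pt u) = (rho i)%:A + W i.
Proof.
rewrite /zform -/(sq u i) gcalc1D_sqr0.
- rewrite !gcalc1A -/(rho i); congr (_ + _).
  rewrite derive1E; have [_ ->] := drv_sqrt (u_disc i).
  rewrite -scalerAr mulr1 scalerA /W -/(om R i); congr (_ *: _).
  rewrite -/(rho i) invfM mulrAC mulVf ?mul1r//.
- by apply: (evenZ _ (even_om R i)).1.
- by rewrite -scalerAl -scalerAr -/(om R i) om_sqr0 !scaler0.
- by rewrite bodyZ body_generatorM mulr0.
Qed.

Local Notation expansion := (expansion W).

Lemma zform_expansion i : zform i (pt u) = expansion l (fun v => v i) rho.
Proof.
by rewrite zform_pt expansion_proj// ?rev_uniq ?enum_uniq// mem_rev mem_enum.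
Qed.

Lemma gcalc_zform a : gcalc g (fun i => zform i (pt u)) = expansion l g rho.
Proof.
rewrite (_ : (fun i => _) = fun i => (rho i)%:A + W i); last by apply/funext => i; exact: zform_pt.
rewrite gcalc_expansion// card_sum addn_gt0; apply/orP; left.
by apply/card_gt0P; exists a.
Qed.

Lemma inv_prod_zform : gcalc1 GRing.inv (\prod_i zform i (pt u)) =
  expansion l (fun v => (\prod_i v i)^-1) rho.
Proof.
rewrite (eq_bigr (fun i => expansion l (fun v => v i) rho)); last first.
  by move=> i _; exact: zform_expansion.
rewrite -(expansion_prod eW W_sqr0 oU)//; last by move=> i; exact: diffn_proj.
apply: (gcalc1_expansion eW W_sqr0 bodyW oU (@smooth1_inv R)) => //.
  by move=> v Uv; rewrite /= prodr_gt0// => i _; exact: U_pos.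
by apply: diffn_prod => i; exact: diffn_proj.
Qed.

(** Each summand N is central of square zero, so that exp (V - N) = (1 - N) exp V. *)
Lemma gcalc1_expR_gexp (V : Gr) :
  gcalc1 expR (V - \sum_(p : Lam * Lam) beta p.1 p.2 *: (xi p.1 * eta p.2)) =
  gexp beta * gcalc1 expR V.
Proof.
rewrite /gexp; elim: (index_enum _) V => [|p s IH] V.
  by rewrite !big_nil subr0 mul1r.
have eN q : even_elt (- (beta q.1 q.2 *: (xi q.1 * eta q.2))).
  by apply: evenN; apply: evenZ; exact: even_xi_eta.
rewrite !big_cons opprD addrCA addrC gcalc1D_sqr0.
- have -> : (@expR R)^`()%classic = expR.
    by apply/funext => x; rewrite derive1E; have [_ ->] := drv_expR x.
  by rewrite IH -[RHS]mulrA [RHS]mulrDl mul1r.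
- exact: (eN p).1.
- by rewrite mulrNN -scalerAl -scalerAr generatorM_sqr0 !scaler0.
- by rewrite bodyN bodyZ body_generatorM mulr0 oppr0.
Qed.

Lemma expansionZ c f : diffn (size l) U f ->
  expansion l (fun v => c * f v) rho = c *: expansion l f rho.
Proof.
move=> df; rewrite (expansionM eW W_sqr0 oU (diffn_cst _ _ c) df Urho).
by rewrite expansion_cst -scalerAl mul1r.
Qed.

Lemma expansion_sum (I : Type) (r : seq I) (f : I -> (Lam -> R) -> R) :
  (forall x, diffn (size l) U (f x)) ->
  expansion l (fun v => \sum_(x <- r) f x v) rho = \sum_(x <- r) expansion l (f x) rho.
Proof.
move=> df; elim: r => [|x r IH].
  by under eq_fun do rewrite big_nil; rewrite expansion_cst big_nil scale0r.
under eq_fun do rewrite big_cons; rewrite big_cons.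
by rewrite (expansionD _ oU) ?IH//; exact: diffn_sum.
Qed.

Lemma opp_hamiltonian : - hamiltonian beta (pt u) =
  expansion l (fun v => S0 beta u - energy v) rho -
  \sum_(p : Lam * Lam) beta p.1 p.2 *: (xi p.1 * eta p.2).
Proof.
pose b (p : Lam * Lam) := beta p.1 p.2.
pose z i := zform i (pt u).
pose s (p : Lam * Lam) : R := u (p.1, false) * u (p.2, false) + u (p.1, true) * u (p.2, true).
pose T : Gr := \sum_p b p *: (xi p.1 * eta p.2).
have -> : (fun v => S0 beta u - energy v) = fun v =>
    2^-1 * \sum_p b p * (v p.1 * v p.2) + 2^-1 * \sum_p b p * (s p - 1).
  apply/funext => v; rewrite /S0 /energy !pair_big/= -mulrBr -mulrDr; congr (_ * _).
  by rewrite -sumrB -big_split/=; apply: eq_bigr => p _; rewrite /s /b; ring.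
have dM (p : Lam * Lam) n : diffn n U (fun v => v p.1 * v p.2) by apply: diffnM; exact: diffn_proj.
have dZ (p : Lam * Lam) n : diffn n U (fun v => b p * (v p.1 * v p.2)).
  by apply: diffnM => //; exact: diffn_cst.
rewrite (expansionD _ oU)//; last 2 first.
- by apply: diffnM; [exact: diffn_cst|exact: diffn_sum].
- exact: diffn_cst.
rewrite expansion_cst expansionZ; last exact: diffn_sum.
rewrite expansion_sum//.
rewrite (eq_bigr (fun p => b p *: (z p.1 * z p.2))); last first.
  move=> p _; rewrite expansionZ//; congr (_ *: _).
  by rewrite /z !zform_expansion (expansionM eW W_sqr0 oU)//; exact: diffn_proj.
(* By symmetry of beta and anticommutation, both fermionic terms have the same sum; the resulting 2
   cancels the 1/2 of the Hamiltonian. *)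
have antisym : \sum_p b p *: (eta p.1 * xi p.2 - xi p.1 * eta p.2) = - (2%:R *: T).
  rewrite (eq_bigr (fun p => b p *: (eta p.1 * xi p.2) - b p *: (xi p.1 * eta p.2))); last first.
    by move=> p _; rewrite scalerBr.
  rewrite sumrB -/T; have -> : \sum_p b p *: (eta p.1 * xi p.2) = - T.
    rewrite /T -sumrN (reindex_inj (inv_inj (@swap_pairK Lam Lam)))/=.
    apply: eq_bigr => -[i j] _ /=; rewrite /b/= beta_sym -scalerN; congr (_ *: _).
    by rewrite /Defs.eta /Defs.xi generatorC.
  by rewrite -opprD scaler_nat mulr2n.
rewrite /hamiltonian pair_big/= -scalerN -sumrN.
rewrite (eq_bigr (fun p => b p *: (z p.1 * z p.2) + ((b p * (s p - 1))%:A +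
    b p *: (eta p.1 * xi p.2 - xi p.1 * eta p.2)))); last first.
  move=> p _; rewrite -scalerN opprB /udot /xform /yform/= -/(z _) -/(z _).
  rewrite -[_ * _ *: 1]scalerA -!scalerDr; congr (_ *: _).
  rewrite /s scalerBl scale1r !scalerDl.
  rewrite -!scalerAl !mul1r !scalerA.
  by rewrite -!addrA; do 3!congr (_ + _); rewrite addrC [RHS]addrC addrAC.
rewrite !big_split/= antisym !scalerDr scalerN scalerA mulVf// scale1r addrA; congr (_ + _ - _).
by rewrite -scaler_suml scalerA.
Qed.

Lemma exp_hamiltonian : gcalc1 expR (- hamiltonian beta (pt u)) =
  weight beta u *: (gexp beta * expansion l (fun v => expR (- energy v)) rho).
Proof.
rewrite opp_hamiltonian gcalc1_expR_gexp.
rewrite (gcalc1_expansion eW W_sqr0 bodyW oU (@smooth1_expR R))//; last first.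
  by apply: diffnD; [exact: diffn_cst|exact: diffn_energy].
rewrite (_ : (fun v => _) = fun v => weight beta u * expR (- energy v)); last first.
  by apply/funext => v; rewrite expRD.
rewrite expansionZ ?scalerAr//.
apply: (@diffn_comp _ _ _ U setT (@expR R)) => //; first exact: smooth1_expR.
exact: diffn_energy.
Qed.

(** By multiplicativity the even forms merge into the expansion of [density]. Its term of index A
    carries om_A, whose Berezin integral against [gexp] is the minor [coefc]. *)
Lemma berezin_integrand a b :
  berezin (gcalc1 GRing.inv (\prod_i zform i (pt u)) *
    (xform a (pt u) * xform b (pt u) * gcalc g (fun i => zform i (pt u)) *
     gcalc1 expR (- hamiltonian beta (pt u)))) =
  u (a, false) * u (b, false) * weight beta u *
  \sum_(A : {set Lam}) coefc beta A *
    ((\prod_(i in A) (rho i)^-1) * derives [seq i <- l | i \in A] density rho).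
Proof.
have dE : diffn (size l) U (fun v => expR (- energy v)).
  apply: (@diffn_comp _ _ _ U setT (@expR R)) => //; first exact: smooth1_expR.
  exact: diffn_energy.
rewrite inv_prod_zform (gcalc_zform a) exp_hamiltonian.
have -> : expansion l (fun v => (\prod_i v i)^-1) rho *
   (xform a (pt u) * xform b (pt u) * expansion l g rho *
    (weight beta u *: (gexp beta * expansion l (fun v => expR (- energy v)) rho))) =
   (u (a, false) * u (b, false) * weight beta u) *: (expansion l density rho * gexp beta).
  rewrite (expansionM eW W_sqr0 oU (diffn_inv_prod _) (diffnM (dg _) dE) Urho).
  rewrite (expansionM eW W_sqr0 oU (dg _) dE Urho).
  have -> : xform a (pt u) * xform b (pt u) * expansion l g rho =
      (u (a, false) * u (b, false)) *: expansion l g rho.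
    by rewrite /xform -scalerAl mul1r scalerA -scalerAl mul1r.
  rewrite -scalerAl -!scalerAr scalerA; congr (_ *: _).
  by rewrite -!mulrA -(even_gexp beta).1.
rewrite berezinZ; congr (_ * _).
rewrite expansion_sets//; last by rewrite rev_uniq enum_uniq.
rewrite mulr_suml berezin_sum.
apply: eq_big => [A|A _].
  by apply/fintype.subsetP => i _; rewrite mem_rev mem_enum.
rewrite prod_central_rev; last by move=> i; exact: (eW i).1.
rewrite prodZ_central -scalerAl -scalerAl !berezinZ -/(om_set R A) -/(coefc beta A).
rewrite mulrC [X in X * _]mulrC mulrA; congr (_ * _ * _).
by rewrite big_enum_cond/=.
Qed.

End AtPoint.
End Integrand.

(** * Reduction of the superexpectation *)

Section Compactness.
Variables (R : realType) (J : finType).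
Implicit Types (K : set {ptws J -> R}) (f : (J -> R) -> R) (u v : J -> R) (j : J).

Lemma near_ptws (P : R -> (J -> R) -> Prop) (p : {ptws J -> R}) :
  (exists2 d : R, 0 < d & forall u h, close d p u -> 0 < h <= d -> P h u) ->
  \forall u \near p & h \near 0^'+, P h u.
Proof.
move=> [d d0 dP].
exists ([set u | close d p u], [set h : R | 0 < h <= d]) => /=.
  split; first by apply/ptws_nbhsP; exists d.
  near=> h; apply/andP; split; first by near: h; exact: nbhs_right_gt.
  by near: h; exact: nbhs_right_le.
by move=> [u h] [/= pu hd]; exact: dP.
Unshelve. all: by end_near. Qed.

Lemma compact_closed_ptws K : compact K -> closed K.
Proof.
apply: compact_closed; apply: (@hausdorff_product J (fun=> R)) => _.
exact: Rhausdorff.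
Qed.

Lemma compact_positive K : compact K -> (forall v, K v -> forall j, 0 < v j) ->
  exists2 e : R, 0 < e < 1 & forall v, K v -> forall j, e < v j.
Proof.
move=> cK Kpos.
have := (compact_near_coveringP K).1 cK R 0^'+ (fun h v => forall j, h < v j) _.
move=> /(_ _) H.
have {H} : \forall h \near 0^'+, K `<=` (fun v => forall j, h < v j).
  apply: H => v Kv; apply: near_ptws.
  have [d d0 dP] : exists2 d : R, 0 < d & forall j, 2 * d < v j.
    apply: (@finite_witness R J (fun j d => 2 * d < v j)).
      by move=> j x y xv yx; apply: le_lt_trans xv; rewrite ler_pM2l.
    by move=> j; exists (v j / 3); have := Kpos v Kv j; lra.
  exists d => // u h vu /andP[_ hd] j.
  have := dP j; have := vu j; rewrite ler_norml => /andP[_]; lra.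
move=> H; near (0 : R)^'+ => e; exists e; last by near: e.
apply/andP; split; first by near: e; exact: nbhs_right_gt.
by near: e; apply: nbhs_right_lt; exact: ltr01.
Unshelve. all: by end_near. Qed.

(** Heine's theorem, from the formulation of compactness by near coverings. *)
Lemma box_uniformly_continuous f (e : R) (B : set (J -> R)) :
  B = [set v | forall j, e <= v j <= 1] ->
  (forall v, B v -> continuous_pt f v) -> forall eps : R, 0 < eps ->
  exists2 d : R, 0 < d & forall u v, B u -> B v -> close d u v -> `|f u - f v| <= eps.
Proof.
move=> BE cf eps eps0.
have cB : compact (B : set {ptws J -> R}).
  rewrite BE (_ : [set v | _] = [set v : J -> R | forall j, `[e, 1]%classic (v j)]).
    by apply: (@tychonoff J (fun=> (R : topologicalType)) (fun=> `[e, 1]%classic)) => j; exact: segment_compact.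
  by apply/seteqP; split => v /= vP j; have := vP j; rewrite in_itv/=.
have H := (compact_near_coveringP _).1 cB R 0^'+
  (fun h u => forall v, B v -> close h u v -> `|f u - f v| <= eps) _.
have {H} : \forall h \near 0^'+, B `<=`
    (fun u => forall v, B v -> close h u v -> `|f u - f v| <= eps).
  apply: H => p Bp; apply: near_ptws.
  have e2 : 0 < eps / 2 by rewrite divr_gt0.
  have [d d0 dP] := cf p Bp _ e2.
  exists (d / 2); first by rewrite divr_gt0.
  move=> u h pu /andP[_ hd] v Bv uv.
  have fu : `|f p - f u| <= eps / 2 by apply: dP => j; have := pu j; lra.
  have fv : `|f p - f v| <= eps / 2.
    apply: dP => j; have := ler_distD (u j) (p j) (v j).
    have := pu j; have := uv j; lra.
  have := ler_distD (f p) (f u) (f v); rewrite [`|f u - f p|]distrC; lra.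
move=> H; near (0 : R)^'+ => d; exists d; first by near: d; exact: nbhs_right_gt.
move=> u v Bu Bv uv.
have HB : B `<=` (fun u => forall v, B v -> close d u v -> `|f u - f v| <= eps) by near: d.
exact: HB.
Unshelve. all: by end_near. Qed.

(** One side is enough, which matters at the face where a coordinate equals 1: vanishing is known
    inside the unit box only. *)
Lemma drv_left0 (F : R -> R) (x a d : R) : 0 < d -> drv F x a ->
  (forall t, x - d <= t <= x -> F t = 0) -> a = 0.
Proof.
move=> d0 [dF aE] F0; have /cvg_dnbhs_at_left H1 := dF.
have H2 : h^-1 *: (F (h *: 1 + x) - F x) @[h --> 0^'-] --> (0 : R).
  apply: cvg_near_cst; near=> h.
  have h0 : h <= 0 by near: h; exact: nbhs_left_le.
  have hd : - d <= h by near: h; apply: nbhs_left_ge; lra.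
  rewrite !F0 ?subr0 ?scaler0// ?lexx ?andbT; first by lra.
  rewrite /GRing.scale/= mulr1; apply/andP; split; lra.
rewrite -aE; apply: (cvg_unique _ H1 H2).
exact: Rhausdorff.
Unshelve. all: by end_near. Qed.

End Compactness.

(** * Derivatives in the squared variables as test functions *)

Section Extension.
Variables (R : realType) (J : finType).
Variables (U : set (J -> R)) (K : set {ptws J -> R}) (e : R).
Hypothesis oU : is_open U.
Hypothesis boxU : forall v, @unit_box R J v -> U v.
Hypothesis e01 : 0 < e < 1.
Hypothesis Ke : forall v, K v -> forall j, e < v j.
Hypothesis closedK : closed K.
Local Notation upd v i t := (@dfwith _ (fun=> R) v i t).
Implicit Types (f g : (J -> R) -> R) (u v s : J -> R) (i j : J) (r l : seq J) (x y t : R).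

Let e0 : 0 < e. Proof. by case/andP: e01. Qed.

Definition vanish f : Prop := forall v, @unit_box R J v -> ~ K v -> f v = 0.

(** The clamping keeps values in [e, 1], hence inside the domain of g, and makes the square root
    Lipschitz. *)
Definition clamp_sqrt x : R := Num.sqrt (Num.min 1 (Num.max x (e ^+ 2))).

Let e2 : 0 < e ^+ 2 < 1.
Proof. by rewrite exprn_gt0//= expr_lt1 ?ltW//; case/andP: e01. Qed.

Let clamp_pos x : e ^+ 2 <= Num.min 1 (Num.max x (e ^+ 2)) <= 1.
Proof. by rewrite le_min le_max lexx orbT andbT ge_min lexx andbT; case/andP: e2 => _ /ltW. Qed.

Lemma clamp_sqrt_ge x : e <= clamp_sqrt x <= 1.
Proof.
have /andP[h1 h2] := clamp_pos x; apply/andP; split.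
  have : Num.sqrt (e ^+ 2) <= clamp_sqrt x by exact: ler_wsqrtr.
  by rewrite sqrtr_sqr gtr0_norm.
have : clamp_sqrt x <= Num.sqrt 1 by exact: ler_wsqrtr.
by rewrite sqrtr1.
Qed.

Lemma clamp_sqrt_low x : x <= e ^+ 2 -> clamp_sqrt x = e.
Proof.
move=> xe; rewrite /clamp_sqrt max_r// min_r ?sqrtr_sqr ?gtr0_norm//.
by case/andP: e2 => _ /ltW.
Qed.

Lemma clamp_sqrt_mid x : e ^+ 2 <= x <= 1 -> clamp_sqrt x = Num.sqrt x.
Proof. by move=> /andP[ex x1]; rewrite /clamp_sqrt max_l// min_r. Qed.

Lemma clamp_sqrt_lipschitz x y : `|clamp_sqrt x - clamp_sqrt y| <= e^-1 * `|x - y|.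
Proof.
have /andP[hx1 hx2] := clamp_pos x; have /andP[hy1 hy2] := clamp_pos y.
have /andP[cx _] := clamp_sqrt_ge x; have /andP[cy _] := clamp_sqrt_ge y.
have D : `|Num.min 1 (Num.max x (e ^+ 2)) - Num.min 1 (Num.max y (e ^+ 2))| <= `|x - y|.
  have maxL (a b c : R) : `|Num.max a c - Num.max b c| <= `|a - b|.
    have := ler_norm (a - b); have := ler_norm (- (a - b)); rewrite normrN => h5 h6.
    rewrite ler_norml; case: (leP a c) => h1; case: (leP b c) => h2; apply/andP; split; lra.
  have minL (a b c : R) : `|Num.min c a - Num.min c b| <= `|a - b|.
    have := ler_norm (a - b); have := ler_norm (- (a - b)); rewrite normrN => h5 h6.
    rewrite ler_norml; case: (leP c a) => h1; case: (leP c b) => h2; apply/andP; split; lra.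
  exact: le_trans (minL _ _ _) (maxL _ _ _).
rewrite mulrC ler_pdivlMr//; apply: le_trans D.
have q0 z : 0 <= Num.min 1 (Num.max z (e ^+ 2)).
  by have /andP[h _] := clamp_pos z; apply: le_trans h; exact: sqr_ge0.
rewrite -[in leRHS](sqr_sqrtr (q0 x)) -[in leRHS](sqr_sqrtr (q0 y)) -!/(clamp_sqrt _).
rewrite subr_sqr normrM ler_wpM2l//.
have cy0 : 0 <= clamp_sqrt y by exact: le_trans (ltW e0) cy.
have h : 0 <= clamp_sqrt x + clamp_sqrt y by rewrite addr_ge0// (le_trans (ltW e0)).
by rewrite (ger0_norm h); apply: le_trans cx _; rewrite lerDl.
Qed.

Definition root s : J -> R := fun j => clamp_sqrt (s j).

Lemma root_box s : @unit_box R J (root s).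
Proof.
by move=> j; have /andP[h1 h2] := clamp_sqrt_ge (s j); split => //; exact: lt_le_trans h1.
Qed.

Lemma root_upd s i t : root (upd s i t) = upd (root s) i (clamp_sqrt t).
Proof.
apply/funext => j; rewrite /root; have [->|ji] := eqVneq j i; first by rewrite !dfwithin.
by rewrite !dfwithout// eq_sym.
Qed.

(* The derivative of [f (sqrt s)] in the variables of r, if [f] is the derivative
   of the same function in these variables; the clamping makes it a test
   function. *)
Definition ext r f s : R := (\prod_(j <- r) (2 * clamp_sqrt (s j))^-1) * f (root s).

Lemma cts_root f : (forall v, U v -> continuous_pt f v) -> cts (fun s => f (root s)).
Proof.
move=> cf M eps eps0.
have [d d0 dP] := @box_uniformly_continuous R J f e _ erefl
  (fun v vB => cf v (boxU (fun j => conj (lt_le_trans e0 (proj1 (andP (vB j))))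
    (proj2 (andP (vB j)))))) eps eps0.
exists (e * d); first exact: mulr_gt0.
move=> u v _ _ uv; apply: dP; try by move=> j; exact: clamp_sqrt_ge.
move=> j; apply: le_trans (clamp_sqrt_lipschitz _ _) _.
by rewrite mulrC ler_pdivrMr// mulrC.
Qed.

Lemma cts_ext r f : (forall v, U v -> continuous_pt f v) -> cts (ext r f).
Proof.
move=> cf; apply: ctsM; last exact: cts_root.
apply: cts_prod => j; apply: (@cts_comp1 R J (fun x => (2 * clamp_sqrt x)^-1)); last exact: cts_proj.
move=> M eps eps0; exists (2 * e ^+ 3 * eps); first by rewrite !mulr_gt0 ?exprn_gt0.
move=> x y _ _ xy.
have /andP[cx _] := clamp_sqrt_ge x; have /andP[cy _] := clamp_sqrt_ge y.
have x0 := lt_le_trans e0 cx; have y0 := lt_le_trans e0 cy.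
have -> : (2 * clamp_sqrt x)^-1 - (2 * clamp_sqrt y)^-1 =
    (clamp_sqrt y - clamp_sqrt x) / (2 * (clamp_sqrt x * clamp_sqrt y)).
  by field; rewrite !gt_eqF.
rewrite normrM normfV ler_pdivrMr; last by rewrite normr_gt0 gt_eqF ?mulr_gt0.
rewrite distrC; apply: le_trans (clamp_sqrt_lipschitz _ _) _.
rewrite mulrC ler_pdivrMr//; apply: le_trans xy _.
rewrite gtr0_norm; last by rewrite !mulr_gt0.
have : e ^+ 2 <= clamp_sqrt x * clamp_sqrt y.
  by rewrite expr2; apply: ler_pM => //; exact: ltW.
move=> h; have -> : 2 * e ^+ 3 * eps = eps * (2 * e ^+ 2) * e by ring.
by rewrite ler_pM2r// ler_pM2l// ler_pM2l.
Qed.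

(** Such a coordinate is clamped to e, which all coordinates of points of K exceed. *)
Lemma ext0 r f s : vanish f -> (exists i, s i <= e ^+ 2) -> ext r f s = 0.
Proof.
move=> vf [i si]; rewrite /ext vf ?mulr0//; first exact: root_box.
by move/Ke => /(_ i); rewrite /root clamp_sqrt_low// ltxx.
Qed.

Lemma test_ext r f : vanish f -> (forall v, U v -> continuous_pt f v) -> test_fun (ext r f).
Proof.
move=> vf cf; split; first exact: cts_ext.
by exists (e ^+ 2); [case/andP: e2|move=> s; exact: ext0].
Qed.

(** The complement of K is open, so f vanishes on a segment to the left of v, which stays in the
    unit box; to the right it might leave the box. *)
Lemma vanish_partial i f : diffn 1 U f -> vanish f -> vanish (partial i f).
Proof.
move=> df vf v vB vK.
have : nbhs (v : {ptws J -> R}) (~` K) by apply: open_nbhs_nbhs; split => //; exact: closed_openC.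
move=> /ptws_nbhsP[d d0 dP].
have [vi0 vi1] := vB i.
pose d' := Num.min d (v i / 2).
have d'0 : 0 < d' by rewrite lt_min d0 divr_gt0.
apply: (drv_left0 d'0 (diffn_drv i df (boxU vB))) => t /andP[t1 t2].
have d'd : d' <= d by rewrite ge_min lexx.
have d'v : d' <= v i / 2 by rewrite ge_min lexx orbT.
apply: vf.
  move=> j; have [->|ji] := eqVneq j i; last by rewrite dfwithout 1?eq_sym//; exact: vB.
  rewrite dfwithin; split; last exact: le_trans vi1.
  lra.
apply: dP => j; have [->|ji] := eqVneq j i; last by rewrite dfwithout 1?eq_sym// subrr normr0 ltW.
rewrite dfwithin ger0_norm; lra.
Qed.

Definition below1 s : Prop := forall j, s j <= 1.

Lemma below1_upd s i t : below1 s -> t <= 1 -> below1 (upd s i t).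
Proof.
move=> s1 t1 j; have [->|ji] := eqVneq j i; first by rewrite dfwithin.
by rewrite dfwithout 1?eq_sym.
Qed.

(** The fundamental theorem of calculus from e^2, where the function vanishes, to s_i, with 1 / (2
    sqrt s_i) as the derivative of the square root. Above 1 the clamped root is constant, whence the
    restriction [below1]. *)
Lemma prim_ext i r f : diffn 1 U f -> vanish f -> i \notin r ->
  forall s, below1 s -> prim i (ext (i :: r) (partial i f)) s = ext r f s.
Proof.
move=> df vf ir s s1; have vp := vanish_partial i df vf.
have cp : forall v, U v -> continuous_pt (partial i f) v.
  by have := diffn_partial i oU df => /= -[].
have [tc _] := test_ext (i :: r) vp cp.
have h0 t : t <= e ^+ 2 -> ext (i :: r) (partial i f) (upd s i t) = 0.
  by move=> te; apply: ext0 => //; exists i; rewrite dfwithin.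
have zero y : y <= e ^+ 2 -> rint (-2) y (fun t => ext (i :: r) (partial i f) (upd s i t)) = 0.
  move=> ye; rewrite (@eq_rint _ _ _ _ (fun=> 0)); last first.
    by move=> t /andP[_ ty]; apply: h0; exact: le_trans ye.
  have [l2|l2] := leP (-2) y; last exact: rint_gt.
  by rewrite rint_cst// mul0r.
rewrite /prim.
have [si|si] := leP (s i) (e ^+ 2); first by rewrite zero// ext0//; exists i.
have cse := @cts_section _ _ _ s i tc.
rewrite (@rint_split _ _ (e ^+ 2) _ _ cse) ?ltW//; last first.
  by have /andP[h _] := e2; lra.
rewrite zero// add0r.
pose c := \prod_(j <- r) (2 * clamp_sqrt (s j))^-1.
pose F t := c * f (upd (root s) i (Num.sqrt t)).
have dF t : e ^+ 2 <= t <= s i -> drv F t (ext (i :: r) (partial i f) (upd s i t)).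
  move=> /andP[et ts]; have t0 : 0 < t by case/andP: e2 => h _; exact: lt_le_trans et.
  have tm : e ^+ 2 <= t <= 1 by rewrite et (le_trans ts).
  have Ub : U (upd (root s) i (Num.sqrt t)).
    by rewrite -(clamp_sqrt_mid tm) -root_upd; apply: boxU; exact: root_box.
  have D1 := diffn_drv i df Ub.
  rewrite dfwithin in D1.
  have D2 : drv (fun x => f (upd (root s) i x)) (Num.sqrt t)
      (partial i f (upd (root s) i (Num.sqrt t))).
    by move: D1; under eq_fun do rewrite upd_upd.
  apply: drv_eq (drvZ c (drv_comp D2 (drv_sqrt t0))) _.
  rewrite /ext root_upd (clamp_sqrt_mid tm) big_cons dfwithin (clamp_sqrt_mid tm).
  have -> : \prod_(j <- r) (2 * clamp_sqrt (upd s i t j))^-1 = c.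
    rewrite /c big_seq [RHS]big_seq; apply: eq_bigr => j jr.
    rewrite dfwithout//; apply/eqP => ij; by rewrite ij jr in ir.
  ring.
rewrite (rint_FTC (ltW si) cse dF).
have -> : F (e ^+ 2) = 0.
  rewrite /F sqrtr_sqr gtr0_norm// -[e in upd _ _ e](clamp_sqrt_low (lexx _)) -root_upd.
  rewrite vf ?mulr0//; first exact: root_box.
  by move/Ke => /(_ i); rewrite root_upd dfwithin clamp_sqrt_low// ltxx.
rewrite subr0 /F /ext -/c; congr (_ * f _).
rewrite -(@clamp_sqrt_mid (s i)); last by rewrite (ltW si) s1.
by rewrite -root_upd updK.
Qed.

Lemma ext_perm r r' f : perm_eq r r' -> ext r f = ext r' f.
Proof. by move=> rr; apply/funext => s; rewrite /ext (perm_big _ rr). Qed.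

Lemma diffn_le m n f : (m <= n)%N -> diffn n U f -> diffn m U f.
Proof.
move=> /subnK <-; elim: (n - m)%N => [|k IH] //.
by rewrite addSn => /diffnW.
Qed.

Lemma derives_diffn l n f : diffn (size l + n) U f -> diffn n U (derives l f).
Proof.
elim: l f => [|i l IH] f df //=; apply: IH.
exact: (diffn_partial i oU df).
Qed.

Lemma derives_vanish l f : diffn (size l) U f -> vanish f -> vanish (derives l f).
Proof.
elim: l f => [|i l IH] f df vf //=; apply: IH; first exact: (diffn_partial i oU df).
by apply: vanish_partial => //; exact: diffn_le df.
Qed.

Lemma prims_ext l r f : diffn (size l) U f -> vanish f -> uniq (l ++ r) ->
  forall s, below1 s -> prims l (ext (l ++ r) (derives l f)) s = ext r f s.
Proof.
elim: l r f => [|i l IH] r f df vf //= /andP[ilr ulr] s s1.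
have df1 : diffn 1 U f by exact: diffn_le df.
have ir : i \notin r by move: ilr; rewrite mem_cat negb_or => /andP[].
rewrite -(prim_ext df1 vf ir s1); apply: eq_rint => t /andP[_ ts].
rewrite (@ext_perm (i :: l ++ r) (l ++ i :: r)); last first.
  by rewrite perm_sym -[l ++ i :: r]/(l ++ [:: i] ++ r) perm_catCA.
apply: IH.
- exact: (diffn_partial i oU df).
- exact: vanish_partial.
- by rewrite uniq_catC /= uniq_catC ulr mem_cat orbC -mem_cat ilr.
- by apply: below1_upd => //; exact: le_trans (s1 i).
Qed.

(** The primitives are compared below 1 only, and their left derivatives recover the functions up to
    the value 1. *)
Lemma prim_inj i f g : test_fun f -> test_fun g ->
  (forall s, below1 s -> prim i f s = prim i g s) -> forall s, below1 s -> f s = g s.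
Proof.
move=> tf tg fg s s1.
have D : drv (fun t => prim i f (upd s i t) + (-1) * prim i g (upd s i t)) (s i) (f s + (-1) * g s).
  have D1 := prim_derive i s (s i) tf; have D2 := prim_derive i s (s i) tg.
  rewrite !updK in D1 D2; exact: (drvD D1 (drvZ (-1) D2)).
have := drv_left0 ltr01 D _; rewrite mulN1r => H; apply/eqP; rewrite -subr_eq0; apply/eqP; apply: H.
move=> t /andP[_ ts]; rewrite fg ?mulN1r ?subrr//.
by apply: below1_upd => //; exact: le_trans (s1 i).
Qed.

Lemma prims_inj l f g : test_fun f -> test_fun g ->
  (forall s, below1 s -> prims l f s = prims l g s) -> forall s, below1 s -> f s = g s.
Proof.
elim: l => //= i l IH tf tg fg; apply: IH => //.
by apply: (@prim_inj i); [exact: test_prims|exact: test_prims|].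
Qed.

End Extension.

(** * The superexpectation and the profile in terms of the kernel *)

Section Representation.
Variables (R : realType) (Lam : finType) (beta : Lam -> Lam -> R).
Hypothesis beta_sym : forall i j, beta i j = beta j i.
Variables (g : (Lam -> R) -> R) (U : set (Lam -> R)) (K : set {ptws Lam -> R}) (e : R).
Hypothesis oU : is_open U.
Hypothesis U_pos : forall v, U v -> forall i, 0 < v i.
Hypothesis boxU : forall v, @unit_box R Lam v -> U v.
Hypothesis dg : forall n, diffn n U g.
Hypothesis e01 : 0 < e < 1.
Hypothesis Ke : forall v, K v -> forall j, e < v j.
Hypothesis closedK : closed K.
Hypothesis gK : vanish K g.
Local Notation C := (Lam * bool)%type.
Local Notation ext := (ext e).
Implicit Types (i j a b : Lam) (v s : Lam -> R) (u : C -> R) (A : {set Lam}).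

Let l := rev (enum Lam).
Let G := density beta g.

Let dG n : diffn n U G. Proof. exact: diffn_density. Qed.

Let vG : vanish K G.
Proof. by move=> v vB vK; rewrite /G /density gK// mul0r mulr0. Qed.

Let ul : uniq l. Proof. by rewrite rev_uniq enum_uniq. Qed.

Let vD r : vanish K (derives r G).
Proof. exact: (derives_vanish oU boxU closedK). Qed.

Let cD r v : U v -> continuous_pt (derives r G) v.
Proof. by apply: diffn_continuous; apply: (derives_diffn oU (n := 0)); exact: dG. Qed.

Let tE r r' : test_fun (ext r' (derives r G)).
Proof. by apply: (test_ext boxU e01 Ke); [exact: vD|exact: cD]. Qed.

Lemma extE r f s : ext r f s = (\prod_(j <- r) (2 * clamp_sqrt e (s j))^-1) * f (root e s).
Proof. by []. Qed.

(** The mixed derivative k of K in all the variables. *)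
Definition kernel : (Lam -> R) -> R := ext l (derives l G).

Lemma test_kernel : test_fun kernel.
Proof. exact: tE. Qed.

Lemma prims_kernel s : below1 s -> prims (enum Lam) kernel s = G (root e s).
Proof.
move=> s1; rewrite (@perm_prims _ _ _ l _ test_kernel.1); last first.
  by rewrite /l perm_sym perm_rev.
have := prims_ext oU boxU e01 Ke closedK (dG (size l)) vG (r := [::]).
by rewrite cats0 => /(_ ul s s1); rewrite extE big_nil mul1r.
Qed.

(* Integrating once more in the variables of A avoids interchanging partial
   derivatives. *)
Lemma Kset_kernel A s : below1 s ->
  Kset kernel A s = ext [seq i <- l | i \in A] (derives [seq i <- l | i \in A] G) s.
Proof.
set lA := [seq i <- l | i \in A].
have ulA : uniq lA by exact: filter_uniq.
apply: (@prims_inj R Lam lA) => [| |{}s s1]; first exact: test_Kset test_kernel.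
  exact: tE.
rewrite /Kset -[prims lA _]/(foldr _ _ _) -foldr_cat -/(prims _ _).
rewrite (@perm_prims _ _ _ (enum Lam) _ test_kernel.1); last first.
  apply: uniq_perm; rewrite ?cat_uniq ?ulA ?enum_uniq ?andbT//=.
    apply/hasPn => j; rewrite mem_enum finset.in_setC => jA.
    by rewrite mem_filter (negPf jA).
  move=> j; rewrite mem_cat mem_filter mem_rev !mem_enum finset.in_setC.
  by case: (j \in A).
rewrite prims_kernel//.
have := prims_ext oU boxU e01 Ke closedK (dG (size lA)) vG (r := [::]).
by rewrite cats0 => /(_ ulA s s1) ->; rewrite extE big_nil mul1r.
Qed.

(** The powers of 2 in [corr] absorb the halves from differentiating square roots. If some s_i is
    below e^2, both sides vanish. *)
Lemma ext_sq r u : (forall i, 0 < sq u i) -> (forall f, vanish K f -> 2 ^+ size r * ext r f (sq u) =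
  (\prod_(i <- r) (Num.sqrt (sq u i))^-1) * f (fun i => Num.sqrt (sq u i))).
Proof.
move=> u0 f vf; have s1 i : sq u i <= 1.
  by rewrite /sq; have := sqr_ge0 (u (i, false)); have := sqr_ge0 (u (i, true)); lra.
have [su|/existsNP[i /negP]] := pselect (forall i, e ^+ 2 <= sq u i).
  have rE i : clamp_sqrt e (sq u i) = Num.sqrt (sq u i).
    by apply: clamp_sqrt_mid => //; rewrite su s1.
  have rE' : root e (sq u) = fun i => Num.sqrt (sq u i) by apply/funext => i; exact: rE.
  rewrite extE rE' mulrA; congr (_ * _); elim: r => [|i r IH]; first by rewrite !big_nil mulr1.
  by rewrite !big_cons/= exprS -IH rE invfM; field; rewrite gt_eqF// sqrtr_gt0.
rewrite -ltNge => si; rewrite (ext0 e01 Ke) ?mulr0//; last by exists i; exact: ltW.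
rewrite vf ?mulr0//.
  by move=> j; rewrite sqrtr_gt0; split=> //; rewrite -(@sqrtr1 R) ler_wsqrtr.
move/Ke => /(_ i); have e0 : 0 < e by case/andP: e01.
by rewrite -[e in e < _]gtr0_norm// -sqrtr_sqr ltr_sqrt// => h; have := lt_trans h si; rewrite ltxx.
Qed.

Lemma superexpectation_corr a b :
  superexpectation beta (fun p => xform a p * xform b p * gcalc g (fun i => zform i p)) =
  corr beta a b kernel.
Proof.
rewrite /superexpectation /superintegral /corr; congr (_ * _).
have tK A := test_Kset A test_kernel.
pose h A u := u (a, false) * u (b, false) * (weight beta u * Kset kernel A (sq u)).
have ch A : cts (h A).
  apply: ctsM; first by apply: ctsM; exact: cts_proj.
  by apply: ctsM; [exact: cts_weight|apply: cts_sqc; exact: (tK A).1].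
have cch A : cts (fun u => coefc beta A * h A u) by exact: ctsZ.
rewrite (@disc_integral_Int _ _ (fun u => \sum_(A : {set Lam}) 2 ^+ #|A| * (coefc beta A * h A u))).
- rewrite Int_sum; last by move=> A; exact: ctsZ.
  by apply: eq_bigr => A _; rewrite !IntZ.
- by apply: cts_sum => A; exact: ctsZ.
- move=> u i nd; rewrite big1// => A _; rewrite /h.
  have [_ [d d0 ->]] := tK A; first by rewrite !mulr0.
  exists i; apply: le_trans (ltW d0); move: nd; rewrite /disc /= /sq => /negP; rewrite -leNgt.
  by lra.
move=> u ud.
have u0 i : 0 < sq u i.
  by have := ud i; rewrite /disc /= /sq; lra.
have s1 : below1 (sq u).
  by move=> i; rewrite /sq; have := sqr_ge0 (u (i, false)); have := sqr_ge0 (u (i, true)); lra.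
have rho_box : @unit_box R Lam (fun i => Num.sqrt (sq u i)).
  move=> i; rewrite sqrtr_gt0; split=> //.
  by rewrite -(@sqrtr1 R) ler_wsqrtr.
rewrite (berezin_integrand beta_sym oU U_pos dg u0 (boxU rho_box)).
rewrite mulr_sumr; apply: eq_bigr => A _; rewrite /h Kset_kernel//.
have := ext_sq [seq i <- l | i \in A] u0 (vD [seq i <- l | i \in A]).
have -> : size [seq i <- l | i \in A] = #|A|.
  by rewrite filter_rev size_rev size_filter -sum1_count big_enum_cond/= sum1_card.
have -> : \prod_(i <- [seq i <- l | i \in A]) (Num.sqrt (sq u i))^-1 =
    \prod_(i in A) (Num.sqrt (sq u i))^-1.
  rewrite big_filter (perm_big (enum Lam)); last by rewrite /l perm_rev.
  by rewrite big_enum_cond.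
by rewrite -/l -/G => <-; ring.
Qed.

(** The profile undoes the passage from g to [density]. If some positive v_i is below e, the
    clamping moves the point, but g vanishes both there and at the clamped point. *)
Lemma profile_kernel v : (forall j, v j <= 1) ->
  profile beta (prims (enum Lam) kernel) v = extend_by_zero g v.
Proof.
move=> v1; rewrite /extend_by_zero patchE.
have [v0|v0] := pselect (forall j, 0 < v j); last first.
  have /existsNP[i _] := v0.
  rewrite -(profile_offM beta i) (profile_eq0 beta (test_prims _ test_kernel) v0) mulr0.
  by rewrite memNset// => vB; apply: v0 => j; have [] := vB j.
rewrite mem_set; last by move=> j.
have e0 : 0 < e by case/andP: e01.
have sqE j : sqabsv v j = v j ^+ 2 by rewrite /sqabsv /sqabs gtr0_norm.
have s1 : below1 (sqabsv v).
  by move=> j; rewrite sqE expr_le1// ltW.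
rewrite /profile prims_kernel//.
have [ve|/existsNP[i /negP]] := pselect (forall j, e <= v j).
  have -> : root e (sqabsv v) = v.
    apply/funext => j; rewrite /root clamp_sqrt_mid ?sqE ?sqrtr_sqr ?gtr0_norm//.
    by rewrite -sqE s1 andbT sqE ler_pXn2r// nnegrE ltW.
  rewrite /G /density /envelope -/(energy beta v) expRN.
  have P0 : \prod_j v j != 0 by rewrite gt_eqF// prodr_gt0.
  by field; rewrite P0 gt_eqF// expR_gt0.
rewrite -ltNge => vie.
have rB : @unit_box R Lam (root e (sqabsv v)) by exact: root_box.
rewrite /G /density gK ?mul0r ?mulr0//; last first.
  move/Ke => /(_ i); rewrite /root clamp_sqrt_low ?ltxx// sqE.
  by rewrite ler_pXn2r ?nnegrE ?(ltW e0) ?(ltW (v0 i)) ?(ltW vie).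
apply/esym/gK => //.
by move/Ke => /(_ i) h; have := lt_trans vie h; rewrite ltxx.
Qed.

End Representation.

(** * Comparison *)

Section Comparison.
Context (R : realType) (Lam : finType) d (Omega : measurableType d).
Context (P : probability Omega R) (beta : Lam -> Lam -> R) (a : Lam) (X : R -> Omega -> Lam).
Hypothesis vd : is_vdjp P beta a (fun=> 1) X.
Hypothesis beta_sym : forall i j, beta i j = beta j i.
Implicit Types (t : R) (w : Omega) (i b : Lam) (g k : (Lam -> R) -> R).

Lemma corr_process b k : test_fun k -> corr beta a b k = process_corr P beta X b k.
Proof.
move=> tk; apply/eqP; rewrite -subr_eq0; apply/eqP.
have [C1 C1P] := corr_bound beta a; have [C2 C2P] := process_corr_bound vd.
apply: (@contraction R Lam (fun i k => corr beta a i k - process_corr P beta X i k) beta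
  (C1 + C2)) => //.
- move=> i {}k {}tk; rewrite mulrBr (ward beta_sym a i tk) (process_ward vd beta_sym i tk).
  rewrite (mean_localized beta_sym (test_prim i tk)).
  have -> (x y z : R) : x + z - (y + z) = x - y by ring.
  by rewrite -sumrB; apply: eq_bigr => j _; rewrite mulrBr.
- move=> i {}k B {}tk kB; rewrite mulrDl (le_trans (ler_normB _ _))//.
  by rewrite lerD ?C1P ?C2P.
Qed.

Lemma integral_occupation F b : cts F ->
  (forall w t, #|Lam|%:R < t -> F (left_time X t w) = 0) ->
  (\int[@lebesgue_measure R]_(t in `[0%R, +oo[) (occupation P X F t b)%:E =
   (rint 0 #|Lam|%:R (fun t => occupation P X F t b))%:E)%E.
Proof.
move=> cF F0; pose T : R := #|Lam|%:R; pose f t := occupation P X F (Num.max 0 t) b.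
have cf : continuous f by exact: (occupation_continuous vd).
have -> : rint 0 T (fun t => occupation P X F t b) = rint 0 T f.
  by apply: eq_rint => t /andP[t0 _]; rewrite /f max_r.
rewrite /rint /Rintegral fineK; last first.
  by apply: integrable_fin_num => //; exact: continuous_integrable.
rewrite [LHS]integral_mkcond [RHS]integral_mkcond.
apply: (@eq_integral _ _ _ (@lebesgue_measure R)) => t _.
rewrite !patchE !mem_setE/= !in_itv/= andbT.
case: (leP 0 t) => t0 //=; case: (leP t T) => tT; first by rewrite /f max_r.
transitivity ((Ex P (fun=> 0))%:E); last by rewrite Ex_cst.
rewrite /occupation; congr (_%:E); congr Ex; apply/funext => w.
by rewrite F0 ?mulr0.
Qed.

End Comparison.

Theorem theorem5p11 (R : realType) (Lam : finType)
    (beta : Lam -> Lam -> R)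
    (beta_sym : forall i j, beta i j = beta j i)
    (beta_ge0 : forall i j, 0 <= beta i j)
    (beta_connected : forall i j, connect (fun k l => 0 < beta k l) i j)
    (g : (Lam -> R) -> R)
    (g_smooth : smooth_on_unit_box g)
    (g_compact : compactly_supported_in_unit_box g)
    (a b : Lam)
    (d : measure_display) (Omega : measurableType d)
    (P : probability Omega R) (X : R -> Omega -> Lam)
    (X_vdjp : is_vdjp P beta a (fun=> 1) X) :
  (superexpectation beta
     (fun p => xform a p * xform b p * gcalc g (fun i => zform i p)))%:E =
  (\int[@lebesgue_measure R]_(t in `[0%R, +oo[)
     'E_P[fun w => (extend_by_zero g (remaining (fun=> 1) X t w)
                     * (X t w == b)%:R)%R])%E.
Proof.
have [U0 oU0 [boxU0 sg]] := g_smooth.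
have [K cK [KB g0]] := g_compact.
have [e e01 Ke] : exists2 e : R, 0 < e < 1 & forall v, K v -> forall j, e < v j.
  by apply: (compact_positive cK) => v /KB vB j; have [] := vB j.
(* The domain of g is restricted to positive coordinates, where the inverse of their product is
   smooth as well. *)
pose U : set (Lam -> R) := [set v | U0 v /\ forall j, 0 < v j].
have oU : is_open U.
  move=> v [U0v v0]; have := open_nbhs_nbhs (conj oU0 U0v) => /ptws_nbhsP[d1 d10 d1P].
  have [d2 d20 d2P] : exists2 d2 : R, 0 < d2 & forall j, d2 < v j.
    apply: (@finite_witness R Lam (fun j x => x < v j)).
      by move=> j x y xv yx; exact: le_lt_trans xv.
    by move=> j; exists (v j / 2); have := v0 j; lra.
  exists (Num.min d1 d2); first by rewrite lt_min d10.
  move=> u vu; split.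
    by apply: d1P => j; apply: le_trans (vu j) _; rewrite ge_min lexx.
  move=> j; have : `|v j - u j| <= d2.
    by apply: le_trans (vu j) _; rewrite ge_min lexx orbT.
  by rewrite ler_norml => /andP[_]; have := d2P j; lra.
have U_pos v : U v -> forall i, 0 < v i by move=> [].
have boxU v : @unit_box R Lam v -> U v.
  by move=> vB; split; [exact: boxU0|move=> j; have [] := vB j].
have dg n : diffn n U g.
  have : diffn n (U0 : set (Lam -> R)) g by exact: smooth_diffn.
  by apply: diffn_subset => v [].
have closedK := compact_closed_ptws cK.
rewrite (superexpectation_corr beta_sym oU U_pos boxU dg e01 Ke closedK g0).
have tk := test_kernel beta oU U_pos boxU dg e01 Ke closedK g0.
rewrite (corr_process X_vdjp beta_sym b tk).
pose F := profile beta (prims (enum Lam) (kernel beta g e)).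
have cF : cts F by apply: cts_profile; exact: (test_prims _ tk).1.
rewrite -(integral_occupation X_vdjp b cF).
  apply: eq_integral => t; rewrite inE/= in_itv/= andbT => t0.
  rewrite unlock /occupation /Ex /Rintegral fineK; last first.
    apply: integrable_fin_num => //; apply: bmf_integrable.
    exact: (bmf_occupation X_vdjp).
  apply: eq_integral => w _ /=; congr (_%:E); rewrite mulrC; congr (_ * _).
  rewrite /F (profile_kernel beta oU U_pos boxU dg e01 Ke closedK g0)// => j.
  have /andP[+ _] := @left_time_diff _ _ _ _ _ _ _ _ X_vdjp 0 t w j (ltac:(by rewrite lexx)).
  by rewrite left_time0 subr_ge0.
move=> w t Tt; have t0 : 0 <= t by apply: le_trans (ltW Tt).
rewrite /F -(profile_offM beta a) (profile_eq0 beta (test_prims _ tk)) ?mulr0// => Lp.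
have := sum_left_time X_vdjp w t0; have : 0 <= \sum_j left_time X t w j.
  by apply: sumr_ge0 => j _; exact: ltW.
by move=> h1 h2; move: h1; rewrite h2 subr_ge0 leNgt Tt.
Qed.
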